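(* Let $P,Q\in\mathbb C(z)$ be non-constant rational functions, $n=\deg P$, and let $\gamma\subset\mathbb C$ be a curve containing no poles of $P$ or $Q$. For $j\ge0$ let $I_j(t)=\sum_{i\ge0}m_it^i$ be the generating function of the sequence of moments $$m_i=\int_\gamma P^i(z)Q^j(z)Q'(z)\,dz,\qquad i\ge0.$$ Suppose that the functions $I_j(t)$ are rational for all $j$ with $j_0\le j\le j_0+n-1$, where $j_0\ge0$. Then there exist rational functions $\tilde P,\tilde Q,W$ such that $$P(z)=\tilde P(W(z)),\qquad Q(z)=\tilde Q(W(z)),$$ the curve $W(\gamma)$ is closed, and the poles of $\tilde P$ lie on one side of $W(\gamma)$.
   Context: A curve is an oriented piecewise-smooth curve in $\mathbb C$ (closed or not) having only transversal self-intersections. $W(\gamma)$ is the image curve in $\mathbb{CP}^1$; it is closed if its starting and ending points coincide. Points $x_1,\dots,x_k\in\mathbb{CP}^1$ lie on one side of a curve if the curve is closed and homologous to zero in $\mathbb{CP}^1\setminus\{x_1,\dots,x_k\}$. Poles are taken in $\mathbb{CP}^1$. *)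

(* Defs.v *)
From HB Require Import structures.
From mathcomp Require Import all_boot all_order all_algebra.
From mathcomp Require Import complex.
From mathcomp Require Import all_classical all_reals all_analysis.

Set Implicit Arguments.
Unset Strict Implicit.
Unset Printing Implicit Defensive.

Import Order.TTheory GRing.Theory Num.Theory.
Import numFieldNormedType.Exports.

Local Open Scope classical_set_scope.
Local Open Scope ring_scope.

(* MathComp-Analysis puts the norm topology on the carrier of any structure
   declared as a num(Closed)FieldType, but not on the bare type R[i]; hence
   the type ascription. *)
Definition C (R : realType) : numClosedFieldType := R[i].

(* The Riemann sphere; Some z is the finite point z, None is infinity. *)
Definition CP1 (R : realType) : topologicalType :=
  one_point_compactification (C R).

Definition ratfun (R : realType) : fieldType := {fraction {poly C R}}.

Section RationalFunctions.
Variable R : realType.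
Implicit Types (f : ratfun R) (z : C R).

Definition ratpoly (p : {poly C R}) : ratfun R := FracField.tofrac p.

(* repr f is some pair (n, d) with d != 0 and f = n / d, not necessarily in
   lowest terms; dividing by the gcd makes numerator and denominator coprime,
   see rnum_rden and coprime_rnum_rden. *)
Definition fnum f : {poly C R} := (frac (repr f)).1.
Definition fden f : {poly C R} := (frac (repr f)).2.
Definition rnum f : {poly C R} := fnum f %/ gcdp (fnum f) (fden f).
Definition rden f : {poly C R} := fden f %/ gcdp (fnum f) (fden f).

Definition rdeg f : nat := (maxn (size (rnum f)) (size (rden f))).-1.

Definition nonconstant f : Prop := ~ exists c : C R, f = ratpoly c%:P.

(* Value at a finite point that is not a pole; at a pole this is 0. *)
Definition rval f z : C R := (rnum f).[z] / (rden f).[z].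

(* f as a map from the Riemann sphere to itself. *)
Definition rmap f (x : CP1 R) : CP1 R :=
  match x with
  | Some z => if (rden f).[z] == 0 then None else Some (rval f z)
  | None =>
      if (size (rden f) < size (rnum f))%N then None
      else Some ((rnum f)`_(size (rden f)).-1 / lead_coef (rden f))
  end.

Definition poles f : set (CP1 R) := [set x | rmap f x = None].

Definition rderiv f : ratfun R :=
  ratpoly ((rnum f)^`() * rden f - rnum f * (rden f)^`())
  / ratpoly (rden f ^+ 2).

Lemma fden_neq0 f : fden f != 0.
Proof. exact: denom_ratioP. Qed.

Lemma rden_neq0 f : rden f != 0.
Proof.
rewrite /rden dvdp_div_eq0 ?dvdp_gcdr //; exact: fden_neq0.
Qed.

Lemma fnum_fden f : f * ratpoly (fden f) = ratpoly (fnum f).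
Proof.
have d0 := fden_neq0 f.
rewrite /ratpoly -{1}[f]reprK -[repr f in LHS]Ratio_numden -/(fnum f) -/(fden f).
unlock FracField.tofrac.
rewrite -[LHS]FracField.pi_mul; apply/eqmodP.
rewrite /= FracField.equivfE /FracField.mulf.
by rewrite !numden_Ratio ?mulr1 ?mul1r ?oner_neq0 // mulrC.
Qed.

Lemma rnum_rden f : f = ratpoly (rnum f) / ratpoly (rden f).
Proof.
have t0 p : p != 0 -> ratpoly p != 0 by rewrite /ratpoly tofrac_eq0.
apply: (mulIf (t0 _ (rden_neq0 f))); rewrite mulfVK ?t0 ?rden_neq0 //.
have g0 : gcdp (fnum f) (fden f) != 0.
  by rewrite gcdp_eq0 negb_and fden_neq0 orbT.
apply: (mulIf (t0 _ g0)); rewrite -mulrA /ratpoly -!tofracM.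
by rewrite !divpK ?dvdp_gcdl ?dvdp_gcdr //; exact: fnum_fden.
Qed.

Lemma coprime_rnum_rden f : coprimep (rnum f) (rden f).
Proof. by rewrite /rnum /rden coprimep_div_gcd // fden_neq0 orbT. Qed.

End RationalFunctions.

Section Curves.
Variable R : realType.

Local Notation cRe := (@complex.Re R).
Local Notation cIm := (@complex.Im R).

Definition cderiv (g : R -> C R) (t : R) : C R :=
  Complex (derive1 (fun s => cRe (g s)) t)
          (derive1 (fun s => cIm (g s)) t).

Definition C1 (g : R -> C R) : Prop :=
  (forall t, derivable (fun s => cRe (g s)) t 1) /\
  (forall t, derivable (fun s => cIm (g s)) t 1) /\
  continuous (derive1 (fun s => cRe (g s))) /\
  continuous (derive1 (fun s => cIm (g s))).

(* Linear independence over the reals. *)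
Definition transverse (u v : C R) : Prop :=
  cRe u * cIm v - cIm u * cRe v != 0.

(* An oriented curve is given by a parametrization g by [0, 1].  The piece of
   g over [a k, a k.+1] is the restriction of the regular C^1 map p k, so that
   at a break point cderiv (p k) is a one-sided tangent vector of g.  At a
   self-intersection every tangent vector of one branch must be transversal to
   every tangent vector of the other; the coincidence of the two end points of
   a closed curve is not a self-intersection. *)
Definition is_curve (g : R -> C R) : Prop :=
  exists (m : nat) (a : nat -> R) (p : nat -> R -> C R),
    [/\ a 0%N = 0 /\ a m = 1,
        forall k, (k < m)%N -> a k < a k.+1,
        forall k, (k < m)%N -> C1 (p k) /\
          forall t, a k <= t <= a k.+1 ->
            g t = p k t /\ cderiv (p k) t != 0
      & forall k l s t, (k < m)%N -> (l < m)%N ->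
          a k <= s <= a k.+1 -> a l <= t <= a l.+1 ->
          s < t -> (s, t) != (0, 1) -> g s = g t ->
          transverse (cderiv (p k) s) (cderiv (p l) t)].

(* The integral over g of h(z) dz.  The parametrization g is differentiable
   off the finite set of break points. *)
Definition curve_integral (g : R -> C R) (h : C R -> C R) : C R :=
  let w t := h (g t) * cderiv g t in
  Complex (\int[lebesgue_measure]_(t in `[0, 1]) cRe (w t))
          (\int[lebesgue_measure]_(t in `[0, 1]) cIm (w t)).

End Curves.

(* The power series sum_i m_i t^i is the quotient p / q of two polynomials,
   i.e. q * sum_i m_i t^i = p as formal power series. *)
Definition rational_series (R : realType) (m : nat -> C R) : Prop :=
  exists p q : {poly C R}, q != 0 /\
    forall k : nat, \sum_(i < k.+1) q`_i * m (k - i)%N = p`_k.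

(* Singular homology in degree 1.  Singular simplices are represented by total
   functions of which only the values on the standard simplex matter: `[0, 1]
   in dimension 1, and stdtriangle, with vertices v0 = (0, 0), v1 = (1, 0),
   v2 = (0, 1), in dimension 2. *)
Section Homology.
Variables (R : realType) (X : topologicalType).

Definition stdtriangle : set (R * R) :=
  [set x | [/\ 0 <= x.1, 0 <= x.2 & x.1 + x.2 <= 1]].

(* sface i s is the restriction of s to the edge opposite to the vertex v_i *)
Definition sface0 (s : R * R -> X) (t : R) : X := s (1 - t, t).
Definition sface1 (s : R * R -> X) (t : R) : X := s (0, t).
Definition sface2 (s : R * R -> X) (t : R) : X := s (t, 0).

(* The coefficient of the 1-simplex c in the chain consisting of b alone. *)
Definition scoef (b c : R -> X) : int := `[< {in `[0, 1], b =1 c} >]%:Z.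

(* The closed curve b over [0, 1] is the boundary of the singular 2-chain
   sum_k n_k s_k of U; chains are compared coefficientwise. *)
Definition homologous_to_zero (U : set X) (b : R -> X) : Prop :=
  exists (m : nat) (n : 'I_m -> int) (s : 'I_m -> R * R -> X),
    (forall k, {within stdtriangle, continuous (s k)} /\
               s k @` stdtriangle `<=` U) /\
    forall c : R -> X,
      \sum_(k < m) n k * (scoef (sface0 (s k)) c - scoef (sface1 (s k)) c
                          + scoef (sface2 (s k)) c) = scoef b c.

Definition closed_curve (b : R -> X) : Prop := b 0 = b 1.

Definition on_one_side (F : set X) (b : R -> X) : Prop :=
  closed_curve b /\ homologous_to_zero (~` F) b.

End Homology.

(* Main.v *)
(* A rational I_j gives a polynomial A_j <> 0 such that the functional
   L f = int_gamma f dz vanishes on A_j(P) C[P] Q^j Q'.  The field K = C(P, Q)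
   equals C(W) by Lueroth's theorem, and its elements are combinations of
   Q^j0, ..., Q^(j0 + n - 1) over C(P); composing W with a Moebius map, we may
   assume that Pt, where P = Pt(W), has a pole at infinity, so that W is integral
   over C[P].  It follows that L(d(W) G(W) W') = 0 for all polynomials G and some
   polynomial d vanishing at no finite pole of Pt.  If W took different values a
   and b at the ends of the curve, a polynomial F with d | F' and F(a) <> F(b)
   would give a contradiction; hence W(gamma) is closed, and then
   L(W' / (W - p)) = 0 for every finite pole p of Pt, that is, log(W - p) returns
   to its initial value along gamma.
   To see that W(gamma) bounds in the complement of the poles, cut the plane along
   vertical slits below the poles.  Every small arc of the curve is homologous to
   the detour over the line above all poles, up to the loop around p whenever the
   slit of p is crossed; the crossings are counted by the angle around p, so that
   these contributions cancel along the curve. *)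
Require Import Defs.
From HB Require Import structures.
From mathcomp Require Import all_boot all_order all_algebra.
From mathcomp Require Import complex.
From mathcomp Require Import all_classical all_reals all_analysis.
From mathcomp Require Import measurable_realfun ring lra.
Import Order.TTheory GRing.Theory Num.Theory.
Import numFieldNormedType.Exports.
Set Implicit Arguments.
Unset Strict Implicit.
Unset Printing Implicit Defensive.
Local Open Scope classical_set_scope.
Local Open Scope ring_scope.

(** * Subfields generated by algebraic elements *)

(** There are n families of moments because Q has degree at most n over C(P), as C(z) itself has.
    The annihilator A_j is the reversed denominator of I_j.

    The algebraic obstacle is uniformity. Each W^j W' has its own annihilator, whereas a single
    polynomial is needed for all G(W) W'. With P = N(W) / E(W) and deg E < deg N, dividing G by N
    lowers its degree at the price of a factor P, which the annihilator absorbs because the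
    functional vanishes on a whole ideal; so finitely many j suffice. This is where the pole of Pt
    at infinity enters.

    On the topological side, a boundary has to be exhibited as an integral combination of singular
    2-simplices, and consecutive arcs add up only modulo boundaries. The homology is therefore
    obtained from a chain-valued potential along the curve: an arc is homologous to the difference
    of the potentials at its ends. This is checked near each parameter and spread by connectedness
    of the real line; if the curve and all its angles close up, the two end potentials agree. *)

Section FractionMorphism.
Variables (A : idomainType) (L L' : fieldType).
Variables (tof : {rmorphism A -> L}) (phi : {rmorphism A -> L'}).
Hypothesis tof_inj : injective tof.
Hypothesis tof_surj : forall f, exists n d : A, d != 0 /\ f = tof n / tof d.
Hypothesis phi_inj : injective phi.

Let tof_neq0 (a : A) : a != 0 -> tof a != 0.
Proof. by move=> a0; rewrite -(rmorph0 tof) (inj_eq tof_inj). Qed.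

Let phi_neq0 (a : A) : a != 0 -> phi a != 0.
Proof. by move=> a0; rewrite -(rmorph0 phi) (inj_eq phi_inj). Qed.

Let h (f : L) : L' := xget 0 [set y | exists n d : A, [/\ d != 0, f = tof n / tof d
  & y = phi n / phi d]].

Let hE n d : d != 0 -> h (tof n / tof d) = phi n / phi d.
Proof.
move=> d0; rewrite /h; set S := [set y | _].
have : S (xget 0 S) by apply: (@xgetPex _ 0); exists (phi n / phi d), n, d.
case=> n' [d' [d'0 e ->]].
apply/eqP; rewrite eqr_div ?phi_neq0 // -!rmorphM; apply/eqP; congr (phi _).
apply: tof_inj; rewrite !rmorphM; apply/eqP.
by rewrite -eqr_div ?tof_neq0 // e.
Qed.

Let h_zmod : zmod_morphism h.
Proof.
move=> f g; have [n [d [d0 ->]]] := tof_surj f.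
have [n' [d' [d'0 ->]]] := tof_surj g.
have subE (K : fieldType) (a b c e : K) : b != 0 -> e != 0 ->
    a / b - c / e = (a * e - c * b) / (b * e).
  by move=> b0 e0; rewrite -mulNr addf_div // mulNr.
by rewrite subE ?tof_neq0 // -!rmorphM -rmorphB !hE ?mulf_neq0 // subE ?phi_neq0 //
  -!rmorphM -rmorphB.
Qed.

Let h_monoid : monoid_morphism h.
Proof.
split.
  rewrite -[X in h X](divr1 1) -(rmorph1 tof) hE ?oner_neq0 //.
  by rewrite rmorph1 divr1.
move=> f g; have [n [d [d0 ->]]] := tof_surj f.
have [n' [d' [d'0 ->]]] := tof_surj g.
by rewrite mulf_div -!rmorphM !hE ?mulf_neq0 // mulf_div -!rmorphM.
Qed.

(** [L] is known as the fraction field of [A] only through [tof_surj], so the extension sends n / d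
    to phi n / phi d for representatives chosen by [xget]. Injectivity of [phi] keeps the
    denominators invertible; that of [tof] makes the value independent of the representative. *)
Lemma exists_fraction_morphism :
  exists i : {rmorphism L -> L'}, forall a, i (tof a) = phi a.
Proof.
exists (HB.pack_for {rmorphism L -> L'} h
  (GRing.isZmodMorphism.Build L L' h h_zmod)
  (GRing.isMonoidMorphism.Build L L' h h_monoid)) => a /=.
by rewrite -[tof a]divr1 -(rmorph1 tof) hE ?oner_neq0 // rmorph1 divr1.
Qed.

End FractionMorphism.

(** * Extensions generated by one algebraic element *)

Section AlgebraicElement.
Variables (F L : fieldType) (i : {rmorphism F -> L}) (x : L).

(** The base field comes with an embedding [i] instead of being a subfield: in the applications [F]
    and [L] are both C(z) and [i] substitutes a rational function W or P, so that its image is C(W)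
    or C(P). *)
Definition spanned (n : nat) (y : L) : Prop :=
  exists2 B : {poly F}, (size B <= n)%N & y = (map_poly i B).[x].

Variables (p : {poly F}) (n : nat).
Hypotheses (p_neq0 : p != 0) (p_size : (size p <= n.+1)%N)
  (p_root : (map_poly i p).[x] = 0).

Lemma spanned_horner (B : {poly F}) : spanned n (map_poly i B).[x].
Proof.
exists (B %% p); first by rewrite -ltnS (leq_trans _ p_size) // ltn_modp.
rewrite {1}(divp_eq B p) rmorphD rmorphM /= hornerD hornerM p_root.
by rewrite mulr0 add0r.
Qed.

Lemma spannedD y z : spanned n y -> spanned n z -> spanned n (y + z).
Proof. by case=> B _ -> [B' _ ->]; rewrite -hornerD -rmorphD; exact: spanned_horner. Qed.

Lemma spannedM y z : spanned n y -> spanned n z -> spanned n (y * z).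
Proof. by case=> B _ -> [B' _ ->]; rewrite -hornerM -rmorphM; exact: spanned_horner. Qed.

(** The annihilator [p] need not be irreducible. If [B] shares a factor with the current
    annihilator, that factor does not vanish at [x] because [B] does not, so dividing it out leaves
    a smaller annihilator. Once the two are coprime, Bezout gives the inverse. *)
Lemma spannedV y : spanned n y -> spanned n y^-1.
Proof.
case=> B _ ->; have [->|B0] := eqVneq (map_poly i B).[x] 0.
  by exists 0; rewrite ?size_poly0 // invr0 rmorph0 horner0.
suff [u uB] : exists u : {poly F}, (map_poly i u).[x] * (map_poly i B).[x] = 1.
  suff -> : (map_poly i B).[x]^-1 = (map_poly i u).[x] by exact: spanned_horner.
  by apply: (mulIf B0); rewrite mulVf // uB.
move: p p_neq0 p_root => q; elim: {q}(size q) {-2}q (leqnn (size q)) => [|m IH] q.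
  by rewrite leqn0 size_poly_eq0 => /eqP ->; rewrite eqxx.
move=> qm q0 qx.
have g0 : gcdp B q != 0 by rewrite gcdp_eq0 negb_and q0 orbT.
have dq := divpK (dvdp_gcdr B q).
have : (map_poly i (q %/ gcdp B q)).[x] * (map_poly i (gcdp B q)).[x] = 0.
  by rewrite -hornerM -rmorphM /= dq.
move/eqP; rewrite mulf_eq0 => /orP[/eqP q'x|/eqP gx]; last first.
  case/negP: B0; rewrite -(divpK (dvdp_gcdl B q)) rmorphM hornerM gx mulr0.
  by [].
have [/eqP s1|s1] := boolP (size (gcdp B q) == 1%N).
  have /Bezout_eq1_coprimepP [[u v] /= uv] : coprimep B q by rewrite /coprimep s1.
  exists u; have := congr1 (fun r => (map_poly i r).[x]) uv.
  by rewrite rmorphD !rmorphM rmorph1 hornerD !hornerM hornerC qx mulr0 addr0.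
apply: (IH (q %/ gcdp B q)) => //; last by rewrite dvdp_div_eq0 // dvdp_gcdr.
rewrite -ltnS (leq_trans _ qm) // size_divp //.
have sg : (1 < size (gcdp B q))%N by rewrite ltn_neqAle eq_sym s1 size_poly_gt0.
have sq : (0 < size q)%N by rewrite size_poly_gt0.
by rewrite ltn_subrL sq andbT -ltnS (ltn_predK sg).
Qed.

(** The n + 1 powers 1, ..., y^n lie in the span of n powers of [x]; a nonzero row vector in the
    left kernel of their coefficient matrix is a linear relation between them. *)
Lemma exists_annihilator y : spanned n y ->
  exists q : {poly F}, [/\ q != 0, (size q <= n.+1)%N & (map_poly i q).[y] = 0].
Proof.
move=> yS.
have yX k : spanned n (y ^+ k).
  elim: k => [|k IH]; last by rewrite exprS; exact: spannedM.
  by rewrite expr0; have := spanned_horner 1; rewrite rmorph1 hornerC.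
pose B k := projT1 (cid2 (yX k)).
have B_size k : (size (B k) <= n)%N by rewrite /B; case: cid2.
have yE k : y ^+ k = (map_poly i (B k)).[x] by rewrite /B; case: cid2.
pose M : 'M[F]_(n.+1, n) := \matrix_(k, j) (B k)`_j.
have kM : kermx M != 0.
  rewrite kermx_eq0 /row_free neq_ltn; apply/orP; left.
  by rewrite ltnS rank_leq_col.
have [c /submxP[D cE] c0] := rowV0Pn kM.
have cM : c *m M = 0 by rewrite cE -mulmxA mulmx_ker mulmx0.
exists (rVpoly c); split; last 1 first.
- rewrite /rVpoly horner_coef.
  rewrite (@big_ord_widen _ _ _ _ n.+1
    (fun k => (map_poly i (rVpoly c))`_k * y ^+ k)); last first.
    by rewrite (leq_trans (size_poly _ _)) // size_poly.
  rewrite big_mkcond /=.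
  transitivity (\sum_(k < n.+1) i (c 0 k) * (map_poly i (B k)).[x]).
    apply: eq_bigr => k _; rewrite -yE; case: ltnP => [_|/(nth_default 0) ks].
      by rewrite coef_map /= coef_rVpoly_ord.
    suff -> : i (c 0 k) = 0 by rewrite mul0r.
    by rewrite -coef_rVpoly_ord -coef_map /= ks.
  transitivity (\sum_(k < n.+1) \sum_(j < n) i (c 0 k * M k j) * x ^+ j).
    apply: eq_bigr => k _; rewrite (@horner_coef_wide _ n).
      rewrite mulr_sumr; apply: eq_bigr => j _.
      by rewrite coef_map rmorphM /= mxE mulrA.
    by rewrite (leq_trans (size_poly _ _)).
  rewrite exchange_big /= big1 // => j _; rewrite -mulr_suml -rmorph_sum /=.
  have := congr1 (fun N : 'rV_n => N 0 j) cM; rewrite mxE => ->.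
  by rewrite mxE rmorph0 mul0r.
- by apply: contraNneq c0 => c0; rewrite -(rVpolyK c) c0 linear0.
- exact: size_poly.
Qed.

End AlgebraicElement.

(** * Lueroth's theorem *)

Section BivariatePolynomials.
Variable k : closedFieldType.
Implicit Types (G H : {poly {poly k}}) (c : {poly k}).

(** Over an algebraically closed field this means that the coefficients have no common factor.
    Phrased with roots, it lets Gauss's lemma be proved one linear factor at a time. *)
Definition primitive_poly G := forall z : k, exists j, ~~ root G`_j z.

Lemma common_root_factor G (z : k) :
  (forall j, root G`_j z) -> exists G1, G = ('X - z%:P) *: G1.
Proof.
move=> Gz; exists (map_poly (fun p => p %/ ('X - z%:P)) G); apply/polyP => j.
rewrite coefZ coef_map_id0 ?div0p // mulrC divpK // dvdp_XsubCl; exact: Gz.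
Qed.

(** A common root of all coefficients is a root of the leading one, so dividing it out lowers the
    degree of the leading coefficient, on which the induction runs. *)
Lemma exists_primitive_part G : G != 0 ->
  exists G1 c, [/\ c != 0, G = c *: G1 & primitive_poly G1].
Proof.
elim: {G}(size (lead_coef G)) {-2}G (leqnn (size (lead_coef G))) => [|m IH] G.
  by rewrite leqn0 size_poly_eq0 lead_coef_eq0 => ->.
move=> Gm G0; case: (pselect (primitive_poly G)) => [Gp|].
  by exists G, 1; rewrite oner_neq0 scale1r.
move=> /existsNP[z /forallNP Gz].
have {}Gz j : root G`_j z by apply: contraT => /Gz.
have [G1 GE] := common_root_factor Gz.
have G10 : G1 != 0 by apply: contraNneq G0 => G10; rewrite GE G10 scaler0.
have [|//|G2 [c [c0 G1E G2p]]] := IH G1.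
  rewrite -ltnS (leq_trans _ Gm) // GE lead_coefZ size_monicM ?monicXsubC //.
    by rewrite size_XsubC add2n.
  by rewrite lead_coef_eq0.
exists G2, (('X - z%:P) * c); split=> //; last by rewrite -scalerA -G1E.
by rewrite mulf_neq0 // polyXsubC_eq0.
Qed.

(** Evaluating the coefficients at [z] is a ring morphism into the domain k[Y], and it does not kill
    [G]. *)
Lemma primitive_mul_root G H (z : k) : primitive_poly G ->
  (forall j, root (G * H)`_j z) -> forall j, root H`_j z.
Proof.
move=> Gp GHz j; pose e := map_poly (horner_eval z).
have e0 (P : {poly {poly k}}) : (forall j, root P`_j z) -> e P = 0.
  by move=> Pz; apply/polyP => i; rewrite coef_map coef0 /=; apply/eqP/Pz.
move: (e0 _ GHz) => /eqP; rewrite /e rmorphM mulf_eq0 => /orP[/eqP eG|/eqP eH].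
  case: (Gp z) => i; have := congr1 (fun p : {poly k} => p`_i) eG.
  by rewrite coef_map coef0 /root /= /horner_eval => ->; rewrite eqxx.
by have := congr1 (fun p : {poly k} => p`_j) eH; rewrite coef_map coef0 => /eqP.
Qed.

(** Every root of [c] is a common root of the coefficients of G H, hence of those of [H]; it is
    cancelled on both sides until [c] is a constant. *)
Lemma gauss_strip G H F c : primitive_poly G -> c != 0 -> c *: F = G * H ->
  exists H1, F = G * H1.
Proof.
move=> Gp; elim: {c}(size c) {-2}c (leqnn (size c)) H => [|m IH] c.
  by rewrite leqn0 size_poly_eq0 => ->.
move=> cm H c0 E; have [sc|] := boolP (size c == 1%N).
  have /size_poly1P[a a0 cE] := sc.
  exists (a^-1%:P *: H); rewrite -scalerAr -E scalerA cE -polyCM mulVf //.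
  by rewrite scale1r.
move=> /closed_rootP[z cz].
have [H1 HE] : exists H1, H = ('X - z%:P) *: H1.
  apply: common_root_factor; apply: (primitive_mul_root Gp) => j.
  by rewrite -E coefZ rootM cz.
have /factor_theorem[c1 cE] := cz.
have c10 : c1 != 0 by apply: contraNneq c0 => c10; rewrite cE c10 mul0r.
apply: (IH c1 _ H1) => //.
  by rewrite -ltnS (leq_trans _ cm) // cE size_Mmonic ?monicXsubC // size_XsubC addn2.
have X0 : ('X - z%:P : {poly k}) != 0 by rewrite polyXsubC_eq0.
apply: (@mulfI _ ('X - z%:P)%:P); first by rewrite polyC_eq0.
by rewrite mulrCA !mul_polyC scalerA mulrC -cE E HE.
Qed.

End BivariatePolynomials.

(** * Substitution in the field of rational functions *)

Section RationalFunctionField.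
Variables (k : closedFieldType) (L : fieldType) (tof : {rmorphism {poly k} -> L}).
Hypothesis tof_inj : injective tof.
Hypothesis tof_surj :
  forall f, exists n d : {poly k}, d != 0 /\ f = tof n / tof d.
Implicit Types (p q u v : {poly k}) (f W : L).

Definition eval_at W : {rmorphism {poly k} -> L} :=
  horner_eval W \o map_poly (tof \o polyC).

Definition is_constant f := exists c, f = tof c%:P.

Definition deg_le m f := exists u v,
  [/\ v != 0, f = tof u / tof v, (size u <= m.+1)%N & (size v <= m.+1)%N].

Lemma tof_eq0 p : (tof p == 0) = (p == 0).
Proof. by rewrite -(rmorph0 tof) (inj_eq tof_inj). Qed.

Lemma eval_atC W c : eval_at W c%:P = tof c%:P.
Proof. by rewrite /= /horner_eval map_polyC hornerC. Qed.

Lemma eval_atX W : eval_at W 'X = W.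
Proof. by rewrite /= /horner_eval map_polyX hornerX. Qed.

Lemma eval_at_polyX p : eval_at (tof 'X) p = tof p.
Proof.
rewrite /= /horner_eval; elim/poly_ind: p => [|p c IH].
  by rewrite !rmorph0 horner0.
by rewrite rmorphD rmorphM /= map_polyX map_polyC hornerMXaddC IH -rmorphM -rmorphD.
Qed.

(** A nonconstant [W] is transcendental: [p] splits into linear factors, and a vanishing factor W -
    z would make [W] constant. *)
Lemma eval_at_eq0 W p : ~ is_constant W -> eval_at W p = 0 -> p = 0.
Proof.
move=> Wc; have [r ->] := closed_field_poly_normal p.
move: (lead_coef p) => a; rewrite -mul_polyC rmorphM rmorph_prod eval_atC.
move/eqP; rewrite mulf_eq0 => /orP[|].
  by rewrite tof_eq0 polyC_eq0 => /eqP ->; rewrite mul0r.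
rewrite prodf_seq_eq0 => /hasP[z _].
rewrite rmorphB eval_atX eval_atC subr_eq0 => /eqP e.
by case: Wc; exists z.
Qed.

Lemma exists_subst W : ~ is_constant W ->
  exists i : {rmorphism L -> L}, forall p, i (tof p) = eval_at W p.
Proof.
move=> Wc; apply: exists_fraction_morphism => //.
by apply: raddf_inj => p; exact: eval_at_eq0.
Qed.

Lemma exists_coprime_fraction f m : deg_le m f -> exists u v,
  [/\ coprimep u v, v != 0, f = tof u / tof v, (size u <= m.+1)%N
    & (size v <= m.+1)%N].
Proof.
move=> [u [v [v0 -> um vm]]].
have g0 : gcdp u v != 0 by rewrite gcdp_eq0 negb_and v0 orbT.
exists (u %/ gcdp u v), (v %/ gcdp u v); split.
- by rewrite coprimep_div_gcd // v0 orbT.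
- by rewrite dvdp_div_eq0 // dvdp_gcdr.
- have -> : tof u = tof (u %/ gcdp u v) * tof (gcdp u v).
    by rewrite -rmorphM divpK // dvdp_gcdl.
  have -> : tof v = tof (v %/ gcdp u v) * tof (gcdp u v).
    by rewrite -rmorphM divpK // dvdp_gcdr.
  by rewrite -mulf_div divff ?mulr1 // tof_eq0.
- exact: leq_trans (leq_divp _ _) um.
- exact: leq_trans (leq_divp _ _) vm.
Qed.

Lemma proportional_constant u v a b : v != 0 -> (a, b) != (0, 0) ->
  a *: v = b *: u -> is_constant (tof u / tof v).
Proof.
move=> v0 ab E; have [b0|b0] := eqVneq b 0.
  move: E ab; rewrite b0 scale0r => /eqP.
  by rewrite scaler_eq0 (negbTE v0) orbF => /eqP ->; rewrite eqxx.
exists (a / b); apply: (mulIf (_ : tof v != 0)); first by rewrite tof_eq0.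
rewrite mulfVK ?tof_eq0 // -rmorphM mul_polyC mulrC -scalerA E scalerA mulVf //.
by rewrite scale1r.
Qed.

Section Substitution.
Variables (W : L) (i : {rmorphism L -> L}) (m : nat).
Hypotheses (W_nonconst : ~ is_constant W) (iE : forall p, i (tof p) = eval_at W p)
  (W_deg : deg_le m W).

Lemma substC c : i (tof c%:P) = tof c%:P.
Proof. by rewrite iE eval_atC. Qed.

Lemma substX : i (tof 'X) = W.
Proof. by rewrite iE eval_atX. Qed.

(* [u - 'X v] kills the generator, where the coefficient ['X] stands for [W]. *)
Lemma generator_annihilator : exists p : {poly L},
  [/\ p != 0, (size p <= m.+1)%N & (map_poly i p).[tof 'X] = 0].
Proof.
have [u [v [v0 WE um vm]]] := W_deg.
have cc0 : (tof \o polyC) 0 = 0 by rewrite /= rmorph0.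
pose up : {poly L} := map_poly (tof \o polyC) u.
pose vp : {poly L} := map_poly (tof \o polyC) v.
exists (up - tof 'X *: vp); split.
- apply: contraNneq v0 => /(congr1 (fun p : {poly L} => p`_(size v).-1)).
  rewrite coefB coefZ !coef_map_id0 // coef0 /= -rmorphM -rmorphB => /eqP.
  rewrite tof_eq0 => /eqP /(congr1 (fun p : {poly k} => p`_1)).
  rewrite coefB coefXM coef0 !coefC /= sub0r => /eqP.
  by rewrite oppr_eq0 -/(lead_coef v) lead_coef_eq0.
- rewrite (leq_trans (size_polyD _ _)) // geq_max size_polyN.
  rewrite (leq_trans (size_poly _ _)) //=.
  by rewrite (leq_trans (size_scale_leq _ _)) // (leq_trans (size_poly _ _)).
- have ip (q : {poly k}) :
      map_poly i (map_poly (tof \o polyC) q) = map_poly (tof \o polyC) q.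
    by rewrite -map_poly_comp; apply: eq_map_poly => c /=; rewrite substC.
  rewrite rmorphB /= map_polyZ substX !ip hornerD hornerN hornerZ.
  rewrite -[up.[_]]/(eval_at _ u) -[vp.[_]]/(eval_at _ v) !eval_at_polyX WE.
  by rewrite mulfVK ?subrr // tof_eq0.
Qed.

(** This bounds the degree of k(X) over k(W) by the degree of W: the generator is algebraic over
    k(W), its polynomials are spanned by m powers, and so are their quotients. *)
Lemma subst_spanned f : spanned i (tof 'X) m f.
Proof.
have [p [p0 pm px]] := generator_annihilator.
have S q : spanned i (tof 'X) m (tof q).
  have -> : tof q = (map_poly i (map_poly (tof \o polyC) q)).[tof 'X].
    rewrite -map_poly_comp (eq_map_poly (_ : _ =1 tof \o polyC)).
      by rewrite -[RHS]/(eval_at _ q) eval_at_polyX.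
    by move=> c /=; rewrite substC.
  exact: (spanned_horner p0 pm px).
have [n [d [d0 ->]]] := tof_surj f.
by apply: (spannedM p0 pm px) => //; exact: (spannedV p0 pm px).
Qed.

End Substitution.

End RationalFunctionField.

Section Luroth.
Variables (k : closedFieldType) (L : fieldType) (tof : {rmorphism {poly k} -> L}).
Hypothesis tof_inj : injective tof.
Hypothesis tof_surj :
  forall f, exists n d : {poly k}, d != 0 /\ f = tof n / tof d.
Implicit Types (p q u v : {poly k}) (f : L).

Lemma clear_denominators (h : {poly L}) : exists (c : {poly k}) H,
  c != 0 /\ map_poly tof H = tof c *: h.
Proof.
elim/poly_ind: h => [|h a [c [H [c0 HE]]]].
  by exists 1, 0; rewrite oner_neq0 rmorph0 scaler0.
have [n [d [d0 ->]]] := tof_surj a.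
exists (c * d), (H * d%:P * 'X + (c * n)%:P); rewrite mulf_neq0 //; split=> //.
rewrite rmorphD !rmorphM /= map_polyX !map_polyC /= HE scalerDr; congr (_ + _).
  by rewrite -!mul_polyC polyCM; ring.
rewrite -mul_polyC -!polyCM; congr (_%:P).
by rewrite -mulrA; congr (_ * _); rewrite mulrC mulfVK // tof_eq0.
Qed.

(** Clearing the denominators of [h] gives c F = G H over k[X], and primitivity of [G] allows [c] to
    be cancelled. *)
Lemma gauss_factor (G F : {poly {poly k}}) (h : {poly L}) : primitive_poly G ->
  map_poly tof F = map_poly tof G * h -> exists H, F = G * H.
Proof.
move=> Gp E; have [c [H [c0 HE]]] := clear_denominators h.
apply: (gauss_strip (c := c) (H := H) Gp c0).
apply: (map_inj_poly tof_inj (rmorph0 tof)).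
by rewrite map_polyZ rmorphM /= HE E scalerAr.
Qed.

Section MinimalPolynomial.
Variable K : L -> Prop.
Hypotheses (KC : forall c, K (tof c%:P)) (KB : forall f g, K f -> K g -> K (f - g))
  (KM : forall f g, K f -> K g -> K (f * g)) (KV : forall f, K f -> K f^-1).

Definition over_K (p : {poly L}) := forall j, K p`_j.

Let K0 : K 0.
Proof. by have := KC 0; rewrite !rmorph0. Qed.

Let KD f g : K f -> K g -> K (f + g).
Proof. move=> fK gK; have -> : f + g = f - (0 - g) by rewrite sub0r opprK.
by apply: KB => //; exact: KB. Qed.

Lemma closed_eval W p : K W -> K (eval_at tof W p).
Proof.
move=> WK; elim/poly_ind: p => [|p c IH]; first by rewrite rmorph0.
by rewrite rmorphD rmorphM eval_atX eval_atC; apply: KD => //; exact: KM.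
Qed.

Lemma closed_subst W (i : {rmorphism L -> L}) f : (forall p, i (tof p) = eval_at tof W p) ->
  K W -> K (i f).
Proof.
move=> iE WK; have [n [d [_ ->]]] := tof_surj f.
by rewrite fmorph_div !iE; apply: KM; [|apply: KV]; exact: closed_eval.
Qed.

Variables (g : {poly L}) (x : L).
Hypotheses (gK : over_K g) (g_monic : g \is monic) (gx : g.[x] = 0)
  (g_min : forall h, over_K h -> h.[x] = 0 -> (size h < size g)%N -> h = 0).

Let g_size : (0 < size g)%N. Proof. by rewrite size_poly_gt0 monic_neq0. Qed.

(** Since [K] is a predicate and carries no polynomial ring, Euclidean division by the monic [g] is
    run inside L[Y], checking at each step that the coefficients stay in [K]. *)
Lemma minimal_dvd (f : {poly L}) : over_K f -> f.[x] = 0 -> exists h, f = g * h.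
Proof.
elim: {f}(size f) {-2}f (leqnn (size f)) => [|s IH] f.
  by rewrite leqn0 size_poly_eq0 => /eqP -> _ _; exists 0; rewrite mulr0.
move=> fs fK fx; have [fg|gf] := ltnP (size f) (size g).
  by exists 0; rewrite mulr0; exact: g_min.
have f0 : f != 0 by rewrite -size_poly_gt0 (leq_trans g_size).
pose r : {poly L} := lead_coef f *: 'X^(size f - size g).
have rE : size (r * g) = size f /\ lead_coef (r * g) = lead_coef f.
  rewrite /r -mul_polyC -mulrA mul_polyC size_scale ?lead_coef_eq0 //.
  rewrite lead_coefZ lead_coef_Mmonic // lead_coefXn mulr1; split=> //.
  by rewrite size_monicM ?monicXn ?monic_neq0 // size_polyXn /= subnK.
have [|||h hE] := IH (f - r * g).
- rewrite -ltnS (leq_trans _ fs) //.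
  have [->|d0] := eqVneq (f - r * g) 0; first by rewrite size_poly0 size_poly_gt0.
  rewrite ltn_neqAle; apply/andP; split; last first.
    by rewrite (leq_trans (size_polyD _ _)) // size_polyN rE.1 maxnn.
  apply: contraNneq d0 => se.
  rewrite -lead_coef_eq0 lead_coefE se coefB -lead_coefE -[in X in _ - X]rE.1.
  by rewrite -lead_coefE rE.2 subrr.
- move=> j; rewrite coefB; apply: KB => //.
  rewrite /r -scalerAl coefZ coefXnM; apply: KM; first exact: fK.
  by case: ifP => // _; exact: gK.
- by rewrite hornerD hornerN hornerM gx mulr0 fx subr0.
by exists (h + r); rewrite mulrDr -hE [g * r]mulrC subrK.
Qed.

End MinimalPolynomial.
End Luroth.

Lemma exists_least (P : nat -> Prop) : (exists n, P n) ->
  exists n, P n /\ forall m, (m < n)%N -> ~ P m.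
Proof.
move=> exP; have exP' : exists n, `[< P n >] by case: exP => n /asboolP; exists n.
case: (ex_minnP exP') => n /asboolP Pn nmin; exists n; split=> // m mn /asboolP.
by move=> /nmin; rewrite leqNgt mn.
Qed.

Section LurothTheorem.
Variables (k : closedFieldType) (L : fieldType) (tof : {rmorphism {poly k} -> L}).
Hypothesis tof_inj : injective tof.
Hypothesis tof_surj :
  forall f, exists n d : {poly k}, d != 0 /\ f = tof n / tof d.
Implicit Types (p q u v : {poly k}) (f : L).
Variable K : L -> Prop.
Hypotheses (KC : forall c, K (tof c%:P)) (KB : forall f g, K f -> K g -> K (f - g))
  (KM : forall f g, K f -> K g -> K (f * g)) (KV : forall f, K f -> K f^-1).

Section MinimalDegree.
Variables (u v : {poly k}) (m : nat).
Hypotheses (uv : coprimep u v) (v0 : v != 0) (um : (size u <= m.+2)%N)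
  (vm : (size v <= m.+2)%N) (uvK : K (tof u / tof v))
  (uv_nonconst : ~ is_constant tof (tof u / tof v))
  (m_min : forall f, K f -> deg_le tof m f -> is_constant tof f).

(** With X the variable of the coefficients and Y the outer one, this is v(X) u(Y) - u(X) v(Y),
    which vanishes at Y = X. *)
Let bihom : {poly {poly k}} := v *: map_poly polyC u - u *: map_poly polyC v.

Let bihom_coef j : bihom`_j = v * (u`_j)%:P - u * (v`_j)%:P.
Proof. by rewrite coefB !coefZ !coef_map. Qed.

Let bihom_coef_neq0 (a b : k) : (a, b) != (0, 0) -> v * a%:P - u * b%:P != 0.
Proof.
move=> ab; apply: contra_notN uv_nonconst; rewrite subr_eq0 => /eqP e.
apply: (proportional_constant tof_inj v0 ab).
by rewrite -!mul_polyC mulrC e mulrC.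
Qed.

(** The degree in Y does not drop: [bihom_coef_neq0] would make both coefficients of degree m + 1 of
    u and v vanish, and u / v would then be constant by minimality. *)
Let bihom_size : size bihom = m.+2.
Proof.
apply/eqP; rewrite eqn_leq; apply/andP; split.
  apply/leq_sizeP => j mj; rewrite bihom_coef !(nth_default 0) ?(leq_trans um) //.
    by rewrite !mulr0 subrr.
  exact: leq_trans vm mj.
rewrite ltnNge; apply/negP => /leq_sizeP /(_ m.+1 (leqnn _)) /eqP.
apply/negP; rewrite bihom_coef; apply: bihom_coef_neq0; apply/negP => /eqP[um0 vm0].
apply: uv_nonconst; apply: m_min => //; exists u, v; split=> //.
- apply/leq_sizeP => j; rewrite leq_eqVlt => /predU1P[<- //|mj].
  by rewrite nth_default // (leq_trans um).
- apply/leq_sizeP => j; rewrite leq_eqVlt => /predU1P[<- //|mj].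
  by rewrite nth_default // (leq_trans vm).
Qed.

(** The generator has degree at least m + 1 over [K]. The primitive multiple [G] of its minimal
    polynomial divides [bihom]; comparing degrees in X first, the cofactor turns out to be constant,
    so [G] has the degree of [bihom] in Y as well. *)
Lemma min_annihilator_size (g : {poly L}) : over_K K g -> g != 0 ->
  g.[tof 'X] = 0 -> (m.+2 <= size g)%N.
Proof.
move=> gK' g0' gx'.
have [s [[g1 [gK1 g01 gx1 s1]] smin]] : exists s, (exists g : {poly L},
    [/\ over_K K g, g != 0, g.[tof 'X] = 0 & size g = s]) /\
    forall s', (s' < s)%N -> ~ exists g : {poly L},
    [/\ over_K K g, g != 0, g.[tof 'X] = 0 & size g = s'].
  by apply: exists_least; exists (size g), g.
suff : (m.+2 <= s)%N.
  move=> /leq_trans; apply; rewrite leqNgt; apply/negP => /smin; apply.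
  by exists g.
have l0 : lead_coef g1 != 0 by rewrite lead_coef_eq0.
pose h : {poly L} := (lead_coef g1)^-1 *: g1.
have hs : size h = s by rewrite size_scale ?invr_eq0.
have hK : over_K K h by move=> j; rewrite coefZ; apply: KM => //; apply: KV; exact: gK1.
have h_monic : h \is monic by rewrite monicE lead_coefZ mulVf.
have hx : h.[tof 'X] = 0 by rewrite hornerZ gx1 mulr0.
have hmin (q : {poly L}) : over_K K q -> q.[tof 'X] = 0 -> (size q < size h)%N -> q = 0.
  move=> qK qx qs; apply/eqP/negPn/negP => q0; apply: (smin (size q)).
    by rewrite -hs.
  by exists q.
have tv0 : tof v != 0 by rewrite tof_eq0.
(* Divided by v(X), [bihom] becomes u(Y) - (u / v)(X) v(Y), whose coefficients lie in [K]. *)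
pose F : {poly L} := (tof v)^-1 *: map_poly tof bihom.
have FK : over_K K F.
  move=> j; rewrite coefZ coef_map bihom_coef /= rmorphB !rmorphM mulrBr.
  rewrite mulKf // mulrA [_^-1 * _]mulrC; apply: KB; first exact: KC.
  by apply: KM => //; exact: KC.
have Fx : F.[tof 'X] = 0.
  rewrite /F hornerZ rmorphB /= !map_polyZ -!map_poly_comp hornerD hornerN !hornerZ.
  rewrite -[X in tof v * X]/(eval_at _ _ u) -[X in tof u * X]/(eval_at _ _ v).
  by rewrite !eval_at_polyX [X in _ * (X - _)]mulrC subrr mulr0.
have [r Fr] := minimal_dvd KC KB KM hK h_monic hx hmin FK Fx.
have [c [H [c0 HE]]] := clear_denominators tof_inj tof_surj h.
have H0 : H != 0.
  apply: contraTneq h_monic => H0; move/eqP: HE; rewrite H0 rmorph0 eq_sym.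
  rewrite scaler_eq0 tof_eq0 // (negbTE c0) => /eqP ->.
  by rewrite monicE lead_coef0 eq_sym oner_eq0.
have [G [d [d0 HG Gp]]] := exists_primitive_part H0.
have td0 : tof d != 0 by rewrite tof_eq0.
have tc0 : tof c != 0 by rewrite tof_eq0.
have GE : map_poly tof G = (tof c / tof d) *: h.
  rewrite mulrC -scalerA -HE HG map_polyZ scalerA mulVf // scale1r //.
have cd0 : tof c / tof d != 0 by rewrite mulf_neq0 // invr_eq0.
have sG : size G = s.
  by rewrite -(size_map_inj_poly tof_inj (rmorph0 tof)) GE size_scale.
have [M FM] : exists M, bihom = G * M.
  apply: (@gauss_factor _ _ _ tof_inj tof_surj G bihom ((tof v / (tof c / tof d)) *: r)) => //.
  rewrite GE -scalerAl -scalerAr scalerA -Fr mulrC mulfVK // /F scalerA mulfV //.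
  by rewrite scale1r.
have b0 : bihom != 0 by rewrite -size_poly_gt0 bihom_size.
have M0 : M != 0 by apply: contraNneq b0 => M0; rewrite FM M0 mulr0.
have G0 : G != 0 by apply: contraNneq b0 => G0; rewrite FM G0 mul0r.
have sYb : (sizeY bihom <= m.+2)%N.
  apply/bigmax_leqP => j _; rewrite bihom_coef.
  rewrite (leq_trans (size_polyD _ _)) // geq_max size_polyN.
  by rewrite mulrC mul_polyC (leq_trans (size_scale_leq _ _)) //=
    mulrC mul_polyC (leq_trans (size_scale_leq _ _)).
(* The coefficients of [h] are those of [G] divided by the leading one. If [G] had degree at most m
   in X, minimality would make them all constant, and X would be algebraic over k. *)
have sYG : (m.+2 <= sizeY G)%N.
  rewrite ltnNge; apply/negP => sYG.
  have hc j : is_constant tof h`_j.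
    apply: m_min => //; exists G`_j, (lead_coef G); split.
    - by rewrite lead_coef_eq0.
    - have -> : tof (lead_coef G) = tof c / tof d.
        rewrite -(lead_coef_map_inj tof_inj (rmorph0 tof)) GE lead_coefZ.
        by rewrite (monicP h_monic) mulr1.
      have := congr1 (fun q : {poly L} => q`_j) GE; rewrite coef_map coefZ /= => ->.
      by rewrite mulrC mulKf.
    - exact: leq_trans (max_size_coefXY _ _) sYG.
    - exact: leq_trans (max_size_coefXY _ _) sYG.
  pose h0 : {poly k} := \poly_(j < size h) projT1 (cid (hc j)).
  have hE : h = map_poly (tof \o polyC) h0.
    apply/polyP => j; rewrite coef_map_id0 ?rmorph0 // coef_poly.
    case: ltnP => [_|/(nth_default 0) ->]; last by rewrite /= !rmorph0.
    by case: cid.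
  have h00 : h0 = 0.
    apply/eqP; rewrite -(tof_eq0 tof_inj) -eval_at_polyX; apply/eqP.
    by rewrite -[LHS]/((map_poly (tof \o polyC) h0).[tof 'X]) -hE.
  by move: (monic_neq0 h_monic); rewrite hE h00 rmorph0 eqxx.
have sYM : sizeY M = 1%N.
  have : sizeY bihom = (sizeY G + sizeY M).-1.
    by rewrite !sizeYE FM rmorphM size_mul ?swapXY_eq0.
  have sM : (0 < sizeY M)%N by rewrite lt0n sizeY_eq0.
  move=> e; move: sYb; rewrite e; move: sYG sM.
  case: (sizeY M) => // -[//|a]; rewrite addnS /= => + _ => G1 G2.
  by have := leq_trans (leq_add G1 (leqnn a.+1)) G2; rewrite -[leqRHS]addn0 leq_add2l.
have [M1 ME] : exists M1 : {poly k}, M = map_poly polyC M1.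
  exists (map_poly (fun q : {poly k} => q`_0) M); apply/polyP => j.
  rewrite coef_map coef_map_id0 ?coef0 //=; apply: size1_polyC.
  by rewrite -sYM max_size_coefXY.
(* [M] involves Y only. At a root z of it, v(X) u(z) - u(X) v(z) would vanish identically, although
   u(z) and v(z) are not both zero. *)
have : size M1 = 1%N.
  apply/eqP/negPn/negP => /closed_rootP[z /rootP M1z].
  have : bihom.[z%:P] = 0.
    by rewrite FM hornerM ME horner_map M1z /= polyC0 mulr0.
  rewrite hornerD hornerN !hornerZ !horner_map /= => /eqP; apply/negP.
  apply: bihom_coef_neq0; apply/negP => /eqP[uz vz].
  by move: (coprimep_root uv (x := z)); rewrite /root uz vz eqxx => /(_ isT).
move=> sM1; rewrite -bihom_size FM size_mul // sG ME.
by rewrite (size_map_inj_poly polyC_inj) // sM1 addn1.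
Qed.

End MinimalDegree.

(** [W] is a nonconstant element of [K] of least degree m + 1. Any f in [K] is B(X) with B over k(W)
    of degree at most m; then B - f is a polynomial over [K] killing X and too short to be nonzero,
    so f is the constant coefficient of B and lies in k(W). *)
Theorem luroth : (exists f, K f /\ ~ is_constant tof f) ->
  exists W (i : {rmorphism L -> L}), [/\ K W, ~ is_constant tof W,
    forall p, i (tof p) = eval_at tof W p & forall f, K f -> exists f0, f = i f0].
Proof.
move=> [f0 [f0K f0c]].
have [m [[W [WK Wc Wm]] mmin]] : exists m, (exists f, [/\ K f,
    ~ is_constant tof f & deg_le tof m f]) /\ forall m', (m' < m)%N ->
    ~ exists f, [/\ K f, ~ is_constant tof f & deg_le tof m' f].
  apply: exists_least; have [u [v [v0 fE]]] := tof_surj f0.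
  by exists (maxn (size u) (size v)), f0; split=> //; exists u, v; split=> //;
     rewrite ltnW // ltnS ?leq_maxl ?leq_maxr.
have [u [v [uv v0 WE um vm]]] := exists_coprime_fraction tof_inj Wm.
case: m Wm mmin um vm => [|m] Wm mmin um vm.
  case: Wc; exists (u`_0 / v`_0).
  have uE := size1_polyC um; have vE := size1_polyC vm.
  have tv0 : tof v != 0 by rewrite tof_eq0.
  apply: (mulIf tv0); rewrite WE mulfVK // -rmorphM; congr (tof _).
  rewrite [LHS]uE [X in _ * X]vE -polyCM mulfVK //.
  by apply: contraNneq v0 => v00; rewrite vE v00 polyC0.
have [i iE] := exists_subst tof_inj tof_surj Wc.
exists W, i; split=> // f fK.
have [B Bm fB] := subst_spanned tof_inj tof_surj iE Wm f.
exists B`_0; pose g : {poly L} := map_poly i B - f%:P.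
have gK : over_K K g.
  move=> j; rewrite coefB coef_map; apply: KB.
    by apply: (closed_subst tof_surj) iE WK => //; exact: KV.
  rewrite coefC; case: ifP => // _; have := KC 0.
  by rewrite !rmorph0.
have gx : g.[tof 'X] = 0 by rewrite hornerD hornerN hornerC -fB subrr.
have mmin' f1 : K f1 -> deg_le tof m f1 -> is_constant tof f1.
  move=> f1K f1m; apply: contrapT => f1c; apply: (mmin m) => //.
  by exists f1.
have /eqP g0 : g == 0.
  apply/negPn/negP => g0; rewrite WE in Wc WK.
  have : (m.+2 <= size g)%N by apply: (min_annihilator_size uv v0).
  apply/negP; rewrite -ltnNge ltnS (leq_trans (size_polyD _ _)) // geq_max.
  by rewrite size_polyN size_map_poly Bm (leq_trans (size_polyC_leq1 _)).
have /eqP := congr1 (fun q : {poly L} => q`_0) g0.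
by rewrite coefB coef_map coefC coef0 /= subr_eq0 => /eqP ->.
Qed.

End LurothTheorem.

(** * The field generated by P and Q, and the choice of W *)

Section TwoRationalFunctions.
Variables (k : closedFieldType) (L : fieldType) (tof : {rmorphism {poly k} -> L}).
Hypothesis tof_inj : injective tof.
Hypothesis tof_surj :
  forall f, exists n d : {poly k}, d != 0 /\ f = tof n / tof d.
Implicit Types (f W : L).

Definition is_subst W (i : {rmorphism L -> L}) :=
  forall p, i (tof p) = eval_at tof W p.

Lemma morphism_eval_at (i : {rmorphism L -> L}) W p :
  (forall c, i (tof c%:P) = tof c%:P) -> i (eval_at tof W p) = eval_at tof (i W) p.
Proof.
move=> iC; elim/poly_ind: p => [|p c IH]; first by rewrite !rmorph0.
by rewrite !rmorphD !rmorphM !eval_atX !eval_atC IH iC.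
Qed.

Lemma subst_comp W M (i j i' : {rmorphism L -> L}) f : is_subst W i ->
  is_subst M j -> is_subst (i M) i' -> i (j f) = i' f.
Proof.
move=> iE jE i'E; have [n [d [_ ->]]] := tof_surj f.
rewrite !fmorph_div !jE !i'E !morphism_eval_at // => c; exact: substC.
Qed.

Lemma nonconstant_subst W i f : is_subst W i -> ~ is_constant tof (i f) ->
  ~ is_constant tof f.
Proof. by move=> iE fc [c fE]; apply: fc; exists c; rewrite fE (substC iE). Qed.

(** [K] is C(P)[Q]. It is a field because [Q] is algebraic of degree at most n over C(P), all of
    C(z) being spanned by n powers of z; this bound is also why n powers of [Q] suffice. The factor
    [c] clears denominators in C(P). *)
Lemma nonconstant_field (P Q : L) (n : nat) :
  ~ is_constant tof P -> deg_le tof n P -> ~ is_constant tof Q ->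
  exists K : L -> Prop, [/\ [/\ forall c, K (tof c%:P),
    forall f g, K f -> K g -> K (f - g), forall f g, K f -> K g -> K (f * g)
    & forall f, K f -> K f^-1], K P, K Q & forall f, K f ->
    exists (c : {poly k}) (H : {poly {poly k}}), [/\ c != 0, (size H <= n)%N
      & eval_at tof P c * f = (map_poly (eval_at tof P) H).[Q]]].
Proof.
move=> Pc Pn Qc; have [i iE] := exists_subst tof_inj tof_surj Pc.
have [p [p0 pn pX]] := generator_annihilator tof_inj iE Pn.
have [q [q0 qn qQ]] := exists_annihilator p0 pn pX
  (subst_spanned tof_inj tof_surj iE Pn Q).
have S B : spanned i Q n (map_poly i B).[Q] by exact: (spanned_horner q0 qn qQ).
exists (spanned i Q n); split.
- split=> [c|f g fK gK|f g fK gK|f fK].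
  + by rewrite -(substC iE) -[X in spanned _ _ _ X](hornerC _ Q) -map_polyC.
  + apply: (spannedD q0 qn qQ) => //; have := S (-1)%:P.
    rewrite map_polyC hornerC /= rmorphN1 => /(spannedM q0 qn qQ) /(_ gK).
    by rewrite mulN1r.
  + exact: (spannedM q0 qn qQ).
  + exact: (spannedV q0 qn qQ).
- by have := S (tof 'X)%:P; rewrite map_polyC hornerC /= (substX iE).
- by have := S 'X; rewrite map_polyX hornerX.
- move=> _ [B Bn ->].
  have [c [H [c0 HE]]] := clear_denominators tof_inj tof_surj B.
  have tc0 : tof c != 0 by rewrite tof_eq0.
  exists c, H; split=> //.
    by rewrite -(size_map_inj_poly tof_inj (rmorph0 tof)) HE size_scale.
  rewrite -iE -hornerZ -map_polyZ -HE -map_poly_comp; congr (_.[_]).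
  by apply: eq_map_poly => r; exact: iE.
Qed.

Lemma rational_decomposition (P Q : L) (n j0 : nat) :
  ~ is_constant tof P -> deg_le tof n P -> ~ is_constant tof Q ->
  exists W (i : {rmorphism L -> L}) P0 Q0, [/\ ~ is_constant tof W, is_subst W i,
    P = i P0, Q = i Q0 & forall f,
    exists (c : {poly k}) (H : {poly {poly k}}), [/\ c != 0, (size H <= n)%N
      & eval_at tof P c * i f = (map_poly (eval_at tof P) H).[Q] * Q ^+ j0]].
Proof.
move=> Pc Pn Qc.
have [K [[KC KB KM KV] KP KQ KE]] := nonconstant_field Pc Pn Qc.
have [|W [i [WK Wc iE isurj]]] := luroth tof_inj tof_surj KC KB KM KV.
  by exists P.
have [P0 PE] := isurj P KP; have [Q0 QE] := isurj Q KQ.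
exists W, i, P0, Q0; split=> // f.
have Q0' : Q != 0 by apply/eqP => Q0'; apply: Qc; exists 0; rewrite Q0' !rmorph0.
have KX m : K (Q ^+ m).
  elim: m => [|m IH]; last by rewrite exprS; exact: KM.
  by rewrite expr0; have := KC 1; rewrite !rmorph1.
(* Expanding f / Q^j0 rather than f shifts the powers of [Q] to start at j0. *)
have [|c [H [c0 Hn E]]] := KE (i f / Q ^+ j0).
  apply: (KM); last exact/KV/KX.
  exact: (closed_subst tof_surj KC KB KM KV f iE WK).
exists c, H; split=> //.
by rewrite -E mulrA mulfVK // expf_neq0.
Qed.

Lemma is_constantB f g :
  is_constant tof f -> is_constant tof g -> is_constant tof (f - g).
Proof. by move=> [a ->] [b ->]; exists (a - b); rewrite -rmorphB polyCB. Qed.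

Lemma is_constantV f : is_constant tof f -> is_constant tof f^-1.
Proof.
move=> [a ->]; exists a^-1; have [->|a0] := eqVneq a 0.
  by rewrite invr0 !rmorph0 invr0.
have ta0 : tof a%:P != 0 by rewrite tof_eq0 // polyC_eq0.
by apply: (mulIf ta0); rewrite mulVf // -rmorphM -polyCM mulVf // !rmorph1.
Qed.

(** The new generator is W' = 1 / (W - c), so W = c + 1 / W'. The outer function f becomes f(c + 1 /
    X), whose value at infinity is that of f at c. *)
Lemma moebius_subst W (i : {rmorphism L -> L}) (c : k) :
  ~ is_constant tof W -> is_subst W i ->
  exists W' (i' j : {rmorphism L -> L}), [/\ ~ is_constant tof W', is_subst W' i',
    is_subst (tof c%:P + (tof 'X)^-1) j, forall f, i f = i' (j f)
    & forall f, exists g, i' f = i g].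
Proof.
move=> Wc iE; pose N := (tof 'X - tof c%:P)^-1; pose M := tof c%:P + (tof 'X)^-1.
have Xc : ~ is_constant tof (tof 'X).
  case=> a /tof_inj /(congr1 (fun p : {poly k} => p`_1)).
  by rewrite coefX coefC /= => /eqP; rewrite oner_eq0.
have cst a : is_constant tof (tof a%:P) by exists a.
have Mc : ~ is_constant tof M.
  move=> Mc; apply: Xc; rewrite -[tof 'X]invrK; apply: is_constantV.
  by have := is_constantB Mc (cst c); rewrite /M addrC addKr.
have Nc : ~ is_constant tof N.
  move=> /is_constantV; rewrite invrK => Nc; apply: Xc.
  have := is_constantB Nc (cst (- c)).
  by rewrite polyCN rmorphN opprK subrK.
have iNc : ~ is_constant tof (i N).
  case=> a; rewrite -(substC iE) => /fmorph_inj NE; apply: Nc.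
  by exists a.
have [i' i'E] := exists_subst tof_inj tof_surj iNc.
have [jM jME] := exists_subst tof_inj tof_surj Mc.
have [jN jNE] := exists_subst tof_inj tof_surj Nc.
exists (i N), i', jM; split=> // f.
  apply/esym/(subst_comp _ i'E jME); rewrite rmorphD fmorphV (substX i'E).
  by rewrite /N fmorphV invrK rmorphB (substC i'E) (substC iE) addrC subrK (substX iE).
by exists (jN f); rewrite (subst_comp _ iE jNE i'E).
Qed.

End TwoRationalFunctions.

(** * Rational maps of the sphere *)

Section Homogenization.
Variable k : closedFieldType.
Implicit Types (A u v : {poly k}) (x y : k) (M : nat).

Definition homogenization M A u v : {poly k} :=
  \sum_(i < M.+1) A`_i *: (u ^+ i * v ^+ (M - i)).

Definition binary_form M A x y : k :=
  \sum_(i < M.+1) A`_i * (x ^+ i * y ^+ (M - i)).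

Lemma horner_homogenization M A u v x :
  (homogenization M A u v).[x] = binary_form M A u.[x] v.[x].
Proof.
rewrite horner_sum; apply: eq_bigr => i _.
by rewrite hornerZ hornerM !horner_exp.
Qed.

Lemma binary_form0 M A x : binary_form M A x 0 = A`_M * x ^+ M.
Proof.
rewrite /binary_form big_ord_recr /= subnn expr0 mulr1 big1 ?add0r // => i _.
by rewrite expr0n subn_eq0 leqNgt ltn_ord /= !mulr0.
Qed.

Lemma binary_form1 M A x : (size A <= M.+1)%N -> binary_form M A x 1 = A.[x].
Proof.
move=> AM; rewrite (horner_coef_wide _ AM); apply: eq_bigr => i _.
by rewrite expr1n mulr1.
Qed.

Lemma binary_formZ M A x y c :
  binary_form M A (c * x) (c * y) = c ^+ M * binary_form M A x y.
Proof.
rewrite mulr_sumr; apply: eq_bigr => -[i /=]; rewrite ltnS => iM _.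
rewrite !exprMn -{3}(subnKC iM) exprD; ring.
Qed.

Lemma coef_mul_top (p q : {poly k}) m n : (size p <= m.+1)%N ->
  (size q <= n.+1)%N -> (p * q)`_(m + n) = p`_m * q`_n.
Proof.
move=> pm qn; rewrite coefM.
have mi : (m < (m + n).+1)%N by rewrite ltnS leq_addr.
rewrite (bigD1 (Ordinal mi)) //= addKn big1 ?addr0 // => i im.
have [lt|gt|e] := ltngtP i m; last by case/negP: im; apply/eqP/val_inj.
  rewrite (nth_default 0 (s := q)) ?mulr0 // (leq_trans qn) //.
  have im' : (i <= m + n)%N by rewrite -ltnS.
  by rewrite -(ltn_add2l i) subnKC // ltn_add2r.
by rewrite (nth_default 0) ?mul0r // (leq_trans pm).
Qed.

Lemma size_exp_top (p : {poly k}) m i : (size p <= m.+1)%N ->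
  (size (p ^+ i) <= (i * m).+1)%N /\ (p ^+ i)`_(i * m) = p`_m ^+ i.
Proof.
move=> pm; elim: i => [|i [IHs IHc]]; first by rewrite expr0 size_poly1 coef1.
rewrite !exprS mulSn coef_mul_top // IHc; split=> //.
rewrite (leq_trans (size_polyMleq _ _)) // -subn1 leq_subLR add1n.
by rewrite (leq_trans (leq_add pm IHs)) // addSn addnS.
Qed.

Lemma homogenization_top M A u v m : (size u <= m.+1)%N -> (size v <= m.+1)%N ->
  (size (homogenization M A u v) <= (M * m).+1)%N /\
  (homogenization M A u v)`_(M * m) = binary_form M A u`_m v`_m.
Proof.
move=> um vm; have T i : (i <= M)%N ->
    (size (u ^+ i * v ^+ (M - i))%R <= (M * m).+1)%N /\
    (u ^+ i * v ^+ (M - i))`_(M * m) = u`_m ^+ i * v`_m ^+ (M - i).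
  move=> iM; have [us uc] := size_exp_top i um; have [vs vc] := size_exp_top (M - i) vm.
  have -> : (M * m = i * m + (M - i) * m)%N by rewrite -mulnDl subnKC.
  rewrite coef_mul_top // uc vc; split=> //.
  rewrite (leq_trans (size_polyMleq _ _)) // -subn1 leq_subLR add1n.
  by rewrite (leq_trans (leq_add us vs)) // addSn addnS.
split.
  apply: (big_ind (fun p : {poly k} => size p <= (M * m).+1)%N).
  - by rewrite size_poly0.
  - by move=> p q ps qs; rewrite (leq_trans (size_polyD _ _)) // geq_max ps.
  - by move=> i _; rewrite (leq_trans (size_scale_leq _ _)) // (T i _).1 // -ltnS.
rewrite coef_sum; apply: eq_bigr => i _.
by rewrite coefZ (T i _).2 // -ltnS.
Qed.

(* A common zero of two binary forms would be a common zero of their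
   dehomogenizations, or the top coefficients would both vanish. *)
Lemma binary_form_neq0 M A B x y : coprimep A B -> (size A <= M.+1)%N ->
  (size B <= M.+1)%N -> (A`_M, B`_M) != (0, 0) -> (x, y) != (0, 0) ->
  (binary_form M A x y, binary_form M B x y) != (0, 0).
Proof.
move=> AB AM BM top xy; have [y0|y0] := eqVneq y 0.
  have x0 : x != 0 by apply: contraNneq xy => ->; rewrite y0.
  apply: contraNneq top; rewrite y0 !binary_form0 => -[] /eqP + /eqP.
  by rewrite !mulf_eq0 expf_eq0 (negbTE x0) andbF !orbF => /eqP -> /eqP ->.
have E (C : {poly k}) : (size C <= M.+1)%N -> binary_form M C x y = y ^+ M * C.[x / y].
  move=> CM; rewrite -(binary_form1 _ CM) -binary_formZ mulr1.
  by rewrite mulrCA mulfV // mulr1.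
rewrite !E //; apply/negP => /eqP[] /eqP + /eqP.
rewrite !mulf_eq0 expf_eq0 (negbTE y0) andbF /= => Axy Bxy.
by have := coprimep_root AB Axy; rewrite Bxy.
Qed.

Variables (L : fieldType) (tof phi : {rmorphism {poly k} -> L}).
Hypothesis phiC : forall c, phi c%:P = tof c%:P.

(** This is A(u / v) v^M = homogenization. The morphism [phi] serves twice: as [tof], to compose
    rational maps, and as evaluation at W, to clear the denominator of a polynomial in P. *)
Lemma eval_at_homogenization M A u v : phi v != 0 -> (size A <= M.+1)%N ->
  eval_at tof (phi u / phi v) A = phi (homogenization M A u v) / phi v ^+ M.
Proof.
move=> tv0 AM.
apply: (mulIf (expf_neq0 M tv0)); rewrite mulfVK ?expf_neq0 //.
rewrite /= /horner_eval (@horner_coef_wide _ M.+1); last first.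
  by rewrite (leq_trans (size_poly _ _)).
rewrite rmorph_sum mulr_suml; apply: eq_bigr => -[i /=]; rewrite ltnS => iM _.
rewrite coef_map_id0 ?rmorph0 //= -mul_polyC !rmorphM !rmorphXn -mulrA phiC.
congr (_ * _); have -> : phi v ^+ M = phi v ^+ i * phi v ^+ (M - i).
  by rewrite -exprD subnKC.
by rewrite mulrA -exprMn mulfVK.
Qed.

End Homogenization.

(** * Fractions as maps of the projective line *)

Section ProjectiveMaps.
Variable k : closedFieldType.
Implicit Types (n d u v : {poly k}) (x y z : k).

(* The point [x : y] of the projective line, [None] being infinity. *)
Definition proj_point x y : option k := if y == 0 then None else Some (x / y).

Definition proj_map n d (s : option k) : option k :=
  match s with
  | Some z => proj_point n.[z] d.[z]
  | None => if (size d < size n)%N then None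
            else Some (n`_(size d).-1 / lead_coef d)
  end.

Lemma proj_pointZ c x y : c != 0 -> proj_point (c * x) (c * y) = proj_point x y.
Proof.
move=> c0; rewrite /proj_point mulf_eq0 (negbTE c0) /=; case: eqP => // _.
by rewrite -mulf_div mulfV // mul1r.
Qed.

Lemma proj_map_infty n d : d != 0 ->
  let M := (maxn (size n) (size d)).-1 in
  (n`_M, d`_M) != (0, 0) /\ proj_map n d None = proj_point n`_M d`_M.
Proof.
move=> d0 /=; rewrite /proj_point; have [nd|dn] := ltnP (size d) (size n).
  rewrite [d`__]nth_default ?eqxx; last by rewrite -ltnS (ltn_predK nd).
  split=> //; apply/negP => /eqP[] /eqP.
  rewrite -lead_coefE lead_coef_eq0 => /eqP n0.
  by rewrite n0 size_poly0 in nd.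
have l0 : lead_coef d != 0 by rewrite lead_coef_eq0.
rewrite -lead_coefE (negbTE l0); split=> //.
by apply: contraNneq l0 => -[_ ->].
Qed.

Lemma proj_map_form n d M x y : coprimep n d -> d != 0 ->
  M = (maxn (size n) (size d)).-1 -> (x, y) != (0, 0) ->
  proj_map n d (proj_point x y) = proj_point (binary_form M n x y) (binary_form M d x y).
Proof.
move=> nd d0 ME xy; have sM : (maxn (size n) (size d) <= M.+1)%N by rewrite ME leqSpred.
have := sM; rewrite geq_max => /andP[nM dM].
rewrite {1}/proj_point; have [y0|y0] := eqVneq y 0.
  have x0 : x != 0 by apply: contraNneq xy => ->; rewrite y0.
  have [_ ->] := proj_map_infty n d0.
  rewrite y0 !binary_form0 -ME ![_ * x ^+ M]mulrC proj_pointZ //.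
  by rewrite expf_neq0.
have E (A : {poly k}) : (size A <= M.+1)%N -> binary_form M A x y = y ^+ M * A.[x / y].
  move=> AM; rewrite -(binary_form1 _ AM) -binary_formZ mulr1.
  by rewrite mulrCA mulfV // mulr1.
by rewrite !E // proj_pointZ // expf_neq0.
Qed.

Lemma fraction_multiple n d u v : coprimep n d -> d != 0 -> u * d = n * v ->
  exists h, u = h * n /\ v = h * d.
Proof.
move=> nd d0 E; have dv : d %| v.
  have dn : coprimep d n by rewrite coprimep_sym.
  by rewrite -(Gauss_dvdpr v dn) -E dvdp_mull.
exists (v %/ d); rewrite divpK //; split=> //.
by apply: (mulIf d0); rewrite E -{1}(divpK dv) mulrA [n * _]mulrC.
Qed.

Lemma proj_map_fraction n d u v z : coprimep n d -> d != 0 -> u * d = n * v ->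
  (u.[z], v.[z]) != (0, 0) -> proj_map n d (Some z) = proj_point u.[z] v.[z].
Proof.
move=> nd d0 /(fraction_multiple nd d0)[h [-> ->]]; rewrite !hornerM => hz.
rewrite /= proj_pointZ //; apply: contraNneq hz => ->.
by rewrite !mul0r.
Qed.

(** The common factor [h] multiplies both top coefficients by its own leading coefficient. Since u
    and v do not both vanish in degree m, this m is deg h plus the degree of the reduced
    fraction. *)
Lemma proj_map_fraction_infty n d u v m : coprimep n d -> d != 0 ->
  u * d = n * v -> (size u <= m.+1)%N -> (size v <= m.+1)%N ->
  (u`_m, v`_m) != (0, 0) -> proj_map n d None = proj_point u`_m v`_m.
Proof.
move=> nd d0 /(fraction_multiple nd d0)[h [-> ->]].
have [-> |h0] := eqVneq h 0; first by rewrite !mul0r coef0 eqxx.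
have [nt ->] := proj_map_infty n d0; set M := _.-1 in nt *.
have sM : (maxn (size n) (size d) <= M.+1)%N by rewrite leqSpred.
have := sM; rewrite geq_max => /andP[nM dM] um vm top.
have hs : (size h <= (size h).-1.+1)%N by rewrite leqSpred.
have -> : m = ((size h).-1 + M)%N.
  have le1 : (m <= (size h).-1 + M)%N.
    rewrite leqNgt; apply: contra top => lt; rewrite !nth_default ?eqxx //.
      rewrite (leq_trans (size_polyMleq _ _)) // -subn1 leq_subLR add1n.
      by rewrite (leq_trans (leq_add hs dM)) // addSn addnS !ltnS.
    rewrite (leq_trans (size_polyMleq _ _)) // -subn1 leq_subLR add1n.
    by rewrite (leq_trans (leq_add hs nM)) // addSn addnS !ltnS.
  apply/eqP; rewrite eqn_leq le1 /= leqNgt; apply/negP => lt.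
  have top0 (q : {poly k}) : (size q <= M.+1)%N -> (size (h * q)%R <= m.+1)%N -> q`_M = 0.
    move=> qM hq; have := coef_mul_top hs qM.
    rewrite nth_default ?(leq_trans hq) // => /esym/eqP.
    by rewrite mulf_eq0 -lead_coefE lead_coef_eq0 (negbTE h0) => /eqP.
  by move: nt; rewrite !top0 // eqxx.
rewrite !coef_mul_top // proj_pointZ //.
by rewrite -lead_coefE lead_coef_eq0.
Qed.

Lemma exists_pole n d : coprimep n d -> d != 0 ->
  (~ exists c, n = c *: d) -> exists s, proj_map n d s = None.
Proof.
move=> nd d0 nc; have [|sd] := boolP (size d == 1%N); last first.
  have /closed_rootP[z /rootP dz] := sd.
  by exists (Some z); rewrite /= /proj_point dz eqxx.
move=> /size_poly1P[c c0 dE]; exists None; rewrite /= dE size_polyC c0.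
case: ltnP => // /size1_polyC nE; case: nc; exists (n`_0 / c).
by rewrite dE -mul_polyC -polyCM mulfVK.
Qed.

Variables (L : fieldType) (tof : {rmorphism {poly k} -> L}).
Hypothesis tof_inj : injective tof.

(** The homogenizations of A and B at (u, v) form a fraction equal to n / d. They have no common
    zero on the sphere, infinity included, so the value of n / d can be read off from them without
    reducing. *)
Lemma proj_map_comp A B n d u v s :
  coprimep A B -> B != 0 -> coprimep n d -> d != 0 ->
  coprimep u v -> v != 0 ->
  eval_at tof (tof u / tof v) B != 0 ->
  tof n / tof d = eval_at tof (tof u / tof v) A / eval_at tof (tof u / tof v) B ->
  proj_map n d s = proj_map A B (proj_map u v s).
Proof.
move=> AB B0 nd d0 uv v0 evB0 E; have tv0 : tof v != 0 by rewrite tof_eq0.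
have [ABM _] := proj_map_infty A B0; set M := _.-1 in ABM.
have sM : (maxn (size A) (size B) <= M.+1)%N by rewrite leqSpred.
have := sM; rewrite geq_max => /andP[AM BM].
rewrite !(@eval_at_homogenization _ _ tof tof (fun=> erefl) M) // in E evB0.
have hB0 : homogenization M B u v != 0.
  by apply: contraNneq evB0 => ->; rewrite rmorph0 mul0r.
have {}E : homogenization M A u v * d = n * homogenization M B u v.
  apply: tof_inj; rewrite !rmorphM; apply/esym/eqP.
  rewrite -eqr_div ?(tof_eq0 tof_inj) //; apply/eqP; rewrite E.
  by rewrite invf_div mulrA mulfVK ?expf_neq0.
have nt := binary_form_neq0 AB AM BM ABM.
case: s => [z|].
  have uvz : (u.[z], v.[z]) != (0, 0).
    apply/negP => /eqP[uz vz]; move: (coprimep_root uv (x := z)).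
    by rewrite /root uz vz eqxx => /(_ isT).
  rewrite (proj_map_fraction nd d0 E) !horner_homogenization; last exact: nt.
  by rewrite [proj_map u v _]/= (proj_map_form AB B0 (M := M)).
have [uvt ->] := proj_map_infty u v0; set m := _.-1 in uvt *.
have sm : (maxn (size u) (size v) <= m.+1)%N by rewrite leqSpred.
have := sm; rewrite geq_max => /andP[um vm].
have [sA tA] := homogenization_top M A um vm.
have [sB tB] := homogenization_top M B um vm.
rewrite (proj_map_fraction_infty nd d0 E sA sB) tA tB; last exact: nt.
by rewrite (proj_map_form AB B0 (M := M)).
Qed.

End ProjectiveMaps.

(** * Derivatives and values of fractions *)

Section Fractions.
Variables (k : closedFieldType) (L : fieldType) (tof : {rmorphism {poly k} -> L}).
Hypothesis tof_inj : injective tof.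
Implicit Types n d u v : {poly k}.

Lemma coprime_fraction n d u v : coprimep n d -> d != 0 -> v != 0 ->
  tof n / tof d = tof u / tof v -> exists h, u = h * n /\ v = h * d.
Proof.
move=> nd d0 v0 /eqP; rewrite eqr_div ?tof_eq0 // -!rmorphM (inj_eq tof_inj).
by move=> /eqP e; apply: fraction_multiple.
Qed.

Lemma fraction_deriv n d u v : coprimep n d -> d != 0 -> v != 0 ->
  tof n / tof d = tof u / tof v ->
  tof (n^`() * d - n * d^`()) / tof (d ^+ 2)
  = tof (u^`() * v - u * v^`()) / tof (v ^+ 2).
Proof.
move=> nd d0 v0 /(coprime_fraction nd d0 v0)[h [uE vE]].
apply/eqP; rewrite eqr_div ?tof_eq0 ?expf_neq0 // -!rmorphM (inj_eq tof_inj).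
by rewrite uE vE !derivM; apply/eqP; ring.
Qed.

Lemma coprime_fraction_value n d u v z : coprimep n d -> d != 0 -> v.[z] != 0 ->
  tof n / tof d = tof u / tof v -> d.[z] != 0 /\ n.[z] / d.[z] = u.[z] / v.[z].
Proof.
move=> nd d0 vz; have v0 : v != 0 by apply: contraNneq vz => ->; rewrite horner0.
move=> /(coprime_fraction nd d0 v0)[h [uE vE]].
move: vz; rewrite uE vE !hornerM mulf_eq0 => /norP[hz dz]; split=> //.
by rewrite -mulf_div mulfV // mul1r.
Qed.

End Fractions.

Section Derivations.
Variables (k : closedFieldType) (L : fieldType) (tof : {rmorphism {poly k} -> L}).
Hypothesis tof_inj : injective tof.
Hypothesis tof_surj :
  forall f, exists n d : {poly k}, d != 0 /\ f = tof n / tof d.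
Variable delta : L -> L.
Hypothesis delta_fraction : forall a b : {poly k}, b != 0 ->
  delta (tof a / tof b) = tof (a^`() * b - a * b^`()) / tof (b ^+ 2).

Lemma delta_poly a : delta (tof a) = tof a^`().
Proof.
have := delta_fraction a (oner_neq0 _).
by rewrite derivC !mulr1 mulr0 subr0 expr1n !rmorph1 !divr1.
Qed.

Lemma deltaC c : delta (tof c%:P) = 0.
Proof. by rewrite delta_poly derivC rmorph0. Qed.

Let frac_eq (a b c d : L) : b != 0 -> d != 0 -> a * d = c * b -> a / b = c / d.
Proof. by move=> b0 d0 e; apply/eqP; rewrite eqr_div // e. Qed.

Lemma deltaD f g : delta (f + g) = delta f + delta g.
Proof.
have [a [b [b0 ->]]] := tof_surj f; have [c [d [d0 ->]]] := tof_surj g.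
have tb0 : tof b != 0 by rewrite tof_eq0.
have td0 : tof d != 0 by rewrite tof_eq0.
rewrite addf_div // -!rmorphM -rmorphD !delta_fraction ?mulf_neq0 //.
rewrite addf_div ?tof_eq0 ?expf_neq0 // -!rmorphM -rmorphD.
apply: frac_eq; rewrite ?tof_eq0 ?mulf_neq0 ?expf_neq0 // -!rmorphM.
congr (tof _); rewrite ?derivD !derivM; ring.
Qed.

Lemma deltaM f g : delta (f * g) = delta f * g + f * delta g.
Proof.
have [a [b [b0 ->]]] := tof_surj f; have [c [d [d0 ->]]] := tof_surj g.
have tb0 : tof b != 0 by rewrite tof_eq0.
have td0 : tof d != 0 by rewrite tof_eq0.
rewrite mulf_div -!rmorphM !delta_fraction ?mulf_neq0 // !mulf_div.
rewrite addf_div ?mulf_neq0 ?tof_eq0 ?expf_neq0 // -!rmorphM -rmorphD -?rmorphM.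
apply: frac_eq; rewrite ?tof_eq0 ?mulf_neq0 ?expf_neq0 // -!rmorphM.
congr (tof _); rewrite ?derivD !derivM; ring.
Qed.

Lemma deltaV f : f != 0 -> delta f^-1 = - delta f / f ^+ 2.
Proof.
move=> f0; have : delta (f * f^-1) = 0 by rewrite mulfV // -(rmorph1 tof) deltaC.
rewrite deltaM => /eqP; rewrite addrC addr_eq0 => /eqP e.
apply: (mulfI f0); rewrite e -mulNr; field.
by rewrite f0.
Qed.

Lemma delta_eval_at W p : delta (eval_at tof W p) = eval_at tof W p^`() * delta W.
Proof.
elim/poly_ind: p => [|p c IH].
  by rewrite deriv0 !rmorph0 -(rmorph0 tof) deltaC rmorph0 mul0r.
rewrite rmorphD rmorphM eval_atX eval_atC deltaD deltaM IH deltaC addr0.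
rewrite derivD derivM derivX derivC addr0 mulr1 rmorphD rmorphM eval_atX.
by rewrite mulrDl; congr (_ + _); rewrite mulrAC.
Qed.

Lemma delta_subst W i f : is_subst tof W i -> delta (i f) = i (delta f) * delta W.
Proof.
move=> iE; have [a [b [b0 ->]]] := tof_surj f.
have ib0 : i (tof b) != 0 by rewrite fmorph_eq0 tof_eq0.
rewrite iE in ib0; rewrite delta_fraction // !fmorph_div deltaM !iE deltaV // !delta_eval_at.
rewrite rmorphB !rmorphM ?rmorphXn; move: ib0.
move: (eval_at tof W _) (eval_at tof W _) (eval_at tof W _) (eval_at tof W _).
move=> x y z t; move: (delta W) => w t0; field.
by rewrite t0.
Qed.

End Derivations.

Section Values.
Variables (k : closedFieldType) (L : fieldType) (tof : {rmorphism {poly k} -> L}).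
Hypothesis tof_inj : injective tof.
Variable z : k.

Definition has_value (f : L) (x : k) := exists u v : {poly k},
  [/\ v.[z] != 0, f = tof u / tof v & x = u.[z] / v.[z]].

Let horner_neq0 (v : {poly k}) : v.[z] != 0 -> tof v != 0.
Proof. by rewrite tof_eq0 //; apply: contraNneq => ->; rewrite horner0. Qed.

Lemma has_value_poly p : has_value (tof p) p.[z].
Proof. by exists p, 1; rewrite hornerC oner_neq0 rmorph1 !divr1. Qed.

Lemma has_valueD f g x y :
  has_value f x -> has_value g y -> has_value (f + g) (x + y).
Proof.
move=> [u [v [v0 -> ->]]] [u' [v' [v'0 -> ->]]].
exists (u * v' + u' * v), (v * v').
by rewrite hornerD !hornerM !addf_div ?horner_neq0 // mulf_neq0 // -!rmorphM -rmorphD.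
Qed.

Lemma has_valueM f g x y :
  has_value f x -> has_value g y -> has_value (f * g) (x * y).
Proof.
move=> [u [v [v0 -> ->]]] [u' [v' [v'0 -> ->]]]; exists (u * u'), (v * v').
by rewrite !hornerM !mulf_div mulf_neq0 // -!rmorphM.
Qed.

Lemma has_valueV f x : x != 0 -> has_value f x -> has_value f^-1 x^-1.
Proof.
move=> x0 [u [v [v0 -> xE]]]; exists v, u; rewrite xE !invf_div; split=> //.
by apply: contraNneq x0 => u0; rewrite xE u0 mul0r.
Qed.

Lemma has_value_delta (delta : L -> L) f x :
  (forall a b : {poly k}, b != 0 ->
    delta (tof a / tof b) = tof (a^`() * b - a * b^`()) / tof (b ^+ 2)) ->
  has_value f x -> exists y, has_value (delta f) y.
Proof.
move=> deltaE [u [v [v0 -> _]]].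
exists ((u^`() * v - u * v^`()).[z] / (v ^+ 2).[z]).
exists (u^`() * v - u * v^`()), (v ^+ 2).
rewrite horner_exp expf_neq0 // deltaE //.
by apply: contraNneq v0 => ->; rewrite horner0.
Qed.

End Values.

Section RationalFunctionValues.
Variable R : realType.
Implicit Types (f g W : ratfun R) (p u v : {poly C R}) (z : C R).

Definition tofr : {rmorphism {poly C R} -> ratfun R} :=
  @FracField.tofrac {poly C R}.

Lemma tofr_inj : injective tofr.
Proof. by move=> p q /eqP; rewrite tofrac_eq => /eqP. Qed.

Lemma tofr_rnum_rden f : f = tofr (rnum f) / tofr (rden f).
Proof. exact: rnum_rden. Qed.

Lemma tofr_surj f : exists n d : {poly C R}, d != 0 /\ f = tofr n / tofr d.
Proof. by exists (rnum f), (rden f); split; [exact: rden_neq0|exact: rnum_rden]. Qed.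

Lemma deg_le_rdeg f : deg_le tofr (rdeg f) f.
Proof.
exists (rnum f), (rden f).
have s : (0 < maxn (size (rnum f)) (size (rden f)))%N.
  by rewrite leq_max !size_poly_gt0 rden_neq0 orbT.
split; [exact: rden_neq0|exact: rnum_rden| |];
  by rewrite /rdeg (ltn_predK s) ?leq_maxl ?leq_maxr.
Qed.

Lemma rmapE f x : rmap f x = proj_map (rnum f) (rden f) x.
Proof. by case: x. Qed.

Lemma rmap_subst W (i : {rmorphism ratfun R -> ratfun R}) f x :
  is_subst tofr W i -> rmap (i f) x = rmap f (rmap W x).
Proof.
move=> iE; rewrite !rmapE.
have E B : i (tofr B) = eval_at tofr (tofr (rnum W) / tofr (rden W)) B.
  by rewrite -tofr_rnum_rden iE.
apply: (@proj_map_comp _ _ tofr tofr_inj (rnum f) (rden f) (rnum (i f))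
  (rden (i f)) (rnum W) (rden W) x); rewrite ?coprime_rnum_rden ?rden_neq0 //.
  by rewrite -E fmorph_eq0 (tof_eq0 tofr_inj) rden_neq0.
rewrite -!E -tofr_rnum_rden -fmorph_div; congr (i _).
exact: tofr_rnum_rden.
Qed.

Lemma nonconstant_pole f : nonconstant f -> exists x, rmap f x = None.
Proof.
move=> fc; have [|x fx] := exists_pole (coprime_rnum_rden f) (rden_neq0 f).
  case=> c E; apply: fc; exists c.
  have d0 : tofr (rden f) != 0 by rewrite (tof_eq0 tofr_inj) rden_neq0.
  rewrite [LHS]tofr_rnum_rden E -mul_polyC rmorphM mulfK //.
by exists x; rewrite rmapE.
Qed.

Lemma rderiv_fraction u v : v != 0 -> rderiv (tofr u / tofr v) =
  tofr (u^`() * v - u * v^`()) / tofr (v ^+ 2).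
Proof.
move=> v0; apply: (fraction_deriv tofr_inj) => //.
- exact: coprime_rnum_rden.
- exact: rden_neq0.
- by rewrite -tofr_rnum_rden.
Qed.

Definition regular f z := (rden f).[z] != 0.

Lemma rval_fraction u v z : v.[z] != 0 ->
  regular (tofr u / tofr v) z /\ rval (tofr u / tofr v) z = u.[z] / v.[z].
Proof.
move=> vz; apply: (coprime_fraction_value tofr_inj) => //.
- exact: coprime_rnum_rden.
- exact: rden_neq0.
- by rewrite -tofr_rnum_rden.
Qed.

Lemma has_value_rval f z x : has_value tofr z f x -> regular f z /\ rval f z = x.
Proof. by case=> u [v [vz -> ->]]; exact: rval_fraction. Qed.

Lemma regular_has_value f z : regular f z -> has_value tofr z f (rval f z).
Proof. by exists (rnum f), (rden f); split=> //; exact: tofr_rnum_rden. Qed.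

Lemma rval_poly p z : regular (tofr p) z /\ rval (tofr p) z = p.[z].
Proof. exact/has_value_rval/has_value_poly. Qed.

Lemma rvalD f g z : regular f z -> regular g z ->
  regular (f + g) z /\ rval (f + g) z = rval f z + rval g z.
Proof.
move=> fz gz; apply: has_value_rval.
by apply: (has_valueD tofr_inj); exact: regular_has_value.
Qed.

Lemma rvalM f g z : regular f z -> regular g z ->
  regular (f * g) z /\ rval (f * g) z = rval f z * rval g z.
Proof.
move=> fz gz; apply: has_value_rval.
by apply: has_valueM; exact: regular_has_value.
Qed.

Lemma rvalV f z : regular f z -> rval f z != 0 ->
  regular f^-1 z /\ rval f^-1 z = (rval f z)^-1.
Proof.
move=> fz f0; apply: has_value_rval.
by apply: has_valueV => //; exact: regular_has_value.
Qed.

Lemma rvalX f z n : regular f z ->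
  regular (f ^+ n) z /\ rval (f ^+ n) z = rval f z ^+ n.
Proof.
move=> fz; elim: n => [|n [IHr IHv]].
  rewrite !expr0; have := rval_poly 1 z.
  by rewrite rmorph1 hornerC.
have [r v] := rvalM fz IHr.
by rewrite !exprS -IHv.
Qed.

Lemma regular_rderiv f z : regular f z -> regular (rderiv f) z.
Proof.
move=> fz; have [y] := has_value_delta rderiv_fraction (regular_has_value fz).
by move=> /has_value_rval[].
Qed.

Lemma regularE f z : regular f z <-> ~ poles f (Some z).
Proof.
rewrite /poles /regular /=; case: eqP => [|_]; last by split.
by split=> // H; case: H.
Qed.

Lemma regular_eval_at f p z : regular f z ->
  regular (eval_at tofr f p) z /\ rval (eval_at tofr f p) z = p.[rval f z].
Proof.
move=> fz; elim/poly_ind: p => [|p c [IHr IHv]].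
  by rewrite rmorph0 horner0 -(rmorph0 tofr) -[RHS](horner0 z); exact: rval_poly.
have [r v] := rvalM IHr fz; have [rc vc] := rval_poly c%:P z.
have [rs vs] := rvalD r rc; rewrite rmorphD rmorphM eval_atX eval_atC.
by split=> //; rewrite vs v vc IHv hornerMXaddC hornerC.
Qed.

End RationalFunctionValues.

Arguments tofr {R}.

(** * Functionals with vanishing moments *)

Section PolynomialFunctionals.
Variable k : numClosedFieldType.
Implicit Types (A B D E F G N : {poly k}).

(** [M A G] stands for L(A(P) G(W) W'). As P = N(W) / E(W), a factor N of G can be traded for a
    factor P and a factor E. This reduces G to degree below deg N, where the product of the
    annihilators of the X^j works; the arbitrary cofactor [B] absorbs the new factors. *)
Lemma uniform_annihilator (M : {poly k} -> {poly k} -> k) N E :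
  (forall A c G H, M A (c *: G + H) = c * M A G + M A H) ->
  (forall A G, M A (N * G) = M (A * 'X) (E * G)) -> (size E < size N)%N ->
  (forall j, (j < (size N).-1)%N ->
    exists c, c != 0 /\ forall B, M (c * B) 'X^j = 0) ->
  exists D, D != 0 /\ forall B G, M (D * B) G = 0.
Proof.
move=> ML MN EN Mj; have sN : (0 < size N)%N by exact: leq_ltn_trans EN.
have N0 : N != 0 by rewrite -size_poly_gt0.
have lN0 : lead_coef N != 0 by rewrite lead_coef_eq0.
have M0 A : M A 0 = 0.
  have := ML A 1 0 0; rewrite scaler0 addr0 mul1r => /eqP.
  by rewrite -subr_eq subrr eq_sym => /eqP.
have MZ A c G : M A (c *: G) = c * M A G by rewrite -[_ *: _]addr0 ML M0 addr0.
have MD A G H : M A (G + H) = M A G + M A H by rewrite -[G]scale1r ML mul1r scale1r.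
have /choice[c cP] : forall j : 'I_(size N).-1, exists c,
  c != 0 /\ forall B, M (c * B) 'X^j = 0 by move=> j; apply: Mj.
exists (\prod_j c j); split; first by apply/prodf_neq0 => j _; have [] := cP j.
set D := \prod_j _ => B G.
elim: {G}(size G) {-2}G (leqnn (size G)) B => [|s IH] G.
  by rewrite leqn0 size_poly_eq0 => /eqP -> B; rewrite M0.
move=> Gs B; have [GN|NG] := ltnP (size G) (size N).
  rewrite -[G]coefK poly_def (@big_ord_widen _ _ _ _ (size N).-1 (fun i => G`_i *: 'X^i)).
    apply: (big_ind (fun H => M (D * B) H = 0)) => // [H H' H0 H'0|j _].
      by rewrite MD H0 H'0 addr0.
    by rewrite MZ /D (bigD1 j) //= -mulrA (cP j).2 mulr0.
  by rewrite -ltnS (ltn_predK sN).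
pose r : {poly k} := (lead_coef G / lead_coef N) *: 'X^(size G - size N).
have G0 : G != 0 by rewrite -size_poly_gt0 (leq_trans sN).
have q0 : lead_coef G / lead_coef N != 0.
  by rewrite mulf_neq0 ?invr_eq0 // lead_coef_eq0.
have r0 : r != 0 by rewrite scaler_eq0 (negbTE q0) monic_neq0 // monicXn.
have rs : size r = (size G - size N).+1 by rewrite size_scale // size_polyXn.
have Nrs : size (N * r) = size G by rewrite size_mul // rs addnS /= subnKC.
have Nrl : lead_coef (N * r) = lead_coef G.
  by rewrite lead_coefM lead_coefZ lead_coefXn mulr1 mulrC mulfVK.
rewrite -[G](subrK (N * r)) MD MN -mulrA IH ?add0r; last first.
  rewrite -ltnS (leq_trans _ Gs) //.
  have [->|d0] := eqVneq (G - N * r) 0; first by rewrite size_poly0 size_poly_gt0.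
  rewrite ltn_neqAle; apply/andP; split; last first.
    by rewrite (leq_trans (size_polyD _ _)) // size_polyN Nrs maxnn.
  apply: contraNneq d0 => se.
  rewrite -lead_coef_eq0 lead_coefE se coefB -lead_coefE -[in X in _ - X]Nrs.
  by rewrite -lead_coefE Nrl subrr.
apply: IH; have [->|E0] := eqVneq E 0; first by rewrite mul0r size_poly0.
by rewrite -ltnS (leq_trans _ Gs) // -Nrs !size_mul // rs !addnS /= ltn_add2r.
Qed.

Lemma dvdp_deriv_exp e n F : e ^+ n.+1 %| F -> e ^+ n %| F^`().
Proof.
move=> /dvdpP[g ->]; rewrite derivM deriv_exp /=.
rewrite dvdp_add ?exprS ?mulrA ?dvdp_mulIr //.
have -> : g * (e^`() * e ^+ n *+ n.+1) = (g * e^`() *+ n.+1) * e ^+ n.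
  by rewrite mulrnAr mulrnAl mulrA.
exact: dvdp_mulIr.
Qed.

(** Write D = e (X - b)^m with e(b) nonzero. Bezout gives F divisible by (X - a) e^2 with 1 - F
    divisible by (X - b)^(m + 1). Then F(a) = 0 and F(b) = 1, while the spare exponents make F'
    divisible by e and by (X - b)^m. *)
Lemma endpoints_eq D (a b : k) : D != 0 ->
  (forall F, D %| F^`() -> F.[a] = F.[b]) -> a = b.
Proof.
move=> D0 H; apply/eqP/negPn/negP => ab.
have [m [e /implyP eb DE]] := multiplicity_XsubC D b.
have {}eb := eb D0.
have co : coprimep (('X - a%:P) * e ^+ 2) (('X - b%:P) ^+ m.+1).
  rewrite coprimep_expr // coprimepMl coprimep_XsubC2 ?subr_eq0 1?eq_sym //=.
  by rewrite coprimep_expl // coprimep_XsubC.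
have [[u v] /= uv] := Bezout_eq1_coprimepP _ _ co.
pose F := u * (('X - a%:P) * e ^+ 2).
have FE : F = 1 - v * ('X - b%:P) ^+ m.+1 by rewrite -uv addrK.
have : F.[a] = F.[b].
  apply: H; rewrite DE Gauss_dvdp ?coprimep_expr ?coprimep_XsubC //.
  apply/andP; split.
    have := @dvdp_deriv_exp e 1 F; rewrite expr1; apply.
    by rewrite /F mulrA dvdp_mulIr.
  by rewrite FE derivB derivC sub0r dvdpNr dvdp_deriv_exp // dvdp_mulIr.
have Fa : F.[a] = 0 by rewrite /F !hornerM hornerXsubC subrr mul0r mulr0.
have Fb : F.[b] = 1.
  by rewrite FE hornerD hornerN hornerM horner_exp hornerXsubC subrr expr0n mulr0
    subr0 hornerC.
by rewrite Fa Fb => /esym/eqP; rewrite oner_eq0.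
Qed.

Lemma exists_antiderivative G : exists F, F^`() = G.
Proof.
exists (\poly_(i < (size G).+1) (G`_i.-1 / i%:R)).
apply/polyP => i; rewrite coef_deriv coef_poly ltnS.
case: ltnP => [_|/(nth_default 0) ->]; last by rewrite mul0rn.
by rewrite -[LHS]mulr_natr mulfVK // pnatr_eq0.
Qed.

End PolynomialFunctionals.

(** * The integral along the curve as an abstract linear functional *)

Section MomentFunctional.
Variables (k : numClosedFieldType) (L : fieldType) (tof : {rmorphism {poly k} -> L}).
Hypothesis tof_inj : injective tof.
Variables (reg : L -> Prop) (lam : L -> k).
Hypotheses (reg_tof : forall c, reg (tof c%:P))
  (regD : forall f g, reg f -> reg g -> reg (f + g))
  (regM : forall f g, reg f -> reg g -> reg (f * g))
  (lam_linear : forall c f g, reg f -> reg g ->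
     lam (tof c%:P * f + g) = c * lam f + lam g).

Lemma reg0 : reg 0. Proof. by have := reg_tof 0; rewrite !rmorph0. Qed.
Lemma reg1 : reg 1. Proof. by have := reg_tof 1; rewrite !rmorph1. Qed.

Lemma reg_sum n (F : nat -> L) : (forall l, (l < n)%N -> reg (F l)) ->
  reg (\sum_(l < n) F l).
Proof.
elim: n => [|n IH] Fr; first by rewrite big_ord0; exact: reg0.
rewrite big_ord_recr /=; apply: regD; last exact: Fr.
by apply: IH => l ln; apply: Fr; rewrite ltnW // ltnS.
Qed.

Lemma regX f n : reg f -> reg (f ^+ n).
Proof.
by move=> fr; elim: n => [|n IH]; [exact: reg1|rewrite exprS; exact: regM].
Qed.

Lemma reg_eval f p : reg f -> reg (eval_at tof f p).
Proof.
move=> fr; elim/poly_ind: p => [|p c IH]; first by rewrite rmorph0; exact: reg0.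
rewrite rmorphD rmorphM eval_atX eval_atC.
by apply: (regD) => //; exact: regM.
Qed.

Lemma lam0 : lam 0 = 0.
Proof.
have := lam_linear 1 reg0 reg0; rewrite mulr0 addr0 mul1r => /eqP.
by rewrite -subr_eq subrr eq_sym => /eqP.
Qed.

Lemma lam_sum0 n (F : nat -> L) :
  (forall l, (l < n)%N -> reg (F l) /\ lam (F l) = 0) -> lam (\sum_(l < n) F l) = 0.
Proof.
elim: n => [|n IH] Fr; first by rewrite big_ord0 lam0.
have Fr' l : (l < n)%N -> reg (F l) /\ lam (F l) = 0.
  by move=> ln; apply: Fr; rewrite ltnW // ltnS.
have [Fn Fn0] := Fr n (leqnn _).
rewrite big_ord_recr /= addrC -[F n]mul1r -(rmorph1 tof) lam_linear ?IH ?Fn0 //.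
  by rewrite mulr0 addr0.
by apply: reg_sum => l /Fr'[].
Qed.

Variables (W P Q dW dQ : L) (N E : {poly k}) (n j0 : nat) (a b : k).
Hypotheses (W_nonconst : ~ is_constant tof W) (P_nonconst : ~ is_constant tof P)
  (W_reg : reg W) (P_reg : reg P) (Q_reg : reg Q) (dW_reg : reg dW) (dQ_reg : reg dQ)
  (NE : coprimep N E) (EN : (size E < size N)%N) (E0 : E != 0)
  (P_E : P = eval_at tof W N / eval_at tof W E)
  (decomposition : forall j, exists (c : {poly k}) (H : {poly {poly k}}),
    [/\ c != 0, (size H <= n)%N & eval_at tof P c * W ^+ j * dW
      = (map_poly (eval_at tof P) H).[Q] * Q ^+ j0 * dQ])
  (moments : forall l, (l < n)%N -> exists A : {poly k}, A != 0 /\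
     forall B, lam (eval_at tof P (A * B) * Q ^+ (j0 + l) * dQ) = 0)
  (lam_deriv : forall F : {poly k}, lam (eval_at tof W F^`() * dW) = F.[b] - F.[a]).

Let ev := eval_at tof W.

Let evE0 : ev E != 0.
Proof. by apply: contra_neq E0; exact: (eval_at_eq0 tof_inj W_nonconst). Qed.

(** For a fixed j, c(P) W^j W' is a sum of terms H_l(P) Q^(j0 + l) Q', and the product of all A_l(P)
    annihilates each of them. *)
Lemma exists_uniform_annihilator : exists D : {poly k}, D != 0 /\
  forall B G, lam (eval_at tof P (D * B) * eval_at tof W G * dW) = 0.
Proof.
apply: (uniform_annihilator (N := N) (E := E)
  (M := fun A G => lam (eval_at tof P A * eval_at tof W G * dW))) => //.
- move=> A c G H; rewrite -lam_linear; last 2 first.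
  + by apply: (regM) => //; apply: (regM); exact: reg_eval.
  + by apply: (regM) => //; apply: (regM); exact: reg_eval.
  congr lam; rewrite -mul_polyC rmorphD rmorphM eval_atC; ring.
- move=> A G; congr lam; rewrite !rmorphM eval_atX.
  have -> : eval_at tof W N = P * eval_at tof W E by rewrite P_E mulfVK.
  ring.
move=> j _; have [c [H [c0 Hn E1]]] := decomposition j.
have /choice[A AP] : forall l : 'I_n, exists A : {poly k}, A != 0 /\
     forall B, lam (eval_at tof P (A * B) * Q ^+ (j0 + l) * dQ) = 0.
  by move=> l; exact: moments.
exists (c * \prod_l A l); split.
  by rewrite mulf_neq0 //; apply/prodf_neq0 => l _; have [] := AP l.
move=> B; have -> : eval_at tof P (c * \prod_l A l * B) * eval_at tof W 'X^j * dW
  = \sum_(l < n) eval_at tof P (\prod_l A l * B * H`_l) * Q ^+ (j0 + l) * dQ.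
  transitivity (eval_at tof P (\prod_l A l * B) *
      ((map_poly (eval_at tof P) H).[Q] * Q ^+ j0 * dQ)).
    by rewrite -E1 !rmorphM rmorphXn eval_atX; ring.
  rewrite (@horner_coef_wide _ n); last by rewrite (leq_trans (size_poly _ _)).
  rewrite -mulrA mulr_suml mulr_sumr; apply: eq_bigr => l _.
  by rewrite coef_map_id0 ?rmorph0 // rmorphM exprD; ring.
apply: (lam_sum0 (F := fun l =>
  eval_at tof P (\prod_l0 A l0 * B * H`_l) * Q ^+ (j0 + l) * dQ)) => l ln.
split; first by apply: (regM) => //; apply: (regM); [exact: reg_eval|exact: regX].
have [_ AB] := AP (Ordinal ln).
rewrite (bigD1 (Ordinal ln)) //=.
by rewrite -2!(mulrA (A (Ordinal ln))); exact: AB.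
Qed.

(** A polynomial in P = N(W) / E(W) becomes a polynomial in W after multiplication by a power of
    E(W). When E(p) = 0 one factor W - p can be taken from that power, so the functional also
    vanishes on d(W) W' / (W - p). *)
Lemma clear_poles : exists d : {poly k}, [/\ d != 0,
  forall G, lam (eval_at tof W (d * G) * dW) = 0 &
  forall p, root E p -> ~~ root d p /\
    lam (eval_at tof W d / (W - tof p%:P) * dW) = 0].
Proof.
have [D [D0 DP]] := exists_uniform_annihilator.
(* The extra factor X makes the degree [M] of [D1] positive even if [D] is constant, so that E^M
   does contain X - p. *)
pose D1 := D * 'X; pose M := size D.
have D10 : D1 != 0 by rewrite mulf_neq0 // polyX_eq0.
have D1s : size D1 = M.+1 by rewrite size_mulX.
pose d := homogenization M D1 N E.
have dE : ev d = eval_at tof P D1 * ev (E ^+ M).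
  rewrite {1}P_E (@eval_at_homogenization _ _ tof ev _ M) ?D1s //; last first.
    by move=> c; rewrite /ev eval_atC.
  by rewrite -/d rmorphXn mulfVK // expf_neq0.
have evEM0 G : lam (eval_at tof P D1 * ev G * dW) = 0 by exact: DP.
have M0 : (0 < M)%N by rewrite size_poly_gt0.
exists d; split.
- apply: contraNneq D10 => d0; move/eqP: dE; rewrite d0 rmorph0 eq_sym mulf_eq0.
  rewrite rmorphXn expf_eq0 (negbTE evE0) andbF orbF => /eqP.
  by move=> /(eval_at_eq0 tof_inj P_nonconst) ->.
- by move=> G; rewrite rmorphM -/ev dE -[_ * ev G]mulrA -rmorphM; exact: evEM0.
move=> p Ep; have Np : ~~ root N p by apply: contraL Ep => /(coprimep_root NE) ->.
split.
  (* As E(p) = 0, only the top term survives: d(p) is the leading coefficient of [D1] times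
     N(p)^M. *)
  rewrite /root horner_homogenization (rootP Ep) binary_form0 mulf_neq0 ?expf_neq0 //.
  have -> : D1`_M = lead_coef D1 by rewrite lead_coefE D1s.
  by rewrite lead_coef_eq0.
have /factor_theorem[E1 EE] := Ep.
have Wp0 : W - tof p%:P != 0.
  by apply: contra_notN W_nonconst; rewrite subr_eq0 => /eqP ->; exists p.
have -> : ev d / (W - tof p%:P) = eval_at tof P D1 * ev (E1 * E ^+ M.-1).
  apply: (mulIf Wp0); rewrite mulfVK // dE -mulrA; congr (_ * _).
  have -> : W - tof p%:P = ev ('X - p%:P) by rewrite /ev rmorphB eval_atX eval_atC.
  by rewrite -rmorphM mulrAC -EE -exprS prednK.
exact: evEM0.
Qed.

Lemma moments_endpoints : a = b.
Proof.
have [d [d0 dlam _]] := clear_poles.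
apply: (endpoints_eq d0) => F /dvdpP[G FE]; apply/esym/eqP.
by rewrite -subr_eq0 -lam_deriv FE [G * d]mulrC dlam.
Qed.

(** Divide d by X - p: d / (X - p) = r + d(p) / (X - p). The left side is annihilated by
    [clear_poles], r(W) W' is exact and W closes up, and d(p) is nonzero. *)
Lemma moments_log_integral p : root E p -> reg (W - tof p%:P)^-1 ->
  lam ((W - tof p%:P)^-1 * dW) = 0.
Proof.
move=> Ep Wp; have [d [d0 _ /(_ p Ep)[dp dlam]]] := clear_poles.
have Wp0 : W - tof p%:P != 0.
  by apply: contra_notN W_nonconst; rewrite subr_eq0 => /eqP ->; exists p.
have /factor_theorem[r dE] : root (d - (d.[p])%:P) p.
  by rewrite /root hornerD hornerN hornerC subrr.
have evd : ev d = ev r * (W - tof p%:P) + tof (d.[p])%:P.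
  have -> : W - tof p%:P = ev ('X - p%:P) by rewrite /ev rmorphB eval_atX eval_atC.
  by rewrite -rmorphM -dE -(eval_atC tof W) -rmorphD subrK.
have [F FE] := exists_antiderivative r.
have l0 : lam (ev r * dW) = 0 by rewrite -FE lam_deriv moments_endpoints subrr.
apply: (mulfI dp); rewrite mulr0 -[LHS]addr0 -{1}l0 -lam_linear; last 2 first.
- exact: regM.
- by apply: (regM) => //; exact: reg_eval.
rewrite -[RHS]dlam; congr lam; rewrite -/ev evd [in RHS]mulrDl mulfK //.
by rewrite mulrDl mulrA addrC.
Qed.

End MomentFunctional.

(** * Integration along a curve *)

Section PiecewisePrimitives.
Variable R : realType.
Implicit Types (a b t : R) (w F G phi : R -> R).

Local Notation mu := (@lebesgue_measure R).

Lemma is_derive_within_continuous G phi a b :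
  (forall t, a <= t <= b -> is_derive t 1 G (phi t)) ->
  {within `[a, b], continuous G}.
Proof.
move=> dG; apply: derivable_within_continuous => t; rewrite in_itv /= => abt.
by have [] := dG t abt.
Qed.

(** The integrand is compared with [phi] on the open interval only: at a break point the curve need
    not be differentiable, and [cderiv] there may be unrelated to the one-sided derivatives. The end
    points have measure zero. *)
Lemma integral_open_primitive w G phi a b : a < b -> continuous phi ->
  (forall t, a <= t <= b -> is_derive t 1 G (phi t)) ->
  (forall t, a < t < b -> w t = phi t) ->
  measurable_fun `]a, b[ w /\
  (\int[mu]_(t in `]a, b[) (w t)%:E = (G b - G a)%:E)%E.
Proof.
move=> ab cphi dG wphi.
have wE t : t \in `]a, b[%classic -> phi t = w t.
  by rewrite inE /= in_itv /= => abt; rewrite wphi.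
have mphi : measurable_fun `]a, b[ phi.
  apply: (@measurable_funS _ _ _ _ setT) => //.
  exact: continuous_measurable_fun.
split; first exact: eq_measurable_fun wE mphi.
transitivity (\int[mu]_(t in `]a, b[) (phi t)%:E)%E.
  by apply: eq_integral => t /wE ->.
rewrite -(integral_itv_bndoo true false); last exact/measurable_EFinP.
rewrite (@continuous_FTC2 _ phi G a b) ?EFinB //.
- by apply: continuous_subspaceT => t; exact: cphi.
- have cG := is_derive_within_continuous dG.
  have [_ Ga Gb] := (continuous_within_itvP G ab).1 cG.
  split=> // t; rewrite in_itv /= => /andP[ta tb].
  by have [] := dG t; rewrite ?(ltW ta) ?(ltW tb).
- move=> t; rewrite in_itv /= => /andP[ta tb].
  have [] := dG t; first by rewrite (ltW ta) (ltW tb).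
  by rewrite derive1E.
Qed.

(* [G] is differentiable at the break points too, where [F] need not be. *)
Definition piecewise_primitive (m : nat) (s : nat -> R) (phi : nat -> R -> R)
    (F : R -> R) : Prop :=
  forall k, (k < m)%N -> exists G : R -> R,
    forall t, s k <= t <= s k.+1 -> is_derive t 1 G (phi k t) /\ F t = G t.

Variables (m : nat) (s : nat -> R).
Hypothesis s_incr : forall k, (k < m)%N -> s k < s k.+1.

Lemma subdivision_le k : (k <= m)%N -> s 0%N <= s k.
Proof.
elim: k => // k IH km; rewrite (le_trans (IH (ltnW km))) //.
exact/ltW/s_incr.
Qed.

Lemma integral_piecewise_primitive w (phi : nat -> R -> R) F :
  (forall k, (k < m)%N -> continuous (phi k)) ->
  (forall k, (k < m)%N -> forall t, s k < t < s k.+1 -> w t = phi k t) ->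
  piecewise_primitive m s phi F ->
  \int[mu]_(t in `[s 0%N, s m]) w t = F (s m) - F (s 0%N).
Proof.
move=> cphi wphi phiF; rewrite /Rintegral.
suff H : forall k, (k <= m)%N ->
    measurable_fun `[s 0%N, s k] w /\
    (\int[mu]_(t in `[s 0%N, s k]) (w t)%:E = (F (s k) - F (s 0%N))%:E)%E.
  by rewrite (H m (leqnn m)).2.
elim=> [_|k IH km].
  rewrite set_itv1; split; first exact: measurable_fun_set1.
  by rewrite integral_set1 subrr.
have [mk Ik] := IH (ltnW km); have sk := s_incr km.
have [G GF] := phiF k km.
have [mo Io] := integral_open_primitive sk (cphi k km) (fun t h => (GF t h).1)
  (wphi k km).
have U : `[s 0%N, s k.+1]%classic = `[s 0%N, s k] `|` `]s k, s k.+1].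
  rewrite -itv_bndbnd_setU // ?bnd_simp ?subdivision_le ?(ltW sk) //.
  exact: ltnW.
have mc : measurable_fun `]s k, s k.+1] w.
  rewrite -(@setUitv1 _ _ _ _ true) ?bnd_simp ?(ltW sk) //.
  apply/measurable_funU; [exact: measurable_itv|exact: measurable_set1|].
  by split=> //; exact: measurable_fun_set1.
have mU : measurable_fun `[s 0%N, s k.+1] w by rewrite U; apply/measurable_funU.
split=> //; rewrite U integral_setU //=; last 2 first.
- by rewrite -U; exact/measurable_EFinP.
- apply/disj_setPS => t /=; rewrite !in_itv /= => -[/andP[_ tk] /andP[kt _]].
  by move: kt; rewrite ltNge tk.
rewrite Ik (integral_itv_bndoo false false); last exact/measurable_EFinP.
rewrite Io -EFinD; congr (_%:E).
rewrite -!(GF _ _).2 ?lexx ?(ltW sk) //; ring.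
Qed.

Lemma piecewise_primitive_const F : piecewise_primitive m s (fun _ _ => 0) F ->
  forall t, s 0%N <= t <= s m -> F t = F (s 0%N).
Proof.
move=> F0; suff H : forall k, (k <= m)%N ->
    forall t, s 0%N <= t <= s k -> F t = F (s 0%N) by exact: H.
elim=> [_ t /andP[t0 t1]|k IH km t /andP[t0 tk]].
  by congr F; apply/eqP; rewrite eq_le t0 t1.
have sk := s_incr km; have [tsk|skt] := leP t (s k).
  by apply: (IH (ltnW km)); rewrite t0 tsk.
rewrite -(IH (ltnW km) (s k)) ?lexx ?subdivision_le 1?ltnW //.
have [G GF] := F0 k km.
rewrite !(GF _ _).2 ?lexx ?(ltW sk) ?(ltW skt) //; apply/eqP; rewrite -subr_eq0.
have [||c _ ->] := @MVT_segment _ G (fun=> 0) _ _ (ltW skt).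
- move=> x; rewrite in_itv /= => /andP[kx xt].
  by have [] := GF x; rewrite // (ltW kx) (le_trans (ltW xt) tk).
- apply: (@is_derive_within_continuous _ (fun=> 0)) => x /andP[kx xt].
  by have [] := GF x; rewrite // kx (le_trans xt tk).
- by rewrite mul0r.
Qed.

Lemma exists_antiderivative_on phi a b : continuous phi -> a < b ->
  exists G, forall t, a <= t <= b -> is_derive t 1 G (phi t).
Proof.
(* The interval is enlarged by 1 on both sides so that [a] and [b] are interior and the derivative
   there is two-sided. *)
move=> cphi ab; exists (fun x => \int[mu]_(t in `[a - 1, x]) phi t) => t /andP[ta tb].
have iphi : mu.-integrable `[a - 1, b + 1] (EFin \o phi).
  apply: continuous_compact_integrable; first exact: segment_compact.
  exact: continuous_subspaceT.
have [||dG GE] := continuous_FTC1_closed _ iphi _ (cphi t).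
- by rewrite (le_lt_trans tb) // ltrDl.
- by rewrite (lt_le_trans _ ta) // gtrBl.
apply: (DeriveDef dG); rewrite -derive1E; exact: GE.
Qed.

End PiecewisePrimitives.

Lemma exists_piecewise_primitive (R : realType) (m : nat) (s : nat -> R)
    (phi : nat -> R -> R) :
  (forall k, (k < m)%N -> s k < s k.+1) ->
  (forall k, (k < m)%N -> continuous (phi k)) ->
  exists F, piecewise_primitive m s phi F.
Proof.
elim: m => [_ _|m IH s_incr cphi]; first by exists (fun=> 0).
have [k km|k km|F FP] := IH; first exact/s_incr/ltnW.
  exact/cphi/ltnW.
have sm := s_incr m (leqnn _).
have [G GP] := exists_antiderivative_on (cphi m (leqnn _)) sm.
(* The constant of integration of the last piece is adjusted so that the primitive is continuous at
   the break point. *)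
pose H t := if t <= s m then F t else F (s m) + (G t - G (s m)).
have sk k : (k < m)%N -> s k.+1 <= s m.
  have mono j : (j <= m)%N -> s (m - j)%N <= s m.
    elim: j => [|j IHj jm]; first by rewrite subn0.
    rewrite (le_trans _ (IHj (ltnW jm))) // -[(m - j)%N]prednK ?subn_gt0 //.
    by rewrite -subnS ltW // s_incr // ltnS leq_subr.
  by move=> km; have := mono (m - k.+1)%N (leq_subr _ _); rewrite subKn.
exists H => k; rewrite ltnS leq_eqVlt => /predU1P[->|km].
  exists (fun t => F (s m) + (G t - G (s m))) => t tk.
  have dG := GP t tk; split; first by
    rewrite -[phi m t]subr0 -[_ - 0]add0r; apply: is_deriveD; exact: is_deriveB.
  rewrite /H; case: ifP => // ts; have -> : t = s m.
    by apply/eqP; rewrite eq_le ts; case/andP: tk.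
  by rewrite subrr addr0.
have [G1 GF1] := FP k km.
exists G1 => t tk; have [d FE] := GF1 t tk; split=> //.
rewrite /H (le_trans _ (sk k km)); last by case/andP: tk.
exact: FE.
Qed.

Section PointwiseDerivatives.
Variables (R : realType) (f g : R -> R) (t df dg : R).
Hypotheses (fD : is_derive t 1 f df) (gD : is_derive t 1 g dg).

Lemma is_derive_add : is_derive t 1 (fun s => f s + g s) (df + dg).
Proof. exact: is_deriveD. Qed.

Lemma is_derive_opp : is_derive t 1 (fun s => - f s) (- df).
Proof. exact: is_deriveN. Qed.

Lemma is_derive_mul : is_derive t 1 (fun s => f s * g s) (df * g t + f t * dg).
Proof.
apply: (is_derive_eq (is_deriveM fD gD)).
by rewrite /GRing.scale /= addrC [g t * _]mulrC.
Qed.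

Lemma is_derive_inv : f t != 0 ->
  is_derive t 1 (fun s => (f s)^-1) (- df / (f t) ^+ 2).
Proof.
move=> ft0; apply: (is_derive_eq (is_deriveV ft0 fD)).
by rewrite /GRing.scale /= mulrC mulNr mulrN.
Qed.

End PointwiseDerivatives.

(** * Componentwise calculus for complex paths *)

Section ComplexPaths.
Variable R : realType.
Local Notation cRe := (@complex.Re R).
Local Notation cIm := (@complex.Im R).
Implicit Types (x y : C R) (z w : R -> C R) (t : R) (p : {poly C R}).

Lemma C_ext x y : cRe x = cRe y -> cIm x = cIm y -> x = y.
Proof. by case: x => a b; case: y => c d /= -> ->. Qed.

Lemma cReD x y : cRe (x + y) = cRe x + cRe y.
Proof. by case: x => a b; case: y. Qed.

Lemma cImD x y : cIm (x + y) = cIm x + cIm y.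
Proof. by case: x => a b; case: y. Qed.

Lemma cReN x : cRe (- x) = - cRe x. Proof. by case: x. Qed.
Lemma cImN x : cIm (- x) = - cIm x. Proof. by case: x. Qed.

Lemma cReM x y : cRe (x * y) = cRe x * cRe y - cIm x * cIm y.
Proof. by case: x => a b; case: y. Qed.

Lemma cImM x y : cIm (x * y) = cRe x * cIm y + cIm x * cRe y.
Proof. by case: x => a b; case: y => c d /=; rewrite [LHS]/=. Qed.

Definition sqnorm x : R := cRe x ^+ 2 + cIm x ^+ 2.

Lemma cReV x : cRe x^-1 = cRe x * (sqnorm x)^-1.
Proof. by case: x. Qed.

Lemma cImV x : cIm x^-1 = - (cIm x * (sqnorm x)^-1).
Proof. by case: x. Qed.

Lemma sqnorm_neq0 x : x != 0 -> sqnorm x != 0.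
Proof.
apply: contra_neq => /eqP; rewrite paddr_eq0 ?sqr_ge0 // !sqrf_eq0.
by move=> /andP[/eqP re /eqP im]; exact: C_ext.
Qed.

Definition cderivable z t x :=
  is_derive t 1 (fun s => cRe (z s)) (cRe x) /\
  is_derive t 1 (fun s => cIm (z s)) (cIm x).

Definition ccontinuous z t :=
  {for t, continuous (fun s => cRe (z s))} /\
  {for t, continuous (fun s => cIm (z s))}.

Lemma cderivable_cst x t : cderivable (fun=> x) t 0.
Proof. by split=> /=; exact: is_derive_cst. Qed.

Lemma cderivableD z w t x y : cderivable z t x -> cderivable w t y ->
  cderivable (fun s => z s + w s) t (x + y).
Proof.
move=> [rz iz] [rw iw]; split.
  rewrite cReD; under eq_fun do rewrite cReD; exact: is_derive_add.
rewrite cImD; under eq_fun do rewrite cImD; exact: is_derive_add.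
Qed.

Lemma cderivableM z w t x y : cderivable z t x -> cderivable w t y ->
  cderivable (fun s => z s * w s) t (x * w t + z t * y).
Proof.
move=> [rz iz] [rw iw]; split.
  under eq_fun do rewrite cReM.
  apply: (is_derive_eq (is_derive_add (is_derive_mul rz rw)
    (is_derive_opp (is_derive_mul iz iw)))).
  rewrite cReD !cReM; ring.
under eq_fun do rewrite cImM.
apply: (is_derive_eq (is_derive_add (is_derive_mul rz iw) (is_derive_mul iz rw))).
rewrite cImD !cImM; ring.
Qed.

Lemma is_derive_sqnorm z t x : cderivable z t x ->
  is_derive t 1 (fun s => sqnorm (z s))
    (2 * (cRe (z t) * cRe x + cIm (z t) * cIm x)).
Proof.
move=> [rz iz]; rewrite /sqnorm; under eq_fun do rewrite !expr2.
apply: (is_derive_eq (is_derive_add (is_derive_mul rz rz) (is_derive_mul iz iz))).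
ring.
Qed.

Lemma cderivableV z t x : z t != 0 -> cderivable z t x ->
  cderivable (fun s => (z s)^-1) t (- x * (z t)^-1 * (z t)^-1).
Proof.
move=> zt0 zx; have [rz iz] := zx; have nz := is_derive_sqnorm zx.
have n0 := sqnorm_neq0 zt0.
split.
  under eq_fun do rewrite cReV.
  apply: (is_derive_eq (is_derive_mul rz (is_derive_inv nz n0))).
  rewrite !cReM !cImM cReN cImN cReV cImV; move: n0; rewrite /sqnorm.
  move: (cRe (z t)) (cIm (z t)) (cRe x) (cIm x) => a b c d n0; field.
  by rewrite n0.
under eq_fun do rewrite cImV.
apply: (is_derive_eq (is_derive_opp (is_derive_mul iz (is_derive_inv nz n0)))).
rewrite !cImM !cReM cReN cImN cReV cImV; move: n0; rewrite /sqnorm.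
move: (cRe (z t)) (cIm (z t)) (cRe x) (cIm x) => a b c d n0; field.
by rewrite n0.
Qed.

Lemma cderivable_poly p z t x : cderivable z t x ->
  cderivable (fun s => p.[z s]) t (p^`().[z t] * x).
Proof.
move=> zx; elim/poly_ind: p => [|p c IH].
  rewrite deriv0 horner0 mul0r (_ : (fun s => _) = fun=> 0).
    exact: cderivable_cst.
  by apply/funext => s; rewrite horner0.
rewrite (_ : (fun s => _) = fun s => p.[z s] * z s + c).
  have -> : (p * 'X + c%:P)^`().[z t] * x = p^`().[z t] * x * z t + p.[z t] * x + 0.
    rewrite derivD derivM derivX derivC addr0 mulr1 hornerD hornerM hornerX addr0.
    by rewrite mulrDl mulrAC.
  apply: cderivableD; last exact: cderivable_cst.
  exact: cderivableM.
by apply/funext => s; rewrite hornerMXaddC.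
Qed.

Lemma ccontinuous_cst x t : ccontinuous (fun=> x) t.
Proof. by split; exact: cvg_cst. Qed.

Lemma ccontinuousD z w t : ccontinuous z t -> ccontinuous w t ->
  ccontinuous (fun s => z s + w s) t.
Proof.
move=> [rz iz] [rw iw]; split.
  rewrite (_ : (fun s => _) = (fun s => cRe (z s) + cRe (w s))).
    exact: continuousD.
  by apply/funext => s; rewrite cReD.
rewrite (_ : (fun s => _) = (fun s => cIm (z s) + cIm (w s))).
  exact: continuousD.
by apply/funext => s; rewrite cImD.
Qed.

Lemma ccontinuousM z w t : ccontinuous z t -> ccontinuous w t ->
  ccontinuous (fun s => z s * w s) t.
Proof.
move=> [rz iz] [rw iw]; split.
  rewrite (_ : (fun s => _) = (fun s => cRe (z s) * cRe (w s) - cIm (z s) * cIm (w s))).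
    by apply: continuousB; exact: continuousM.
  by apply/funext => s; rewrite cReM.
rewrite (_ : (fun s => _) = (fun s => cRe (z s) * cIm (w s) + cIm (z s) * cRe (w s))).
  by apply: continuousD; exact: continuousM.
by apply/funext => s; rewrite cImM.
Qed.

Lemma ccontinuousV z t : z t != 0 -> ccontinuous z t ->
  ccontinuous (fun s => (z s)^-1) t.
Proof.
move=> zt0 [rz iz]; have n0 := sqnorm_neq0 zt0.
have nz : {for t, continuous (fun s => (sqnorm (z s))^-1)}.
  apply: continuousV => //.
  rewrite (_ : (fun s => _) = (fun s => cRe (z s) * cRe (z s) + cIm (z s) * cIm (z s))).
    by apply: continuousD; exact: continuousM.
  by apply/funext => s; rewrite /sqnorm !expr2.
split.
  rewrite (_ : (fun s => _) = (fun s => cRe (z s) * (sqnorm (z s))^-1)).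
    exact: continuousM.
  by apply/funext => s; rewrite cReV.
rewrite (_ : (fun s => _) = (fun s => - (cIm (z s) * (sqnorm (z s))^-1))).
  by apply: continuousN; exact: continuousM.
by apply/funext => s; rewrite cImV.
Qed.

Lemma ccontinuous_poly p z t : ccontinuous z t -> ccontinuous (fun s => p.[z s]) t.
Proof.
move=> zc; elim/poly_ind: p => [|p c IH].
  rewrite (_ : (fun s => _) = fun=> 0); first exact: ccontinuous_cst.
  by apply/funext => s; rewrite horner0.
rewrite (_ : (fun s => _) = fun s => p.[z s] * z s + c).
  by apply: ccontinuousD; [exact: ccontinuousM|exact: ccontinuous_cst].
by apply/funext => s; rewrite hornerMXaddC.
Qed.

Lemma cderivable_rval (f : ratfun R) z t x : regular f (z t) -> cderivable z t x ->
  cderivable (fun s => rval f (z s)) t (rval (rderiv f) (z t) * x).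
Proof.
move=> fz zx; have d0 : (rden f).[z t] != 0 by [].
have [_ ->] : regular (rderiv f) (z t) /\ rval (rderiv f) (z t) =
    ((rnum f)^`() * rden f - rnum f * (rden f)^`()).[z t] / (rden f ^+ 2).[z t].
  by apply: rval_fraction; rewrite horner_exp expf_neq0.
have := cderivableM (cderivable_poly (rnum f) zx)
  (cderivableV d0 (cderivable_poly (rden f) zx)).
congr (cderivable _ t _).
rewrite horner_exp hornerD hornerN !hornerM.
have E (K : fieldType) (n d n' d' y : K) : d != 0 ->
    n' * y * d^-1 + n * (- (d' * y) * d^-1 * d^-1) = (n' * d - n * d') / d ^+ 2 * y.
  by move=> dn0; field.
exact: E.
Qed.

Lemma ccontinuous_rval (f : ratfun R) z t : regular f (z t) -> ccontinuous z t ->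
  ccontinuous (fun s => rval f (z s)) t.
Proof.
move=> fz zc; apply: ccontinuousM; first exact: ccontinuous_poly.
by apply: ccontinuousV => //; exact: ccontinuous_poly.
Qed.

End ComplexPaths.

Section Clamp.
Variables (R : realType) (a b : R).
Hypothesis ab : a <= b.

(** The retraction of the line onto the segment; composing with it extends data continuous on [a, b]
    to the whole line. *)
Definition clamp (t : R) : R := Num.max a (Num.min b t).

Lemma clampP t : a <= clamp t <= b.
Proof. by rewrite /clamp le_max lexx ge_max ab ge_min lexx. Qed.

Lemma clamp_id t : a <= t <= b -> clamp t = t.
Proof. by case/andP=> at_ tb; rewrite /clamp min_r // max_r. Qed.

Lemma clamp_continuous : continuous clamp.
Proof.
move=> t; apply: (@continuous_max R R (fun=> a) (fun s => Num.min b s)).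
  exact: cvg_cst.
by apply: (@continuous_min R R (fun=> b) id); [exact: cvg_cst|exact: cvg_id].
Qed.

End Clamp.

Section ComplexExponential.
Variable R : realType.
Local Notation cRe := (@complex.Re R).
Local Notation cIm := (@complex.Im R).
Implicit Types (x y : C R) (z : R -> C R).

Definition cexp x : C R :=
  Complex (expR (cRe x) * cos (cIm x)) (expR (cRe x) * sin (cIm x)).

Lemma cexpN x : cexp x * cexp (- x) = 1.
Proof.
have e : expR (cRe x) * expR (- cRe x) = 1 by rewrite -expRD subrr expR0.
have cs := cos2Dsin2 (cIm x).
apply: C_ext; rewrite ?cReM ?cImM /= cReN cImN cosN sinN.
  transitivity ((expR (cRe x) * expR (- cRe x)) * (cos (cIm x) ^+ 2 + sin (cIm x) ^+ 2)).
    by ring.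
  by rewrite e cs mulr1.
by ring.
Qed.

Lemma cderivable_cexp z t x : cderivable z t x ->
  cderivable (fun s => cexp (z s)) t (cexp (z t) * x).
Proof.
move=> [rz iz].
have de := is_derive1_comp (is_derive_expR _) rz.
have dc := is_derive1_comp (is_derive_cos _) iz.
have ds := is_derive1_comp (is_derive_sin _) iz.
split.
  apply: (is_derive_eq (is_derive_mul de dc)).
  rewrite cReM /=; ring.
apply: (is_derive_eq (is_derive_mul de ds)).
rewrite cImM /=; ring.
Qed.

(** [acos] gives an angle with the right cosine and nonnegative sine; the sign of the imaginary part
    decides between it and its opposite. *)
Lemma polar_form x : x != 0 -> exists r a : R, 0 < r /\
  x = Complex (r * cos a) (r * sin a).
Proof.
move=> x0; pose n := sqnorm x.
have n0 : 0 < n.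
  by rewrite lt0r sqnorm_neq0 // addr_ge0 ?sqr_ge0.
pose r := Num.sqrt n; have r0 : 0 < r by rewrite sqrtr_gt0.
have r2 : r ^+ 2 = n by rewrite sqr_sqrtr // ltW.
pose u := cRe x / r.
have ru : r * u = cRe x by rewrite mulrC mulfVK // gt_eqF.
have v2 : r ^+ 2 * (1 - u ^+ 2) = cIm x ^+ 2.
  by rewrite mulrBr mulr1 -exprMn ru r2 /n /sqnorm; ring.
have u1 : 0 <= 1 - u ^+ 2.
  by rewrite -(pmulr_rge0 _ (exprn_gt0 2 r0)) v2 sqr_ge0.
have ub : -1 <= u <= 1.
  rewrite -ler_norml -(@ler_pXn2r _ 2) ?nnegrE // expr1n real_normK ?num_real //.
  by rewrite -subr_ge0.
have sE : r * sin (acos u) = `|cIm x|.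
  rewrite sin_acos // -[r]ger0_norm ?ltW // -sqrtr_sqr -sqrtrM ?sqr_ge0 // v2.
  by rewrite sqrtr_sqr.
have cE : r * cos (acos u) = cRe x by rewrite acosK ?in_itv.
have [y0|y0] := leP 0 (cIm x).
  exists r, (acos u); split=> //; apply: C_ext => /=; first by rewrite cE.
  by rewrite sE ger0_norm.
exists r, (- acos u); split=> //; apply: C_ext => /=; first by rewrite cosN cE.
by rewrite sinN mulrN sE ltr0_norm // opprK.
Qed.

End ComplexExponential.

(** * Primitives and integrals along a piecewise smooth curve *)

Section AlongCurve.
Variables (R : realType) (g : R -> C R) (m : nat) (s : nat -> R) (q : nat -> R -> C R).
Local Notation cRe := (@complex.Re R).
Local Notation cIm := (@complex.Im R).
Hypotheses (s_0 : s 0%N = 0) (s_m : s m = 1)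
  (s_incr : forall k, (k < m)%N -> s k < s k.+1)
  (gq : forall k, (k < m)%N -> C1 (q k) /\
     forall t, s k <= t <= s k.+1 -> g t = q k t).
Implicit Types f : ratfun R.

Definition regular_along f := forall t, 0 <= t <= 1 -> regular f (g t).

Definition piece_integrand f k t : C R := rval f (q k t) * cderiv (q k) t.

Definition curve_primitive f (F : R -> C R) := forall k, (k < m)%N ->
  exists G : R -> C R, forall t, s k <= t <= s k.+1 ->
    cderivable G t (piece_integrand f k t) /\ F t = G t.

Lemma subdivision01 k t : (k < m)%N -> s k <= t <= s k.+1 -> 0 <= t <= 1.
Proof.
move=> km /andP[kt tk]; rewrite -s_0 (le_trans _ kt) /=; last first.
  exact: (subdivision_le s_incr (ltnW km)).
rewrite (le_trans tk) // -s_m.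
have := @subdivision_le R (m - k.+1) (fun j => s (k.+1 + j)%N).
move=> /(_ _ (m - k.+1)%N (leqnn _)); rewrite addn0 subnKC //; apply.
move=> j jm; rewrite addnS; apply: s_incr.
by rewrite -ltn_subRL.
Qed.

Lemma regular_piece f k t : regular_along f -> (k < m)%N -> s k <= t <= s k.+1 ->
  regular f (q k t).
Proof.
move=> fr km tk; rewrite -((gq km).2 t tk); apply: fr; exact: subdivision01 tk.
Qed.

Lemma cderivable_piece k t : (k < m)%N -> cderivable (q k) t (cderiv (q k) t).
Proof.
move=> km; have [[rq [iq _]] _] := gq km.
by split; rewrite /cderiv /= derive1E; exact: derivableP.
Qed.

Lemma ccontinuous_piece k t : (k < m)%N ->
  ccontinuous (q k) t /\ ccontinuous (cderiv (q k)) t.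
Proof.
move=> km; have [[rq [iq [crq ciq]]] _] := gq km; split.
  by split; apply/differentiable_continuous/derivable1_diffP; [exact: rq|exact: iq].
by split; [exact: crq|exact: ciq].
Qed.

(** Outside its own segment the piece [q k] may meet poles of [f]. Clamping the parameter gives an
    integrand continuous on the whole line. *)
Let phi f k t : C R := piece_integrand f k (clamp (s k) (s k.+1) t).

Let phi_continuous f k : regular_along f -> (k < m)%N ->
  continuous (fun t => cRe (phi f k t)) /\ continuous (fun t => cIm (phi f k t)).
Proof.
move=> fr km; have sk := ltW (s_incr km).
have [c1 c2] :
    (forall t, {for clamp (s k) (s k.+1) t,
       continuous (fun t => cRe (piece_integrand f k t))}) /\
    (forall t, {for clamp (s k) (s k.+1) t,
       continuous (fun t => cIm (piece_integrand f k t))}).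
  have H t : ccontinuous (piece_integrand f k) (clamp (s k) (s k.+1) t).
    have [cq cdq] := ccontinuous_piece (clamp (s k) (s k.+1) t) km.
    apply: ccontinuousM => //; apply: ccontinuous_rval => //.
    exact: (regular_piece fr km (clampP sk t)).
  by split=> t; have [] := H t.
split=> t; apply: (@continuous_comp _ _ _ (clamp (s k) (s k.+1))
    (fun t => _ (piece_integrand f k t))).
- exact: clamp_continuous.
- exact: c1.
- exact: clamp_continuous.
- exact: c2.
Qed.

Lemma exists_curve_primitive f : regular_along f -> exists F, curve_primitive f F.
Proof.
move=> fr.
have [F1 F1P] := exists_piecewise_primitive s_incr
  (fun k km => (phi_continuous fr km).1).
have [F2 F2P] := exists_piecewise_primitive s_incr
  (fun k km => (phi_continuous fr km).2).
exists (fun t => Complex (F1 t) (F2 t)) => k km.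
have [G1 G1P] := F1P k km; have [G2 G2P] := F2P k km.
exists (fun t => Complex (G1 t) (G2 t)) => t tk.
have [d1 ->] := G1P t tk; have [d2 ->] := G2P t tk; split=> //.
by move: d1 d2; rewrite /phi clamp_id.
Qed.

Lemma cderiv_open k t : (k < m)%N -> s k < t < s k.+1 -> cderiv g t = cderiv (q k) t.
Proof.
move=> km tk; have [_ gE] := gq km.
have gqn : \forall x \near t, g x = q k x.
  have : \forall x \near t, x \in `]s k, s k.+1[.
    by apply: near_in_itvoo; rewrite in_itv.
  apply: filterS => x; rewrite in_itv /= => /andP[xk kx].
  by apply: gE; rewrite (ltW xk) (ltW kx).
apply: C_ext => /=; rewrite !derive1E; apply: near_eq_derive;
  by apply: filterS gqn => x ->.
Qed.

Lemma curve_integral_primitive f F : regular_along f -> curve_primitive f F ->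
  curve_integral g (rval f) = F 1 - F 0.
Proof.
move=> fr FP.
have E k t : (k < m)%N -> s k < t < s k.+1 ->
    rval f (g t) * cderiv g t = phi f k t.
  move=> km tk; have tk' : s k <= t <= s k.+1.
    by case/andP: tk => /ltW -> /ltW ->.
  by rewrite (cderiv_open km tk) /phi clamp_id // /piece_integrand (gq km).2.
rewrite /curve_integral; apply: C_ext.
  rewrite cReD cReN /= -{1}s_0 -{1}s_m -[in RHS]s_m -[in RHS]s_0.
  apply: (@integral_piecewise_primitive R m s s_incr _ (fun k t => cRe (phi f k t))
    (fun t => cRe (F t))) => [k km|k km t tk|k km].
  - exact: (phi_continuous fr km).1.
  - by rewrite (E k).
  - have [G GP] := FP k km; exists (fun t => cRe (G t)) => t tk.
    by have [[d _] ->] := GP t tk; rewrite /phi clamp_id.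
rewrite cImD cImN /= -{1}s_0 -{1}s_m -[in RHS]s_m -[in RHS]s_0.
apply: (@integral_piecewise_primitive R m s s_incr _ (fun k t => cIm (phi f k t))
  (fun t => cIm (F t))) => [k km|k km t tk|k km].
- exact: (phi_continuous fr km).2.
- by rewrite (E k).
- have [G GP] := FP k km; exists (fun t => cIm (G t)) => t tk.
  by have [[_ d] ->] := GP t tk; rewrite /phi clamp_id.
Qed.

(** Linearity is read off from primitives, so that no integrability has to be discussed
    separately. *)
Lemma curve_integral_linear (c : C R) f1 f2 : regular_along f1 -> regular_along f2 ->
  curve_integral g (rval (tofr c%:P * f1 + f2))
  = c * curve_integral g (rval f1) + curve_integral g (rval f2).
Proof.
move=> r1 r2; have E t : 0 <= t <= 1 -> regular (tofr c%:P * f1 + f2) (g t) /\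
    rval (tofr c%:P * f1 + f2) (g t) = c * rval f1 (g t) + rval f2 (g t).
  move=> t01; have [rc vc] := rval_poly c%:P (g t).
  have [rm vm] := rvalM rc (r1 t t01); have [rd vd] := rvalD rm (r2 t t01).
  by split=> //; rewrite vd vm vc hornerC.
have [F1 F1P] := exists_curve_primitive r1.
have [F2 F2P] := exists_curve_primitive r2.
rewrite (curve_integral_primitive r1 F1P) (curve_integral_primitive r2 F2P).
rewrite (@curve_integral_primitive _ (fun t => c * F1 t + F2 t)).
- have D (K : comPzRingType) (e a b x y : K) :
    e * a + x - (e * b + y) = e * (a - b) + (x - y) by ring.
  exact: D.
- by move=> t /E[].
move=> k km; have [G1 G1P] := F1P k km; have [G2 G2P] := F2P k km.
exists (fun t => c * G1 t + G2 t) => t tk.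
have [d1 ->] := G1P t tk; have [d2 ->] := G2P t tk; split=> //.
have [_ v] := E t (subdivision01 km tk).
rewrite /piece_integrand -((gq km).2 t tk) v.
have := cderivableD (cderivableM (cderivable_cst c t) d1) d2.
rewrite /piece_integrand -((gq km).2 t tk).
congr (cderivable _ t _).
have D (K : comPzRingType) (e a b x y : K) :
  0 * y + e * (a * x) + b * x = (e * a + b) * x by ring.
exact: D.
Qed.

Lemma curve_primitive_rval f : regular_along f ->
  curve_primitive (rderiv f) (fun t => rval f (g t)).
Proof.
move=> fr k km; exists (fun t => rval f (q k t)) => t tk.
rewrite ((gq km).2 t tk); split=> //; apply: cderivable_rval.
  exact: regular_piece tk.
exact: cderivable_piece.
Qed.

Lemma regular_along_rderiv f : regular_along f -> regular_along (rderiv f).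
Proof. by move=> fr t t01; apply: regular_rderiv; exact: fr. Qed.

Lemma curve_integral_rderiv f : regular_along f ->
  curve_integral g (rval (rderiv f)) = rval f (g 1) - rval f (g 0).
Proof.
move=> fr; apply: (@curve_integral_primitive _ (fun t => rval f (g t))).
  exact: regular_along_rderiv.
exact: curve_primitive_rval.
Qed.

Lemma curve_const (u : R -> C R) : (forall k, (k < m)%N -> exists G : R -> C R,
    forall t, s k <= t <= s k.+1 -> cderivable G t 0 /\ u t = G t) ->
  forall t, 0 <= t <= 1 -> u t = u 0.
Proof.
move=> uG t; rewrite -{1}s_0 -{1}s_m -[in u 0]s_0 => t01; apply: C_ext.
  apply: (@piecewise_primitive_const R m s s_incr (fun t => cRe (u t))) t01.
  move=> k km; have [G GP] := uG k km; exists (fun t => cRe (G t)) => t' tk.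
  by have [[d _] ->] := GP t' tk.
apply: (@piecewise_primitive_const R m s s_incr (fun t => cIm (u t))) t01.
move=> k km; have [G GP] := uG k km; exists (fun t => cIm (G t)) => t' tk.
by have [[_ d] ->] := GP t' tk.
Qed.

Lemma piecewise_within_continuous (f : R -> R) :
  (forall k, (k < m)%N -> {within `[s k, s k.+1], continuous f}) ->
  {within `[0, 1], continuous f}.
Proof.
move=> fk; rewrite -s_0 -s_m.
suff H : forall k, (k <= m)%N -> {within `[s 0%N, s k], continuous f} by exact: H.
elim=> [_|k IH km]; first by rewrite set_itv1; exact: continuous_subspace1.
rewrite (_ : `[s 0%N, s k.+1]%classic = `[s 0%N, s k] `|` `[s k, s k.+1]).
  apply: withinU_continuous; [exact: itv_closed|exact: itv_closed| |].
    exact/IH/ltnW.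
  exact: fk.
apply/seteqP; split=> t /=; rewrite !in_itv /=.
  move=> /andP[t0 t1]; case: (leP t (s k)) => tk; first by left; rewrite t0.
  by right; rewrite (ltW tk).
have s0k := subdivision_le s_incr (ltnW km); have sk := ltW (s_incr km).
case=> /andP[t1 t2]; first by rewrite t1 (le_trans t2).
by rewrite (le_trans s0k t1).
Qed.

Lemma cderivable_within_continuous (F : R -> C R) (dF : nat -> R -> C R) :
  (forall k, (k < m)%N -> exists G : R -> C R, forall t, s k <= t <= s k.+1 ->
    cderivable G t (dF k t) /\ F t = G t) ->
  {within `[0, 1], continuous (fun t => cRe (F t))} /\
  {within `[0, 1], continuous (fun t => cIm (F t))}.
Proof.
move=> FG; split; apply: piecewise_within_continuous => k km; have [G GP] := FG k km.
  apply: (@subspace_eq_continuous _ _ _ (fun t => cRe (G t))).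
    by move=> t; rewrite inE /= in_itv /= => tk; rewrite /from_subspace /= (GP t tk).2.
  apply: (@is_derive_within_continuous _ _ (fun t => cRe (dF k t))).
  by move=> t tk; have [[d _] _] := GP t tk.
apply: (@subspace_eq_continuous _ _ _ (fun t => cIm (G t))).
  by move=> t; rewrite inE /= in_itv /= => tk; rewrite /from_subspace /= (GP t tk).2.
apply: (@is_derive_within_continuous _ _ (fun t => cIm (dF k t))).
by move=> t tk; have [[_ d] _] := GP t tk.
Qed.

(* If [F] is a primitive of [W' / (W - p)] along the curve, then
   [(W - p) * exp (- F)] is constant. *)
Lemma log_lift W (p c : C R) : c != 0 -> W - tofr p%:P != 0 -> regular_along W ->
  regular_along (W - tofr p%:P)^-1 ->
  curve_integral g (rval ((W - tofr p%:P)^-1 * rderiv W)) = 0 ->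
  exists rho theta : R -> R, [/\ forall t, 0 < rho t,
    {within `[0, 1], continuous theta}, theta 1 = theta 0 &
    forall t, 0 <= t <= 1 -> c * (rval W (g t) - p) =
      Complex (rho t * cos (theta t)) (rho t * sin (theta t))].
Proof.
move=> c0 Wp0 rW; set V := (W - tofr p%:P)^-1 => rV I0.
have rWp t : 0 <= t <= 1 -> regular (W - tofr p%:P) (g t) /\
    rval (W - tofr p%:P) (g t) = rval W (g t) - p.
  move=> t01; have [rp vp] := rval_poly (- p%:P) (g t).
  have [rd vd] := rvalD (rW t t01) rp; rewrite rmorphN in rd vd vp.
  by split=> //; rewrite vd vp hornerN hornerC.
have WV t : 0 <= t <= 1 -> rval V (g t) * (rval W (g t) - p) = 1.
  move=> t01; have [r1 v1] := rWp t t01; have [_] := rvalM (rV t t01) r1.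
  rewrite v1 => <-; rewrite /V mulVf //.
  by have [_] := rval_poly 1 (g t); rewrite rmorph1 hornerC.
have rf : regular_along (V * rderiv W).
  by move=> t t01; exact: (rvalM (rV t t01) (regular_along_rderiv rW t01)).1.
have [F FP] := exists_curve_primitive rf.
have F10 : F 1 = F 0.
  by apply/eqP; rewrite -subr_eq0 -(curve_integral_primitive rf FP) I0.
pose u t := (rval W (g t) - p) * cexp (- F t).
have uE : forall t, 0 <= t <= 1 -> u t = u 0.
  apply: curve_const => k km; have [G GP] := FP k km.
  exists (fun t => (rval W (q k t) - p) * cexp (-1 * G t)) => t tk.
  have t01 := subdivision01 km tk; have [dG FG] := GP t tk.
  split; last by rewrite /u FG ((gq km).2 t tk) mulN1r.
  have dW := cderivable_rval (regular_piece rW km tk) (cderivable_piece t km).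
  have dWp := cderivableD dW (cderivable_cst (- p) t).
  have dN := cderivableM (cderivable_cst (-1) t) dG.
  have dE := cderivable_cexp dN.
  have := cderivableM dWp dE.
  congr (cderivable _ t _).
  have [_ vf] := rvalM (rV t t01) (regular_along_rderiv rW t01).
  have := WV t t01; rewrite /piece_integrand -((gq km).2 t tk) vf.
  have D (K : comNzRingType) (v w w' q' e y : K) : v * w = 1 ->
      (w' * q' + 0) * e + w * (e * (0 * y + -1 * (v * w' * q'))) = 0.
    move=> vw; have -> : (w' * q' + 0) * e + w * (e * (0 * y + -1 * (v * w' * q')))
      = (1 - v * w) * (w' * q' * e) by ring.
    by rewrite vw subrr mul0r.
  by move=> /D; exact.
have u0 : c * u 0 != 0.
  have l01 : 0 <= (0 : R) <= 1 by rewrite lexx ler01.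
  rewrite mulf_neq0 // mulf_neq0 //.
    apply: contra_eq_neq (WV 0 l01) => ->; rewrite mulr0 eq_sym; exact: oner_neq0.
  apply: contra_eq_neq (cexpN (- F 0)) => ->; rewrite mul0r eq_sym; exact: oner_neq0.
(* If c u(0) = r exp(i a), then c (W - p) = r exp(i a) exp(F) along the curve: the angle is a + Im
   F, and it closes up because F(1) = F(0). *)
have [r [a [r0 uE0]]] := polar_form u0.
exists (fun t => r * expR (cRe (F t))), (fun t => a + cIm (F t)); split.
- by move=> t; rewrite mulr_gt0 // expR_gt0.
- move=> t; apply: cvgD; first exact: cvg_cst.
  exact: (cderivable_within_continuous FP).2.
- by rewrite F10.
move=> t t01; have -> : c * (rval W (g t) - p) = c * u 0 * cexp (F t).
  rewrite -(uE t t01) /u -[in LHS](mulr1 (rval W (g t) - p)) -(cexpN (- F t)) opprK.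
  by rewrite !mulrA.
rewrite uE0; apply: C_ext; rewrite ?cReM ?cImM /= ?cosD ?sinD; ring.
Qed.

End AlongCurve.

(** * Homology of the punctured plane *)

Section Boundaries.
Variables (R : realType) (X : topologicalType) (U : set X).
Implicit Types (b : (R -> X) -> int).

(** Chains are kept as their coefficient functions, so that homologies can be added and compared
    pointwise by ring identities; [homologous_to_zero] is the case where [b] is the coefficient
    function of one path. *)
Definition is_boundary b :=
  exists (m : nat) (n : 'I_m -> int) (s : 'I_m -> R * R -> X),
    (forall k, {within @stdtriangle R, continuous (s k)} /\
               s k @` @stdtriangle R `<=` U) /\
    forall c : R -> X,
      \sum_(k < m) n k * (scoef (sface0 (s k)) c - scoef (sface1 (s k)) c
                          + scoef (sface2 (s k)) c) = b c.

Lemma eq_boundary b b' : b =1 b' -> is_boundary b -> is_boundary b'.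
Proof. by move=> /funext ->. Qed.

Lemma is_boundaryD b b' : is_boundary b -> is_boundary b' ->
  is_boundary (fun c => b c + b' c).
Proof.
move=> [m [n [s [sU bE]]]] [m' [n' [s' [s'U b'E]]]].
exists (m + m')%N, (fun k => match fintype.split k with inl i => n i | inr i => n' i end),
  (fun k => match fintype.split k with inl i => s i | inr i => s' i end); split.
  by move=> k; case: (fintype.split k) => i; [exact: sU|exact: s'U].
move=> c; rewrite big_split_ord -bE -b'E /=; congr (_ + _); apply: eq_bigr => i _.
  by rewrite -[lshift _ i]/(unsplit (inl i)) unsplitK.
by rewrite -[rshift _ i]/(unsplit (inr i)) unsplitK.
Qed.

Lemma is_boundaryZ (e : int) b : is_boundary b -> is_boundary (fun c => e * b c).
Proof.
move=> [m [n [s [sU bE]]]]; exists m, (fun k => e * n k), s; split=> // c.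
by rewrite -bE mulr_sumr; apply: eq_bigr => k _; rewrite mulrA.
Qed.

Lemma is_boundaryB b b' : is_boundary b -> is_boundary b' ->
  is_boundary (fun c => b c - b' c).
Proof.
move=> bb /(is_boundaryZ (-1)) bb'; apply: eq_boundary (is_boundaryD bb bb') => c.
by rewrite mulN1r.
Qed.

Variables (Psi : R * R -> X) (V : set (R * R)).
Hypotheses (Psi_continuous : continuous Psi) (PsiV : forall w, V w -> U (Psi w)).
Implicit Types (gamma delta : R -> R * R) (C : set (R * R)) (u v w : R * R).

Definition path_chain gamma : (R -> X) -> int := scoef (Psi \o gamma).

Lemma simplex_boundary (sigma : R * R -> R * R) : continuous sigma ->
  (forall x, stdtriangle x -> V (sigma x)) ->
  is_boundary (fun c => path_chain (fun t => sigma (1 - t, t)) c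
    - path_chain (fun t => sigma (0, t)) c + path_chain (fun t => sigma (t, 0)) c).
Proof.
move=> sc sV; exists 1%N, (fun=> 1), (fun=> Psi \o sigma); split.
  move=> _; split; last by move=> _ [x xT <-]; exact/PsiV/sV.
  apply: continuous_subspaceT => x.
  by apply: continuous_comp; [exact: sc|exact: Psi_continuous].
by move=> c; rewrite big_ord1 mul1r.
Qed.

(** The three faces of a constant 2-simplex coincide and carry the signs +, -, +, which leaves one
    of them. *)
Lemma const_boundary w : V w -> is_boundary (path_chain (fun=> w)).
Proof.
move=> Vw; have wc : continuous (fun _ : R * R => w) by move=> x; exact: cvg_cst.
have := simplex_boundary wc (fun _ _ => Vw).
by apply: eq_boundary => c; rewrite subrr add0r.
Qed.

Definition lerp u v (t : R) : R * R :=
  (u.1 + t * (v.1 - u.1), u.2 + t * (v.2 - u.2)).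

Definition segment u v := path_chain (lerp u v).

Definition arc delta (s t : R) := path_chain (fun x => delta (s + x * (t - s))).

Definition is_convex C := forall u v t, C u -> C v -> 0 <= t <= 1 -> C (lerp u v t).

Definition bary u v w (x : R * R) : R * R :=
  (u.1 + x.1 * (v.1 - u.1) + x.2 * (w.1 - u.1),
   u.2 + x.1 * (v.2 - u.2) + x.2 * (w.2 - u.2)).

Lemma bary_convex C u v w x : is_convex C -> C u -> C v -> C w -> stdtriangle x ->
  C (bary u v w x).
Proof.
move=> Cc Cu Cv Cw [x1 x2 x12]; have [s0|s0] := eqVneq (x.1 + x.2) 0.
  have /eqP := s0; rewrite paddr_eq0 // => /andP[/eqP e1 /eqP e2].
  by rewrite /bary e1 e2 !mul0r !addr0; case: (u) Cu.
have sp : 0 < x.1 + x.2 by rewrite lt0r s0 addr_ge0.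
have E (a b c : R) : a + x.1 * (b - a) + x.2 * (c - a) =
    a + (x.1 + x.2) * (b + x.2 / (x.1 + x.2) * (c - b) - a) by field.
have -> : bary u v w x = lerp u (lerp v w (x.2 / (x.1 + x.2))) (x.1 + x.2).
  by rewrite /bary /lerp /= -!E.
apply: (Cc) => //; last by rewrite (ltW sp).
apply: (Cc) => //; rewrite divr_ge0 ?(ltW sp) //=.
by rewrite ler_pdivrMr // mul1r lerDr.
Qed.

Let fst_continuous : continuous (fun x : R * R => x.1).
Proof. by move=> x; exact: cvg_fst. Qed.

Let snd_continuous : continuous (fun x : R * R => x.2).
Proof. by move=> x; exact: cvg_snd. Qed.

Lemma pair_continuous (T : topologicalType) (f h : T -> R) t :
  {for t, continuous f} -> {for t, continuous h} ->
  {for t, continuous (fun t => (f t, h t))}.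
Proof. by move=> ft ht; exact: (cvg_pair ft ht). Qed.

Lemma lerp_continuous (T : topologicalType) (A B : T -> R * R) (y : T -> R) :
  continuous A -> continuous B -> continuous y ->
  continuous (fun t => lerp (A t) (B t) (y t)).
Proof.
move=> Ac Bc yc t.
have A1 : {for t, continuous (fun t => (A t).1)}.
  by apply: continuous_comp; [exact: Ac|exact: fst_continuous].
have A2 : {for t, continuous (fun t => (A t).2)}.
  by apply: continuous_comp; [exact: Ac|exact: snd_continuous].
have B1 : {for t, continuous (fun t => (B t).1)}.
  by apply: continuous_comp; [exact: Bc|exact: fst_continuous].
have B2 : {for t, continuous (fun t => (B t).2)}.
  by apply: continuous_comp; [exact: Bc|exact: snd_continuous].
apply: (@pair_continuous T (fun t => (A t).1 + y t * ((B t).1 - (A t).1))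
  (fun t => (A t).2 + y t * ((B t).2 - (A t).2))).
  by apply: cvgD; [exact: A1|apply: cvgM; [exact: yc|apply: cvgB; [exact: B1|exact: A1]]].
by apply: cvgD; [exact: A2|apply: cvgM; [exact: yc|apply: cvgB; [exact: B2|exact: A2]]].
Qed.

Let affine_continuous (a b e : R) :
  continuous (fun x : R * R => a + x.1 * b + x.2 * e).
Proof.
by move=> x; apply: cvgD; (try apply: cvgD); (try exact: cvg_cst);
  apply: cvgMl; (exact: fst_continuous || exact: snd_continuous).
Qed.

Lemma bary_continuous u v w : continuous (bary u v w).
Proof.
by move=> x; have := pair_continuous (@affine_continuous u.1 (v.1 - u.1) (w.1 - u.1) x)
  (@affine_continuous u.2 (v.2 - u.2) (w.2 - u.2) x).
Qed.

Lemma convex_triangle C u v w : is_convex C -> C `<=` V -> C u -> C v -> C w ->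
  is_boundary (fun c => segment u v c + segment v w c - segment u w c).
Proof.
move=> Cc CV Cu Cv Cw.
have e0 : (fun t => bary u v w (1 - t, t)) = lerp v w.
  by apply/funext => t; rewrite /bary /lerp /=; congr pair; ring.
have e1 : (fun t => bary u v w (0, t)) = lerp u w.
  by apply/funext => t; rewrite /bary /lerp /=; congr pair; ring.
have e2 : (fun t => bary u v w (t, 0)) = lerp u v.
  by apply/funext => t; rewrite /bary /lerp /=; congr pair; ring.
have := simplex_boundary (@bary_continuous u v w)
  (fun x xT => CV _ (bary_convex Cc Cu Cv Cw xT)).
by apply: eq_boundary => c; rewrite e0 e1 e2 /segment; ring.
Qed.

Section Arcs.
Variable delta : R -> R * R.
Hypotheses (delta_continuous : continuous delta) (delta_V : forall t, V (delta t)).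

(** The simplex is [delta] composed with an affine map from the triangle to the parameter line, so
    it stays on the curve. *)
Lemma arc_triangle (s t x : R) :
  is_boundary (fun c => arc delta s t c + arc delta t x c - arc delta s x c).
Proof.
pose sigma (y : R * R) := delta (s + y.1 * (t - s) + y.2 * (x - s)).
have sc : continuous sigma.
  by move=> y; apply: continuous_comp; [exact: affine_continuous|exact: delta_continuous].
have e0 : (fun y => sigma (1 - y, y)) = fun y => delta (t + y * (x - t)).
  by apply/funext => y; rewrite /sigma /=; congr delta; ring.
have e1 : (fun y => sigma (0, y)) = fun y => delta (s + y * (x - s)).
  by apply/funext => y; rewrite /sigma /=; congr delta; ring.
have e2 : (fun y => sigma (y, 0)) = fun y => delta (s + y * (t - s)).
  by apply/funext => y; rewrite /sigma /=; congr delta; ring.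
have := simplex_boundary sc (fun y _ => delta_V _).
by apply: eq_boundary => c; rewrite e0 e1 e2 /arc; ring.
Qed.

Lemma arc_refl (s : R) : is_boundary (arc delta s s).
Proof.
rewrite /arc (_ : (fun x => _) = fun=> delta s); first exact: const_boundary.
by apply/funext => x; rewrite subrr mulr0 addr0.
Qed.

(* The homotopy between the arc and its chord is cut into two triangles. *)
Lemma convex_arc C (s t : R) : is_convex C -> C `<=` V ->
  (forall x, 0 <= x <= 1 -> C (delta (s + x * (t - s)))) ->
  is_boundary (fun c => arc delta s t c - segment (delta s) (delta t) c).
Proof.
move=> Cc CV Cd.
pose H (x y : R) := lerp (delta (s + x * (t - s))) (lerp (delta s) (delta t) x) y.
have Cs : C (delta s) by have := Cd 0; rewrite mul0r addr0; apply; rewrite lexx ler01.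
have Ct : C (delta t).
  by have := Cd 1; rewrite mul1r [s + _]addrC subrK; apply; rewrite lexx ler01.
have HV x y : 0 <= x <= 1 -> 0 <= y <= 1 -> V (H x y).
  by move=> x01 y01; apply/CV/(Cc) => //; [exact: Cd|exact: Cc].
have Hc (f h : R * R -> R) : continuous f -> continuous h ->
    continuous (fun z => H (f z) (h z)).
  move=> fc hc; apply: lerp_continuous => //.
    move=> z; apply: continuous_comp; last exact: delta_continuous.
    apply: cvgD; first exact: cvg_cst.
    by apply: cvgM; [exact: fc|exact: cvg_cst].
  by apply: lerp_continuous => // z; exact: cvg_cst.
have add_c : continuous (fun z : R * R => z.1 + z.2).
  by move=> z; apply: cvgD; [exact: fst_continuous|exact: snd_continuous].
have T1 : forall z : R * R, stdtriangle z -> V (H (z.1 + z.2) z.2).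
  move=> z [z1 z2 z12]; apply: HV; rewrite ?addr_ge0 // z2 /=.
  by rewrite (le_trans _ z12) // lerDr.
have T2 : forall z : R * R, stdtriangle z -> V (H z.2 (z.1 + z.2)).
  move=> z [z1 z2 z12]; apply: HV; rewrite ?addr_ge0 // z2 /=.
  by rewrite (le_trans _ z12) // lerDr.
have c1 : continuous (fun z : R * R => H (z.1 + z.2) z.2).
  exact: (Hc _ _ add_c snd_continuous).
have c2 : continuous (fun z : R * R => H z.2 (z.1 + z.2)).
  exact: (Hc _ _ snd_continuous add_c).
have d t0 : H t0 0 = delta (s + t0 * (t - s)).
  by rewrite /H /lerp !mul0r !addr0; case: (delta _).
have l t0 : H t0 1 = lerp (delta s) (delta t) t0.
  by rewrite /H /lerp /= !mul1r; congr pair; ring.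
have Hs y : H 0 y = delta s.
  by rewrite /H /lerp /= !mul0r !addr0 !subrr !mulr0 !addr0; case: (delta s).
have Ht y : H 1 y = delta t.
  have e : s + (t - s) = t by ring.
  rewrite /H /lerp /= !mul1r e; case: (delta t) (delta s) => [t1 t2] [s1 s2] /=.
  by congr pair; ring.
have B1 := simplex_boundary c1 T1; have B2 := simplex_boundary c2 T2.
have := is_boundaryB (is_boundaryB B1 B2)
  (is_boundaryB (const_boundary (delta_V t)) (const_boundary (delta_V s))).
apply: eq_boundary => c /=.
have E0 : (fun y => H (1 - y + y) y) = fun=> delta t.
  by apply/funext => y; rewrite subrK Ht.
have E1 : (fun y => H (0 + y) y) = fun y => H y y.
  by apply/funext => y; rewrite add0r.
have E2 : (fun y => H (y + 0) 0) = fun y => delta (s + y * (t - s)).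
  by apply/funext => y; rewrite addr0 d.
have E3 : (fun y => H y (1 - y + y)) = lerp (delta s) (delta t).
  by apply/funext => y; rewrite subrK l.
have E4 : (fun y => H y (0 + y)) = fun y => H y y.
  by apply/funext => y; rewrite add0r.
have E5 : (fun y => H 0 (y + 0)) = fun=> delta s.
  by apply/funext => y; rewrite Hs.
rewrite E0 E1 E2 E3 E4 E5 /arc /segment; ring.
Qed.

End Arcs.

End Boundaries.

Section FiniteBounds.
Variables (R : realType) (I : finType).

Lemma exists_upper_bound (F : I -> R) : exists M, 0 < M /\ forall i, F i < M.
Proof.
have s0 : 0 <= \sum_i `|F i| by apply: sumr_ge0.
exists (1 + \sum_i `|F i|); split; first by rewrite ltr_wpDr.
move=> i; rewrite (le_lt_trans (ler_norm _)) // (bigD1 i) //= addrCA ltrDl.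
by rewrite ltr_wpDr // sumr_ge0.
Qed.

Lemma exists_lower_bound (F : I -> R) : (forall i, 0 < F i) ->
  exists e, 0 < e /\ forall i, e < F i.
Proof.
move=> F0; have [M [M0 MF]] := exists_upper_bound (fun i => (F i)^-1).
exists M^-1; rewrite invr_gt0; split=> // i.
by rewrite -[F i]invrK ltf_pV2 ?posrE ?invr_gt0.
Qed.

End FiniteBounds.

Section LerpBounds.
Variable R : realType.
Implicit Types a b t l : R.

Lemma lerp_gt l a b t : l < a -> l < b -> 0 <= t <= 1 -> l < a + t * (b - a).
Proof.
move=> la lb /andP[t0 t1]; have [ab|ba] := leP a b.
  by rewrite (lt_le_trans la) // lerDl mulr_ge0 // subr_ge0.
rewrite (lt_le_trans lb) // -subr_ge0.
have -> : a + t * (b - a) - b = (1 - t) * (a - b) by ring.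
by rewrite mulr_ge0 // subr_ge0 // ltW.
Qed.

Lemma lerp_ge l a b t : l <= a -> l <= b -> 0 <= t <= 1 -> l <= a + t * (b - a).
Proof.
move=> la lb /andP[t0 t1].
rewrite -subr_ge0 (_ : _ - _ = (1 - t) * (a - l) + t * (b - l)); last by ring.
by rewrite addr_ge0 // mulr_ge0 // subr_ge0.
Qed.

Lemma lerp_lt l a b t : a < l -> b < l -> 0 <= t <= 1 -> a + t * (b - a) < l.
Proof.
move=> al bl t01; rewrite -ltrN2 (_ : - (_ + _) = - a + t * (- b - - a)); last by ring.
by apply: lerp_gt; rewrite ?ltrN2.
Qed.

Lemma lerp_le l a b t : a <= l -> b <= l -> 0 <= t <= 1 -> a + t * (b - a) <= l.
Proof.
move=> al bl t01; rewrite -lerN2 (_ : - (_ + _) = - a + t * (- b - - a)); last by ring.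
by apply: lerp_ge; rewrite ?lerN2.
Qed.

End LerpBounds.

(** * A closed path in the slit plane bounds *)

Section SlitPlane.
Variables (R : realType) (X : topologicalType) (U : set X) (Psi : R * R -> X).
Variables (n : nat) (p : 'I_n -> R * R).
Hypothesis p_inj : forall i j, i != j -> (p i).1 != (p j).1.

Definition punctured : set (R * R) := [set w | forall k, w <> p k].

Hypotheses (Psi_continuous : continuous Psi)
  (PsiU : forall w, punctured w -> U (Psi w)).

(* Every puncture carries a vertical slit going down to infinity. *)
Definition on_slit k (w : R * R) := (w.1 == (p k).1) && (w.2 < (p k).2).

Variables (top eta : R).
Hypotheses (p_top : forall k, (p k).2 < top - 1) (eta_gt0 : 0 < eta)
  (p_eta : forall i j, i != j -> eta < `|(p i).1 - (p j).1|).

Local Notation seg := (segment Psi).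
Local Notation bd := (is_boundary U).

Let O : R * R := (0, top).

(** The sign d = 1 or -1 selects the right or left side of the column of [p k]. The column itself is
    included only below the puncture, so the slit belongs to both half strips. *)
Definition half_strip k (d : R) : set (R * R) :=
  [set w | 0 <= d * (w.1 - (p k).1) <= eta /\ (w.1 = (p k).1 -> w.2 < (p k).2)].

(** The nonnegative function d (w.1 - (p k).1) is affine on a segment; if it vanishes at an inner
    point it vanishes at both ends, and these are then both below the puncture. *)
Lemma half_strip_convex k d : d != 0 -> is_convex (half_strip k d).
Proof.
move=> d0 u v t [/andP[u0 u1] u2] [/andP[v0 v1] v2] t01; split.
  have -> : d * ((lerp u v t).1 - (p k).1) = d * (u.1 - (p k).1) +
      t * (d * (v.1 - (p k).1) - d * (u.1 - (p k).1)) by rewrite /lerp /=; ring.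
  by rewrite lerp_ge ?lerp_le.
move=> e; have [t0|t0] := eqVneq t 0.
  by move: e; rewrite /lerp t0 !mul0r !addr0; exact: u2.
have [t1|t1] := eqVneq t 1.
  move: e; rewrite /lerp t1 !mul1r ![_ + (_ - _)]addrC !subrK; exact: v2.
have /andP[tge tle] := t01.
have tp : 0 < t by rewrite lt0r t0.
have tq : 0 < 1 - t by rewrite subr_gt0 lt_neqAle t1.
have /eqP : (1 - t) * (d * (u.1 - (p k).1)) + t * (d * (v.1 - (p k).1)) = 0.
  transitivity (d * ((lerp u v t).1 - (p k).1)); first by rewrite /lerp /=; ring.
  by rewrite e subrr mulr0.
have A0 := mulr_ge0 (ltW tq) u0; have B0 := mulr_ge0 (ltW tp) v0.
rewrite paddr_eq0 // !mulf_eq0 (gt_eqF tq) (gt_eqF tp) (negbTE d0) /=.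
rewrite !subr_eq0 => /andP[/eqP e1 /eqP e2].
exact: lerp_lt (u2 e1) (v2 e2) t01.
Qed.

Lemma half_strip_punctured k d : `|d| = 1 -> half_strip k d `<=` punctured.
Proof.
move=> d1 w [/andP[w0 w1] w2] j wE; have [jk|jk] := eqVneq j k.
  by move: w2; rewrite wE jk => /(_ erefl); rewrite ltxx.
have := p_eta jk; rewrite -wE ltNge -[`|_|]mul1r -d1 -normrM ger0_norm //.
by rewrite w1.
Qed.

(* Inside a convex piece of the punctured plane that meets the line at height
   [top], a segment may be replaced by a detour through that line and [O]. *)
Lemma detour_boundary (D : set (R * R)) u v a b : is_convex D -> D `<=` punctured ->
  D u -> D v -> D a -> D b -> a.2 = top -> b.2 = top ->
  bd (fun c => seg u v c - (seg u a c + seg a O c - seg v b c - seg b O c)).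
Proof.
move=> Dc DV Du Dv Da Db a2 b2.
have T1 := convex_triangle Psi_continuous PsiU Dc DV Du Dv Db.
have T2 := convex_triangle Psi_continuous PsiU Dc DV Du Da Db.
pose l : set (R * R) := [set w | w.2 = top].
have lc : is_convex l.
  by move=> x y t; rewrite /l /lerp /= => -> -> _; rewrite subrr mulr0 addr0.
have lV : l `<=` punctured.
  move=> w /= w2 k wE; have := p_top k; rewrite -wE w2.
  by rewrite ltNge gerBl ler01.
have T3 := convex_triangle Psi_continuous PsiU lc lV (a2 : l a) (b2 : l b) (erefl : l O).
by apply: eq_boundary (is_boundaryD (is_boundaryB T1 T2) T3) => c; ring.
Qed.

(** The end of the way up from [w] to the line above all punctures. From a point of a slit the
    vertical way would run into the puncture, so it leans to the right by [eta]. *)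
Definition tau (w : R * R) : R * R :=
  (if [exists k, on_slit k w] then w.1 + eta else w.1, top).

(** [m k] counts signed crossings of the slit of [p k]. A point on the slit is counted with the
    right side, in agreement with [tau]. *)
Variables (delta : R -> R * R) (m : 'I_n -> R -> int).
Hypotheses (delta_continuous : continuous delta)
  (delta_punctured : forall t, punctured (delta t))
  (m_off : forall k t0, ~~ on_slit k (delta t0) ->
     \forall t \near t0, m k t = m k t0)
  (m_on : forall k t0, on_slit k (delta t0) ->
     \forall t \near t0, m k t = m k t0 + (if (delta t).1 < (p k).1 then 1 else 0)).

Let qm k : R * R := ((p k).1 - eta, top).
Let qp k : R * R := ((p k).1 + eta, top).
Let base k : R * R := ((p k).1, (p k).2 - 1).

(** A cycle around [p k]: from a point below the puncture up on the left to [O], and back down on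
    the right. *)
Definition loop k : (R -> X) -> int := fun c =>
  seg (base k) (qm k) c + seg (qm k) O c - seg (base k) (qp k) c - seg (qp k) O c.

(** The chain-valued potential: the way from [O] to [delta t] through the line at height [top],
    corrected by one loop for each crossing counted so far. *)
Definition height t : (R -> X) -> int := fun c =>
  - seg (delta t) (tau (delta t)) c - seg (tau (delta t)) O c
  + \sum_k m k t * loop k c.

Let delta_near (t0 e : R) : 0 < e -> exists2 r, 0 < r & forall x, `|x - t0| < r ->
  `|(delta x).1 - (delta t0).1| < e /\ `|(delta x).2 - (delta t0).2| < e.
Proof.
move=> e0.
have c1 : {for t0, continuous (fun t => (delta t).1)}.
  by apply: continuous_comp; [exact: delta_continuous|exact: cvg_fst].
have c2 : {for t0, continuous (fun t => (delta t).2)}.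
  by apply: continuous_comp; [exact: delta_continuous|exact: cvg_snd].
have n1 : \forall x \near t0, `|(delta x).1 - (delta t0).1| < e.
  by move/cvgrPdist_lt: c1 => /(_ e e0); apply: filterS => x; rewrite distrC.
have n2 : \forall x \near t0, `|(delta x).2 - (delta t0).2| < e.
  by move/cvgrPdist_lt: c2 => /(_ e e0); apply: filterS => x; rewrite distrC.
have : \forall x \near t0, `|(delta x).1 - (delta t0).1| < e /\
    `|(delta x).2 - (delta t0).2| < e by exact: (filterI n1 n2).
move=> /nbhs_ballP[r r0 rP].
exists r => // x xt; apply: rP; rewrite /ball /= distrC.
exact: xt.
Qed.

Let between (t0 t r x : R) : `|t - t0| < r -> 0 <= x <= 1 ->
  `|t0 + x * (t - t0) - t0| < r.
Proof.
move=> tr /andP[x0 x1]; rewrite addrAC subrr add0r normrM (le_lt_trans _ tr) //.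
by rewrite ger0_norm // ler_piMl.
Qed.

(** Above a point off the slits there is a convex strip [D], unbounded upwards and free of
    punctures, containing the nearby arc and both ways up. The bound [top - 1] lets [D] meet the
    line at height [top] even when the point lies above that line. *)
Let local_boundary_off t0 : (forall k, ~~ on_slit k (delta t0)) ->
  \forall t \near t0,
    bd (fun c => arc Psi delta t0 t c - (height t c - height t0 c)).
Proof.
move=> off; pose w0 := delta t0.
(* For [e] below all gaps, a puncture whose column meets the strip of half-width [e] is in the
   column of [w0] itself, more than [e] below it. *)
pose gap k := if w0.1 == (p k).1 then w0.2 - (p k).2 else `|w0.1 - (p k).1|.
have [k|e [e0 eP]] := @exists_lower_bound _ _ gap.
  rewrite /gap; case: eqVneq => [e1|ne]; last by rewrite normr_gt0 subr_eq0.
  have := off k; rewrite /on_slit -/w0 e1 eqxx /= -leNgt le_eqVlt subr_gt0.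
  case/predU1P => // e2; case: (@delta_punctured t0 k).
  by rewrite -/w0 [w0]surjective_pairing e1 -e2 -surjective_pairing.
pose D : set (R * R) := [set w | [/\ w0.1 - e < w.1, w.1 < w0.1 + e
  & Num.min (w0.2 - e) (top - 1) < w.2]].
have Dc : is_convex D.
  move=> u v t [u1 u2 u3] [v1 v2 v3] t01.
  by split; [exact: lerp_gt|exact: lerp_lt|exact: lerp_gt].
have near_column (w : R * R) (k : 'I_n) : w0.1 - e < w.1 < w0.1 + e -> w.1 = (p k).1 ->
    (p k).2 < w0.2 - e.
  move=> w1 wk; have := eP k; rewrite /gap; case: eqVneq => [_|_].
    by lra.
  rewrite -wk ltNge => /negP[]; rewrite ltW // ltr_norml; lra.
have DV : D `<=` punctured.
  move=> w [w1 w2 w3] k wE; have w12 : w0.1 - e < w.1 < w0.1 + e by rewrite w1.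
  have h1 := near_column w k w12 (congr1 fst wE); have h2 := p_top k.
  by move: w3; rewrite wE gt_min => /orP[]; lra.
have [r r0 rP] := delta_near t0 e0.
have rD x : `|x - t0| < r -> D (delta x).
  move=> /rP; rewrite !ltr_norml -/w0 => -[/andP[a1 a2] /andP[b1 b2]].
  by split; rewrite ?gt_min; try apply/orP; try left; lra.
have DO x : D x -> D (x.1, top).
  move=> [x1 x2 _]; split=> //=; rewrite gt_min; apply/orP; right.
  by rewrite gtrBl.
have mnear : \forall t \near t0, forall k, m k t = m k t0.
  exact: (@filter_forall _ _ (fun k t => m k t = m k t0) _ _ (fun k => @m_off k t0 (off k))).
near=> t; have mt : forall k, m k t = m k t0 by near: t.
have tr : `|t - t0| < r.
  by rewrite distrC; near: t; apply: nbhsx_ballx.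
have taut x : `|x - t0| < r -> tau (delta x) = ((delta x).1, top).
  move=> /rP; rewrite !ltr_norml -/w0 => -[/andP[a1 a2] /andP[b1 b2]].
  rewrite /tau; case: existsP => // -[k /andP[/eqP e1 e2]].
  have h : w0.1 - e < (delta x).1 < w0.1 + e by apply/andP; split; lra.
  by exfalso; have := near_column (delta x) k h e1; move: e2; lra.
have t0r : `|t0 - t0| < r by rewrite subrr normr0.
have B1 := convex_arc Psi_continuous PsiU delta_continuous delta_punctured Dc DV
  (fun x x01 => rD _ (between tr x01)).
have B2 := detour_boundary Dc DV (rD t0 t0r) (rD t tr) (DO _ (rD t0 t0r))
  (DO _ (rD t tr)) erefl erefl.
apply: eq_boundary (is_boundaryD B1 B2) => c.
rewrite /height (taut t tr) (taut t0 t0r).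
have -> : \sum_k m k t * loop k c = \sum_k m k t0 * loop k c.
  by apply: eq_bigr => k _; rewrite mt.
ring.
Unshelve. all: end_near.
Qed.

(** The nearby arc lies in a convex box around the slit, below the puncture, and may be replaced by
    its chord. On or to the right of the slit, both ways up stay in the right half strip; to the
    left, they differ by one loop, which is the jump in [m_on]. *)
Let local_boundary_on k t0 : on_slit k (delta t0) -> \forall t \near t0,
    bd (fun c => arc Psi delta t0 t c - (height t c - height t0 c)).
Proof.
move=> on; pose w0 := delta t0; have /andP[/eqP w01 w02] := on.
pose D : set (R * R) := [set w | [/\ (p k).1 - eta < w.1, w.1 < (p k).1 + eta
  & w.2 < (p k).2]].
have Dc : is_convex D.
  move=> u v t [u1 u2 u3] [v1 v2 v3] t01.
  by split; [exact: lerp_gt|exact: lerp_lt|exact: lerp_lt].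
have D_other w j : D w -> w.1 = (p j).1 -> j = k.
  move=> [a1 a2 _] wj; apply/eqP/negPn/negP => /p_eta.
  by rewrite -wj ltNge => /negP[]; rewrite ltW // ltr_norml; apply/andP; split; lra.
have DV : D `<=` punctured.
  move=> w Dw j wE; have jk := D_other w j Dw (congr1 fst wE).
  by case: Dw => _ _; rewrite wE jk ltxx.
have e0 : 0 < Num.min eta ((p k).2 - w0.2) by rewrite lt_min eta_gt0 subr_gt0.
have [r r0 rP] := delta_near t0 e0.
have rD x : `|x - t0| < r -> D (delta x).
  move=> /rP; rewrite !lt_min !ltr_norml -/w0 w01.
  move=> [/andP[/andP[a1 a2] _] /andP[_ /andP[b1 b2]]].
  by split; lra.
have mnear : \forall t \near t0, forall j, j != k -> m j t = m j t0.
  have H j : \forall t \near t0, j != k -> m j t = m j t0.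
    have [->|jk] := eqVneq j k; first exact: filterE.
    have : ~~ on_slit j (delta t0) by rewrite /on_slit w01 eq_sym (negbTE (p_inj jk)).
    by move=> /m_off; apply: filterS.
  exact: (@filter_forall _ _ (fun j t => j != k -> m j t = m j t0) _ _ H).
near=> t; have mt : forall j, j != k -> m j t = m j t0 by near: t.
have mk : m k t = m k t0 + (if (delta t).1 < (p k).1 then 1 else 0).
  by near: t; exact: m_on.
have tr : `|t - t0| < r.
  by rewrite distrC; near: t; apply: nbhsx_ballx.
have t0r : `|t0 - t0| < r by rewrite subrr normr0.
have taut x : `|x - t0| < r ->
    tau (delta x) = if (delta x).1 == (p k).1 then qp k else ((delta x).1, top).
  move=> /rD Dx; rewrite /tau; case: existsP => [[j /andP[/eqP ej _]]|nj].
    by have jk := D_other _ j Dx ej; rewrite ej jk eqxx.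
  case: eqP => // e1; case: nj; exists k; rewrite /on_slit e1 eqxx.
  by case: Dx.
have B1 := convex_arc Psi_continuous PsiU delta_continuous delta_punctured Dc DV
  (fun x x01 => rD _ (between tr x01)).
have sumE c : \sum_j m j t * loop j c = \sum_j m j t0 * loop j c +
    (if (delta t).1 < (p k).1 then 1 else 0) * loop k c.
  rewrite (bigD1 k) //= [in RHS](bigD1 k) //= mk.
  rewrite (eq_bigr (fun j => m j t0 * loop j c)) => [|j jk]; last by rewrite mt.
  by ring.
have pc := @half_strip_convex k 1 (oner_neq0 R).
have pV := @half_strip_punctured k 1 (normr1 _).
have m1 : (-1 : R) != 0 by rewrite oppr_eq0 oner_neq0.
have mc := @half_strip_convex k (-1) m1.
have mV := @half_strip_punctured k (-1) (normrN1 _).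
have eta0 := ltW eta_gt0.
have zero_strip d w : w.1 = (p k).1 -> w.2 < (p k).2 -> half_strip k d w.
  by move=> e1 e2; split=> //; rewrite e1 subrr mulr0 lexx.
have Dt := rD t tr; have [d1 d2 d3] := Dt.
have qpS : half_strip k 1 (qp k).
  split=> /=; first by rewrite mul1r addrAC subrr add0r lexx eta0.
  by move=> /eqP; rewrite -subr_eq0 addrAC subrr add0r gt_eqF.
have qmS : half_strip k (-1) (qm k).
  split=> /=; first by rewrite mulN1r opprB subKr lexx eta0.
  by move=> /eqP; rewrite -subr_eq0 addrAC subrr add0r oppr_eq0 gt_eqF.
have b2 : (base k).2 < (p k).2 by rewrite /= gtrBl.
have t0E : tau w0 = qp k by rewrite /w0 taut // w01 eqxx.
(* In the left case the base point of the loop is moved along the slit to [w0]: [T1] and [T2] do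
   this in the left and the right half strip. *)
have [lt|ge] := ltP (delta t).1 (p k).1.
  have wS : half_strip k (-1) (delta t).
    by split=> //; rewrite mulN1r opprB; apply/andP; split; lra.
  have tE : tau (delta t) = ((delta t).1, top) by rewrite taut // lt_eqF.
  have tS : half_strip k (-1) (tau (delta t)).
    rewrite tE; split=> /=; first by case: wS.
    by move=> e1; move: lt; rewrite e1 ltxx.
  have B2 := detour_boundary mc mV (zero_strip _ w0 w01 w02) wS qmS tS erefl erefl.
  have T1 := convex_triangle Psi_continuous PsiU mc mV (zero_strip _ w0 w01 w02)
    (zero_strip _ (base k) erefl b2) qmS.
  have T2 := convex_triangle Psi_continuous PsiU pc pV (zero_strip _ w0 w01 w02)
    (zero_strip _ (base k) erefl b2) qpS.
  apply: eq_boundary (is_boundaryB (is_boundaryD B1 B2) (is_boundaryB T1 T2)) => c.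
  rewrite /height sumE lt /loop -/w0 t0E; ring.
have wS : half_strip k 1 (delta t).
  by split=> //; rewrite mul1r; apply/andP; split; lra.
have tS : half_strip k 1 (tau (delta t)).
  rewrite taut //; case: eqP => // ne; split=> //=.
  by case: wS.
have B2 := detour_boundary pc pV (zero_strip _ w0 w01 w02) wS qpS tS erefl erefl.
apply: eq_boundary (is_boundaryD B1 B2) => c.
rewrite /height sumE ltNge ge /= -/w0 t0E; ring.
Unshelve. all: end_near.
Qed.

Let local_boundary t0 : \forall t \near t0,
    bd (fun c => arc Psi delta t0 t c - (height t c - height t0 c)).
Proof.
have [/existsP[k on]|/existsPn off] := boolP [exists k, on_slit k (delta t0)].
  exact: local_boundary_on on.
exact: local_boundary_off.
Qed.

(** The set of t for which the arc from 0 to t is homologous to the difference of heights is open,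
    and so is its complement, since the local relation can be used in both directions. It is the
    whole line, and at t = 1 the heights cancel. *)
Lemma closed_arc_boundary : delta 1 = delta 0 -> (forall k, m k 1 = m k 0) ->
  bd (arc Psi delta 0 1).
Proof.
move=> d10 m10.
pose A := [set t | bd (fun c => arc Psi delta 0 t c - (height t c - height 0 c))].
have arcs := arc_triangle Psi_continuous PsiU delta_continuous delta_punctured.
have A_near t0 : \forall t \near t0, A t0 <-> A t.
  apply: filterS (local_boundary t0) => t lb; have T := arcs 0 t0 t; split=> At.
    by apply: eq_boundary (is_boundaryB (is_boundaryD At lb) T) => c; ring.
  by apply: eq_boundary (is_boundaryD (is_boundaryB At lb) T) => c; ring.
have A0 : A 0.
  apply: eq_boundary (arc_refl Psi_continuous PsiU delta_punctured 0) => c.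
  by rewrite subrr subr0.
have Ao : open A by rewrite openE => t At; apply: filterS (A_near t) => x [H _]; exact: H.
have Acl : closed A.
  rewrite -[A]setCK; apply: open_closedC; rewrite openE => t At.
  by apply: filterS (A_near t) => x [_ H] /H.
have connR : connected [set: R] by apply/connected_intervalP.
have AT : A = setT.
  apply: connR; first by exists 0.
    by exists A => //; rewrite setTI.
  by exists A => //; rewrite setTI.
have : A 1 by rewrite AT.
apply: eq_boundary => c; rewrite /height d10.
have -> : \sum_k m k 1 * loop k c = \sum_k m k 0 * loop k c.
  by apply: eq_bigr => k _; rewrite m10.
by rewrite subrr subr0.
Qed.

End SlitPlane.

(** * Counting the turns of an angle *)

Section WindingCounter.
Variable R : realType.
Implicit Types (a h : R).

Let tp : R := pi *+ 2.

Let tp_gt0 : 0 < tp. Proof. by rewrite /tp mulrn_wgt0 // pi_gt0. Qed.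

Lemma periodic_int (f : R -> R) (T a : R) (N : int) : periodic f T ->
  f (a + N%:~R * T) = f a.
Proof.
move=> fT; have H (n : nat) b : f (b + n%:R * T) = f b.
  elim: n b => [|n IH] b; first by rewrite mul0r addr0.
  by rewrite -natr1 mulrDl mul1r addrA fT IH.
case: N => n; first exact: H.
by rewrite NegzE mulrNz mulNr -[in LHS](H n.+1) subrK.
Qed.

Definition turns h : int := Num.floor (h / tp).

Lemma turnsP h : 0 <= h - (turns h)%:~R * tp < tp.
Proof.
have /andP[h1 h2] := floor_itv (h / tp); rewrite -/(turns h) in h1 h2.
rewrite subr_ge0 -ler_pdivlMr // h1 /= ltrBlDl.
rewrite ltr_pdivrMr // intrD mulrDl mul1r in h2.
exact: h2.
Qed.

Lemma turns_eq h (N : int) : 0 <= h - N%:~R * tp < tp -> turns h = N.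
Proof.
move=> /andP[h1 h2]; apply/eqP; rewrite /turns floor_eq ler_pdivlMr // -subr_ge0 h1 /=.
by rewrite ltr_pdivrMr // intrD mulrDl mul1r addrC -ltrBlDr.
Qed.

Lemma sin_turns h : sin (h - (turns h)%:~R * tp) = sin h.
Proof. by rewrite -[in RHS](subrK ((turns h)%:~R * tp) h) periodic_int //; exact: sinD2pi. Qed.

Lemma cos_turns h : cos (h - (turns h)%:~R * tp) = cos h.
Proof. by rewrite -[in RHS](subrK ((turns h)%:~R * tp) h) periodic_int //; exact: cosD2pi. Qed.

(** The remainder of [h] modulo a full turn lies in [0, 2 pi); a vanishing sine leaves only 0 and
    pi, and the sign of the cosine excludes pi. *)
Lemma sin0_cos_gt0 h : sin h = 0 -> 0 < cos h -> h = (turns h)%:~R * tp.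
Proof.
rewrite -sin_turns -cos_turns => s0 c0; apply/eqP; rewrite -subr_eq0.
have := turnsP h; move: s0 c0; set r := h - _ => s0 c0 /andP[r0 r1].
apply/negPn/negP => rn0; have rp : 0 < r by rewrite lt0r rn0.
have [rpi|pir] := ltP r pi.
  by have := sin_gt0_pi (x := r); rewrite rp rpi s0 ltxx => /(_ isT).
move: pir; rewrite le_eqVlt => /predU1P[e|pir].
  by move: c0; rewrite -e cospi ltr0N1.
have : 0 < sin (r - pi).
  by apply: sin_gt0_pi; rewrite subr_gt0 pir /= ltrBlDr -mulr2n.
rewrite -[r](subrK pi) sinDpi in s0; move/eqP: s0; rewrite oppr_eq0 => /eqP ->.
by rewrite ltxx.
Qed.

Lemma turns_near_off (h : R -> R) t0 : {for t0, continuous h} ->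
  h t0 != (turns (h t0))%:~R * tp -> \forall t \near t0, turns (h t) = turns (h t0).
Proof.
move=> hc ne; have /andP[r0 r1] := turnsP (h t0).
set N := turns (h t0) in ne r0 r1 *.
have rp : 0 < h t0 - N%:~R * tp by rewrite lt0r r0 subr_eq0 ne.
have e0 : 0 < Num.min (h t0 - N%:~R * tp) (tp - (h t0 - N%:~R * tp)).
  by rewrite lt_min rp subr_gt0.
move/cvgrPdist_lt: hc => /(_ _ e0); apply: filterS => t.
rewrite lt_min !ltr_norml => /andP[/andP[a1 a2] /andP[b1 b2]].
by apply: turns_eq; apply/andP; split; lra.
Qed.

(** At a multiple of 2 pi the floor drops by one on the lower side only. Within distance pi, that
    side is recognised by a negative sine. *)
Lemma turns_near_on (h : R -> R) t0 : {for t0, continuous h} ->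
  h t0 = (turns (h t0))%:~R * tp -> \forall t \near t0,
  turns (h t) = turns (h t0) - (if sin (h t) < 0 then 1 else 0).
Proof.
move=> hc e; set N := turns (h t0) in e *.
have pi0 : 0 < pi :> R := pi_gt0 R.
move/cvgrPdist_lt: hc => /(_ _ pi0); apply: filterS => t.
rewrite distrC ltr_norml => /andP[a1 a2].
have sE : sin (h t) = sin (h t - h t0).
  by rewrite -{1}(subrK (h t0) (h t)) e periodic_int //; exact: sinD2pi.
have tpE : tp = pi + pi by rewrite /tp mulr2n.
have [ge|lt] := leP 0 (h t - h t0).
  have -> : (sin (h t) < 0) = false.
    apply/negbTE; rewrite -leNgt sE; move: ge; rewrite le_eqVlt => /predU1P[<-|gt].
      by rewrite sin0.
    by apply/ltW/sin_gt0_pi; rewrite gt.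
  by rewrite subr0; apply: turns_eq; rewrite -e ge tpE /=; lra.
have -> : (sin (h t) < 0) = true.
  rewrite sE -oppr_gt0 -sinN; apply: sin_gt0_pi; apply/andP; split; lra.
by apply: turns_eq; rewrite intrB mulrBl mul1r -e tpE; apply/andP; split; lra.
Qed.

End WindingCounter.

Lemma angle_lifts_homologous_to_zero (R : realType) (X : topologicalType)
    (U : set X) (Psi : R * R -> X) (n : nat) (p : 'I_n -> R * R)
    (delta : R -> R * R) (rho theta : 'I_n -> R -> R) :
  (forall i j, i != j -> (p i).1 != (p j).1) -> continuous Psi ->
  (forall w, (forall k, w <> p k) -> U (Psi w)) -> continuous delta ->
  (forall k, continuous (theta k)) -> (forall k t, 0 < rho k t) ->
  (forall k t, (delta t).1 = (p k).1 + rho k t * cos (theta k t) /\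
               (delta t).2 = (p k).2 + rho k t * sin (theta k t)) ->
  delta 1 = delta 0 -> (forall k, theta k 1 = theta k 0) ->
  homologous_to_zero U (Psi \o delta).
Proof.
move=> p_inj Psi_c PsiU dc tc rho0 polar d10 t10.
have [M [_ MP]] := exists_upper_bound (fun k => (p k).2).
have [[i j]|eta [eta0 etaP]] := @exists_lower_bound R ('I_n * 'I_n)%type
    (fun ij => if ij.1 == ij.2 then 1 else `|(p ij.1).1 - (p ij.2).1|).
  by case: eqVneq => //= ij; rewrite normr_gt0 subr_eq0; exact: p_inj.
have top k : (p k).2 < (M + 1) - 1 by rewrite addrK.
have sep i j : i != j -> eta < `|(p i).1 - (p j).1|.
  by move=> ij; have := etaP (i, j); rewrite /= (negbTE ij).
have dp t : punctured p (delta t).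
  move=> k dk; have [e1 e2] := polar k t.
  have := cos2Dsin2 (theta k t); move: e1 e2; rewrite dk.
  move=> /eqP; rewrite -subr_eq0 opprD addrA subrr add0r oppr_eq0 mulf_eq0.
  rewrite gt_eqF //= => /eqP ->; move=> /eqP.
  rewrite -subr_eq0 opprD addrA subrr add0r oppr_eq0 mulf_eq0 gt_eqF //= => /eqP ->.
  by rewrite expr0n addr0 => /eqP; rewrite eq_sym oner_eq0.
(* The slit is the direction -pi / 2, so after this shift it corresponds to the multiples of 2 pi,
   and sin h = cos theta is negative exactly to the left of the puncture. The sign in [m] turns the
   drop of the floor there into the jump +1. *)
pose h k t := theta k t + pi / 2.
pose m k t : int := - turns (h k t).
have hc k : continuous (h k) by move=> t; apply: cvgD; [exact: tc|exact: cvg_cst].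
have sinh k t : sin (h k t) = cos (theta k t) by rewrite sinDpihalf.
have cosh k t : cos (h k t) = - sin (theta k t) by rewrite cosDpihalf.
have slitP k t : on_slit p k (delta t) <-> h k t = (turns (h k t))%:~R * (pi *+ 2).
  have [e1 e2] := polar k t; rewrite /on_slit e1 e2; split.
    rewrite -subr_eq0 addrAC subrr add0r mulf_eq0 gt_eqF //= gtrDl pmulr_rlt0 //.
    by move=> /andP[/eqP c0 s0]; apply: sin0_cos_gt0; rewrite ?sinh ?cosh // oppr_gt0.
  move=> e; have := cos_turns (h k t); have := sin_turns (h k t).
  rewrite -e subrr sin0 cos0 sinh cosh => <- /eqP; rewrite eq_sym eqr_oppLR => /eqP ->.
  by rewrite mulr0 addr0 eqxx /= mulrN1 gtrBl.
have off k t0 : ~~ on_slit p k (delta t0) -> \forall t \near t0, m k t = m k t0.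
  move=> /negP ns; have := @turns_near_off _ (h k) t0 (hc k t0).
  move=> H; have : h k t0 != (turns (h k t0))%:~R * (pi *+ 2).
    by apply/eqP => /slitP.
  by move=> /H; apply: filterS => t; rewrite /m => ->.
have on k t0 : on_slit p k (delta t0) -> \forall t \near t0,
    m k t = m k t0 + (if (delta t).1 < (p k).1 then 1 else 0).
  move=> /slitP /(@turns_near_on _ (h k) t0 (hc k t0)); apply: filterS => t.
  rewrite /m => ->; rewrite opprB addrC; congr (_ + _).
  by rewrite (polar k t).1 gtrDl pmulr_rlt0 // sinh.
have := closed_arc_boundary p_inj Psi_c PsiU top eta0 sep dc dp off on d10.
case=> [k|a [b [s [sU sE]]]]; first by rewrite /m /h t10.
exists a, b, s; split=> // c; rewrite sE /arc /path_chain; congr (scoef _ c).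
by apply/funext => x /=; rewrite subr0 mulr1 add0r.
Qed.

(** * Moments of rational functions *)

Section RationalSeries.
Variable R : realType.

(** [A] is the denominator with its coefficients reversed in degree N. Then mu(A X^l) is the
    coefficient of index N + l of the numerator, which vanishes because N is at least the size of
    [p]. *)
Lemma rational_series_annihilator (mu : {poly C R} -> C R) :
  (forall c A B, mu (c *: A + B) = c * mu A + mu B) ->
  rational_series (fun i => mu 'X^i) ->
  exists A : {poly C R}, A != 0 /\ forall B, mu (A * B) = 0.
Proof.
move=> mu_lin [p [q [q0 pq]]].
have mu0 : mu 0 = 0.
  have := mu_lin 1 0 0; rewrite scaler0 addr0 mul1r => /eqP.
  by rewrite -subr_eq subrr eq_sym => /eqP.
have muZ c A : mu (c *: A) = c * mu A by rewrite -[_ *: _]addr0 mu_lin mu0 addr0.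
have muD A B : mu (A + B) = mu A + mu B by rewrite -[A]scale1r mu_lin mul1r scale1r.
have mu_sum n (F : nat -> {poly C R}) : mu (\sum_(i < n) F i) = \sum_(i < n) mu (F i).
  elim: n => [|n IH]; first by rewrite !big_ord0.
  by rewrite !big_ord_recr /= muD IH.
pose N := maxn (size p) (size q).
have qN j : (N <= j)%N -> q`_j = 0.
  by move=> Nj; rewrite nth_default // (leq_trans (leq_maxr _ _) Nj).
pose A := \sum_(i < N) q`_i *: 'X^(N - i).
exists A; split.
  apply: contraNneq q0 => A0; apply/eqP/polyP => j; rewrite coef0.
  have [Nj|jN] := leqP N j; first exact: qN.
  have := congr1 (fun B : {poly C R} => B`_(N - j)) A0; rewrite coef0 coef_sum.
  rewrite (bigD1 (Ordinal jN)) //= coefZ coefXn eqxx mulr1 big1 ?addr0 // => i ij.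
  rewrite coefZ coefXn; case: eqP; rewrite ?mulr0 // => e; case/negP: ij.
  apply/eqP/val_inj => /=; have iN := ltn_ord i.
  by rewrite -(subKn (ltnW iN)) -e subKn // ltnW.
move=> B; rewrite -[B]coefK poly_def mulr_sumr.
rewrite (mu_sum _ (fun l => A * (B`_l *: 'X^l))) big1 // => l _.
rewrite -scalerAr muZ mulr_suml (mu_sum _ (fun i => q`_i *: 'X^(N - i) * 'X^l)).
suff : \sum_(i < N) mu (q`_i *: 'X^(N - i) * 'X^l) = p`_(N + l).
  have sp : (size p <= N + l)%N by exact: leq_trans (leq_maxl _ _) (leq_addr _ _).
  by move=> ->; rewrite (nth_default 0 sp) mulr0.
rewrite -pq (@big_ord_widen _ _ _ N (N + l).+1
  (fun i => mu (q`_i *: 'X^(N - i) * 'X^l))) ?leqW ?leq_addr //.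
rewrite big_mkcond /=; apply: eq_bigr => i _; case: ltnP => [iN|/qN ->].
  by rewrite -scalerAl muZ -exprD addnBAC // ltnW.
by rewrite mul0r.
Qed.

Lemma deriv_eq0_const (k : numClosedFieldType) (p : {poly k}) :
  p^`() = 0 -> (size p <= 1)%N.
Proof.
move=> p0; apply/leq_sizeP => -[//|j] _.
have := congr1 (fun q : {poly k} => q`_j) p0; rewrite coef_deriv coef0 => /eqP.
by rewrite mulrn_eq0 /= => /eqP.
Qed.

(** From n' d = n d' and coprimality, d divides d', which has smaller degree; so d' = 0 and then n'
    = 0. *)
Lemma coprime_wronskian0 (k : numClosedFieldType) (n d : {poly k}) :
  coprimep n d -> d != 0 -> n^`() * d - n * d^`() = 0 ->
  (size n <= 1)%N /\ (size d <= 1)%N.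
Proof.
move=> nd d0 /eqP; rewrite subr_eq0 => /eqP e.
have dd : d %| d^`().
  have dn : coprimep d n by rewrite coprimep_sym.
  by rewrite -(Gauss_dvdpr _ dn) -e dvdp_mull.
have d'0 : d^`() = 0.
  apply/eqP/negPn/negP => d'0; have := dvdp_leq d'0 dd.
  by rewrite leqNgt (lt_size_deriv d0).
have /eqP := e; rewrite d'0 mulr0 mulf_eq0 (negbTE d0) orbF => /eqP n'0.
by split; exact: deriv_eq0_const.
Qed.

Lemma fraction_eq0 (k : closedFieldType) (L : fieldType)
    (tof : {rmorphism {poly k} -> L}) (a b : {poly k}) :
  injective tof -> b != 0 -> tof a / tof b = 0 -> a = 0.
Proof.
move=> tof_inj b0 /eqP; rewrite mulf_eq0 invr_eq0 -!(rmorph0 tof) !(inj_eq tof_inj).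
by rewrite (negbTE b0) orbF => /eqP.
Qed.

Lemma rderiv_neq0 (f : ratfun R) : nonconstant f -> rderiv f != 0.
Proof.
move=> fc; apply/eqP => f0; have d0 := rden_neq0 f.
have d20 : rden f ^+ 2 != 0 by rewrite expf_neq0.
have w0 := fraction_eq0 (@tofr_inj R) d20 f0.
have [/size1_polyC n1 /size1_polyC d1] := coprime_wronskian0 (coprime_rnum_rden f) d0 w0.
apply: fc; exists ((rnum f)`_0 / (rden f)`_0).
have d00 : (rden f)`_0 != 0 by apply: contraNneq d0 => d00; rewrite d1 d00 polyC0.
have td0 : tofr (rden f) != 0 by rewrite (tof_eq0 (@tofr_inj R)).
apply: (mulIf td0); rewrite {1}[f]tofr_rnum_rden mulfVK //.
rewrite -[ratpoly _]/(tofr _) -rmorphM; congr (tofr _).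
by rewrite [LHS]n1 [X in _ * X]d1 -polyCM mulfVK.
Qed.

End RationalSeries.

Section Decomposition.
Variable R : realType.
Implicit Types (P Q W f : ratfun R).

Lemma rmap_moebius_infty (c : C R) :
  rmap (tofr c%:P + (tofr 'X)^-1) None = Some c.
Proof.
set M := _ + _; rewrite rmapE.
have X0 : ('X : {poly C R}) != 0 by rewrite polyX_eq0.
have ME : M = tofr (c *: 'X + 1) / tofr 'X.
  have tX0 : tofr ('X : {poly C R}) != 0 by rewrite (tof_eq0 (@tofr_inj R)).
  by rewrite rmorphD -mul_polyC rmorphM rmorph1 mulrDl mulfK // mul1r.
have [h [uE vE]] : exists h, (c *: 'X + 1) = h * rnum M /\ 'X = h * rden M.
  apply: (coprime_fraction (@tofr_inj R)) => //.
  - exact: coprime_rnum_rden.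
  - exact: rden_neq0.
  - by rewrite -tofr_rnum_rden.
have E : (c *: 'X + 1) * rden M = rnum M * 'X by rewrite uE [in RHS]vE; ring.
have s1 : (size (c *: 'X + 1 : {poly C R})%R <= 2)%N.
  rewrite (leq_trans (size_polyD _ _)) // geq_max size_poly1 andbT.
  by rewrite (leq_trans (size_scale_leq _ _)) // size_polyX.
have s2 : (size ('X : {poly C R})%R <= 2)%N by rewrite size_polyX.
have c1 : (c *: 'X + 1 : {poly C R})`_1 = c by rewrite coefD coefZ coefX coef1 mulr1 addr0.
have c2 : ('X : {poly C R})`_1 = 1 by rewrite coefX.
rewrite (proj_map_fraction_infty (coprime_rnum_rden M) (rden_neq0 M) E s1 s2) c1 c2.
  by rewrite /proj_point oner_eq0 divr1.
by apply/eqP => -[_ /eqP]; rewrite oner_eq0.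
Qed.

Lemma ratfun_decomposition P Q j0 : nonconstant P -> nonconstant Q ->
  exists W (i : {rmorphism ratfun R -> ratfun R}) Pt Qt,
  [/\ nonconstant W, is_subst tofr W i, P = i Pt /\ Q = i Qt, rmap Pt None = None
    & forall f, exists (c : {poly C R}) (H : {poly {poly C R}}),
      [/\ c != 0, (size H <= rdeg P)%N & eval_at tofr P c * i f
        = (map_poly (eval_at tofr P) H).[Q] * Q ^+ j0]].
Proof.
move=> Pc Qc.
have [W [i [P0 [Q0 [Wc iE PE QE dec]]]]] :=
  rational_decomposition (@tofr_inj R) (@tofr_surj R) j0 Pc (deg_le_rdeg P) Qc.
have P0c : nonconstant P0.
  by apply: (nonconstant_subst iE); rewrite -PE.
(* A finite pole c of the outer function is moved to infinity by replacing W with 1 / (W - c). *)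
have [[c|] P0x] := nonconstant_pole P0c; last by exists W, i, P0, Q0.
have [W' [i' [j [W'c i'E jE ij i'i]]]] :=
  moebius_subst (@tofr_inj R) (@tofr_surj R) c Wc iE.
exists W', i', (j P0), (j Q0); split=> //.
- by rewrite -!ij.
- by rewrite (rmap_subst P0 None jE) rmap_moebius_infty.
- by move=> f; have [f' ->] := i'i f.
Qed.

(** By the chain rule Q' = Qt'(W) W', so W^j W' is Q' times the element W^j / Qt'(W) of C(W), to
    which the expansion in powers of Q applies. *)
Lemma rderiv_decomposition P Q W (i : {rmorphism ratfun R -> ratfun R}) Qt j0 n :
  is_subst tofr W i -> Q = i Qt -> nonconstant Q ->
  (forall f, exists (c : {poly C R}) (H : {poly {poly C R}}),
     [/\ c != 0, (size H <= n)%N & eval_at tofr P c * i f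
        = (map_poly (eval_at tofr P) H).[Q] * Q ^+ j0]) ->
  forall j, exists (c : {poly C R}) (H : {poly {poly C R}}),
     [/\ c != 0, (size H <= n)%N & eval_at tofr P c * W ^+ j * rderiv W
        = (map_poly (eval_at tofr P) H).[Q] * Q ^+ j0 * rderiv Q].
Proof.
move=> iE QE Qc dec j; have [c [H [c0 Hn E]]] := dec (tofr 'X ^+ j / rderiv Qt).
exists c, H; split=> //; rewrite -E.
have Qt0 : rderiv Qt != 0.
  by apply/rderiv_neq0/(nonconstant_subst iE); rewrite -QE.
have dQ : rderiv Q = i (rderiv Qt) * rderiv W.
  by rewrite QE (delta_subst (@tofr_inj R) (@tofr_surj R) (@rderiv_fraction R) _ iE).
have iQt0 : i (rderiv Qt) != 0 by rewrite fmorph_eq0.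
rewrite dQ fmorph_div rmorphXn (substX iE).
have D (K : fieldType) (a w q d : K) : q != 0 -> a * w * d = a * (w / q) * (q * d).
  by move=> q0; field.
exact: D.
Qed.

End Decomposition.

Lemma clamp_within_continuous (R : realType) (a b : R) (f : R -> R) : a <= b ->
  {within `[a, b], continuous f} -> continuous (f \o clamp a b).
Proof.
move=> ab /subspace_continuousP fc t.
have ct : `[a, b]%classic (clamp a b t) by rewrite /= in_itv /=; exact: clampP.
have clt : clamp a b @ t --> within `[a, b] (nbhs (clamp a b t)).
  move=> A nA; have H : nbhs t (fun x => `[a, b]%classic (clamp a b x) -> A (clamp a b x)).
    exact: (@clamp_continuous R a b t _ nA).
  apply: filterS H => x; apply.
  by rewrite /= in_itv /=; exact: clampP.
exact: (cvg_comp _ _ clt (fc _ ct)).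
Qed.

(** A positive [s] smaller than every ratio |x| / |y| of nonzero entries can satisfy none of the
    equations x = s y. *)
Lemma generic_direction (R : realType) (I : finType) (x y : I -> R) :
  (forall i, (x i != 0) || (y i != 0)) ->
  exists s : R, forall i, x i - s * y i != 0.
Proof.
move=> xy; pose F i := if (x i != 0) && (y i != 0) then `|x i| / `|y i| else 1.
have [i|s [s0 sF]] := @exists_lower_bound R I F.
  by rewrite /F; case: ifP => // /andP[x0 y0]; rewrite divr_gt0 // normr_gt0.
exists s => i; have := sF i; have := xy i; rewrite /F subr_eq0.
have [-> /= y0 _|x0] := eqVneq (x i) 0.
  by rewrite eq_sym mulf_neq0 // gt_eqF.
have [->|y0] := eqVneq (y i) 0; first by rewrite mulr0.
move=> _; rewrite /= ltr_pdivlMr ?normr_gt0 // => lt.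
by apply: contraTneq lt => ->; rewrite normrM gtr0_norm // ltxx.
Qed.

Section Rotation.
Variable R : realType.
Local Notation cRe := (@complex.Re R).
Local Notation cIm := (@complex.Im R).

Lemma Complex_continuous : continuous (fun w : R * R => Complex w.1 w.2 : C R).
Proof.
move=> w; apply/cvgrPdist_lt => e e0.
(* The norm of [C R] is itself complex-valued; a positive bound has zero imaginary part, so the
   estimate is made on its real part. *)
have eE : e = Complex (cRe e) 0.
  by move: e0; case: (e) => a b; rewrite ltcE /= => /andP[/eqP -> _].
have re0 : 0 < cRe e by move: e0; rewrite {1}eE ltcE /= => /andP[_].
have e2 : 0 < cRe e / 2 by rewrite divr_gt0.
have c1 : {for w, continuous (fun x : R * R => x.1)} by exact: cvg_fst.
have c2 : {for w, continuous (fun x : R * R => x.2)} by exact: cvg_snd.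
have n1 : \forall x \near w, `|w.1 - x.1| < cRe e / 2.
  by move/cvgrPdist_lt: c1 => /(_ _ e2).
have n2 : \forall x \near w, `|w.2 - x.2| < cRe e / 2.
  by move/cvgrPdist_lt: c2 => /(_ _ e2).
near=> x; have h1 : `|w.1 - x.1| < cRe e / 2 by near: x.
have h2 : `|w.2 - x.2| < cRe e / 2 by near: x.
rewrite eE.
have -> : (Complex w.1 w.2 : C R) - Complex x.1 x.2 = Complex (w.1 - x.1) (w.2 - x.2).
  by [].
rewrite normc_def ltcE /= eqxx /=.
have -> : cRe e = Num.sqrt (cRe e ^+ 2) by rewrite sqrtr_sqr gtr0_norm.
rewrite ltr_sqrt ?exprn_gt0 //.
have sq (y : R) : `|y| < cRe e / 2 -> y ^+ 2 < (cRe e / 2) ^+ 2.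
  move=> ye; rewrite -[y ^+ 2]real_normK ?num_real //.
  by rewrite ltr_pXn2r // ?nnegrE ?normr_ge0 ?(ltW e2).
have q : (cRe e / 2) ^+ 2 + (cRe e / 2) ^+ 2 < cRe e ^+ 2.
  have -> : cRe e ^+ 2 = (cRe e / 2) ^+ 2 + (cRe e / 2) ^+ 2 + cRe e ^+ 2 / 2 by field.
  by rewrite ltrDl divr_gt0 // exprn_gt0.
by apply: lt_trans q; apply: ltrD; exact: sq.
Unshelve. all: end_near.
Qed.

Lemma finite_point_continuous (c : C R) :
  continuous (fun w : R * R => Some (c * Complex w.1 w.2) : CP1 R).
Proof.
move=> w A nA; have cc : continuous (fun w : R * R => c * (Complex w.1 w.2 : C R)).
  by move=> x; apply: cvgM; [exact: cvg_cst|exact: Complex_continuous].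
exact: (cc w _ nA).
Qed.

End Rotation.

Section OneSide.
Variables (R : realType) (g : R -> C R) (m : nat) (s : nat -> R) (q : nat -> R -> C R).
Local Notation cRe := (@complex.Re R).
Local Notation cIm := (@complex.Im R).
Hypotheses (s_0 : s 0%N = 0) (s_m : s m = 1)
  (s_incr : forall k, (k < m)%N -> s k < s k.+1)
  (gq : forall k, (k < m)%N -> C1 (q k) /\
     forall t, s k <= t <= s k.+1 -> g t = q k t).
Variables (W Pt : ratfun R).
Hypotheses (W_nonconst : nonconstant W) (W_reg : regular_along g W)
  (W_closed : rval W (g 1) = rval W (g 0))
  (W_log : forall p, root (rden Pt) p -> regular_along g (W - tofr p%:P)^-1 /\
     curve_integral g (rval ((W - tofr p%:P)^-1 * rderiv W)) = 0).

Let shift_neq0 (p : C R) : W - tofr p%:P != 0.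
Proof. by apply/negP; rewrite subr_eq0 => /eqP WE; apply: W_nonconst; exists p. Qed.

(** The punctures are the distinct roots of the denominator of [Pt], and the angles around them come
    from [log_lift]. The bounding chain stays in the finite plane, hence it avoids a pole at
    infinity as well. *)
Lemma poles_on_one_side :
  homologous_to_zero (~` poles Pt) (fun t => rmap W (Some (g t))).
Proof.
have [r rE] := closed_field_poly_normal (rden Pt).
pose z (i : 'I_(size (undup r))) : C R := nth 0 (undup r) i.
have z_root i : root (rden Pt) (z i).
  rewrite rE rootZ ?lead_coef_eq0 ?rden_neq0 // root_prod_XsubC -mem_undup.
  exact: mem_nth.
have rootz x : root (rden Pt) x -> exists i, x = z i.
  rewrite rE rootZ ?lead_coef_eq0 ?rden_neq0 // root_prod_XsubC -mem_undup => xr.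
  have ir : (index x (undup r) < size (undup r))%N by rewrite index_mem.
  by exists (Ordinal ir); rewrite /z nth_index.
have z_inj i j : z i = z j -> i = j.
  by move/eqP; rewrite nth_uniq ?undup_uniq // => /eqP; exact: val_inj.
(* Multiplication by [c] makes the real parts of the poles distinct. *)
have [sl slP] : exists sl : R, forall ij : 'I_(size (undup r)) * 'I_(size (undup r)),
    ij.1 != ij.2 -> cRe (z ij.1 - z ij.2) - sl * cIm (z ij.1 - z ij.2) != 0.
  pose x (ij : 'I_(size (undup r)) * 'I_(size (undup r))) :=
    if ij.1 == ij.2 then 1 else cRe (z ij.1 - z ij.2).
  pose y (ij : 'I_(size (undup r)) * 'I_(size (undup r))) :=
    if ij.1 == ij.2 then 0 else cIm (z ij.1 - z ij.2).
  have [ij|sl slP] := @generic_direction R _ x y.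
    rewrite /x /y; case: (eqVneq ij.1 ij.2) => [_|ne]; first by rewrite oner_eq0.
    rewrite -negb_and; apply: contra_neqN ne => /andP[/eqP e1 /eqP e2].
    by apply: z_inj; apply/eqP; rewrite -subr_eq0; apply/eqP; exact: C_ext.
  by exists sl => ij ne; have := slP ij; rewrite /x /y (negbTE ne).
pose c : C R := Complex 1 sl.
have c0 : c != 0 by apply/eqP => /(congr1 cRe) /= /eqP; rewrite oner_eq0.
pose p i : R * R := (cRe (c * z i), cIm (c * z i)).
have p_inj i j : i != j -> (p i).1 != (p j).1.
  move=> ij; rewrite -subr_eq0 /p /= !cReM /=; have := slP (i, j) ij.
  rewrite /= cReD cImD cReN cImN.
  have -> : 1 * cRe (z i) - sl * cIm (z i) - (1 * cRe (z j) - sl * cIm (z j)) =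
    cRe (z i) - cRe (z j) - sl * (cIm (z i) - cIm (z j)) by ring.
  by [].
have l01 : (0 : R) <= 1 := ler01.
have /choice[rt rtP] : forall i, exists rt : (R -> R) * (R -> R),
    [/\ forall t, 0 < rt.1 t, {within `[0, 1], continuous rt.2}, rt.2 1 = rt.2 0 &
    forall t, 0 <= t <= 1 -> c * (rval W (g t) - z i) =
      Complex (rt.1 t * cos (rt.2 t)) (rt.1 t * sin (rt.2 t))].
  move=> i; have [rz iz] := W_log (z_root i).
  have [rho [theta H]] := log_lift s_0 s_m s_incr gq c0 (shift_neq0 _) W_reg rz iz.
  by exists (rho, theta).
(* The connectedness argument runs over the whole real line while the curve lives on [0, 1];
   clamping extends the path and its angles continuously. *)
pose cl := clamp 0 1 : R -> R.
have clP t : 0 <= cl t <= 1 by exact: clampP.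
have cl0 : cl 0 = 0 by rewrite /cl clamp_id // lexx l01.
have cl1 : cl 1 = 1 by rewrite /cl clamp_id // lexx l01.
pose w t : C R := c * rval W (g t).
pose delta (t : R) : R * R := (cRe (w (cl t)), cIm (w (cl t))).
have wG k : (k < m)%N -> exists G : R -> C R, forall t, s k <= t <= s k.+1 ->
    cderivable G t (0 * rval W (q k t) + c * piece_integrand q (rderiv W) k t) /\
    w t = G t.
  move=> km; exists (fun t => c * rval W (q k t)) => t tk.
  split; last by rewrite /w ((gq km).2 t tk).
  apply: cderivableM; first exact: cderivable_cst.
  apply: cderivable_rval; first exact: (regular_piece s_0 s_m s_incr gq W_reg km tk).
  exact: (cderivable_piece gq t km).
have [w1 w2] := cderivable_within_continuous s_0 s_m s_incr wG.
have dc : continuous delta.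
  have c1 := clamp_within_continuous l01 w1.
  have c2 := clamp_within_continuous l01 w2.
  by move=> t; exact: (pair_continuous (c1 t) (c2 t)).
pose Psi (u : R * R) : CP1 R := Some (c^-1 * Complex u.1 u.2).
have PsiU u : (forall i, u <> p i) -> (~` poles Pt) (Psi u).
  move=> up; rewrite /poles /= /Psi; case: eqP => // d0 _.
  have [i iE] := rootz _ (introT eqP d0).
  apply: (up i); rewrite /p -iE mulrA mulfV // mul1r.
  by case: (u).
have := @angle_lifts_homologous_to_zero R (CP1 R) (~` poles Pt) Psi _ p delta
  (fun i t => (rt i).1 (cl t)) (fun i t => (rt i).2 (cl t)) p_inj
  (@finite_point_continuous R c^-1) PsiU dc.
case.
- move=> i; have [_ cth _ _] := rtP i.
  have H := clamp_within_continuous l01 cth; exact: H.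
- by move=> i t; have [] := rtP i.
- move=> i t; have [_ _ _ /(_ _ (clP t)) E] := rtP i.
  have E1 := congr1 cRe E; have E2 := congr1 cIm E.
  move: E1 E2; rewrite mulrBr cReD cImD cReN cImN /= => E1 E2.
  by rewrite /p /delta /w -E1 -E2 /=; split; rewrite addrC subrK.
- by rewrite /delta cl0 cl1 /w W_closed.
- by move=> i; have [_ _ e _] := rtP i; rewrite cl0 cl1.
move=> a [b [sg [sgU sgE]]]; exists a, b, sg; split=> // e; rewrite sgE.
(* Coefficients of 1-simplices depend only on values over [0, 1], where the clamped path is the
   image curve. *)
congr (Posz (nat_of_bool _)).
have PE t : 0 <= t <= 1 -> (Psi \o delta) t = rmap W (Some (g t)).
  move=> t01; rewrite /= /Psi /delta /cl clamp_id //.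
  have -> : Complex (cRe (w t)) (cIm (w t)) = w t by exact: C_ext.
  rewrite /w mulKf //; have := W_reg t01; rewrite /regular => /negbTE ->.
  by [].
apply: asbool_equiv_eq; split=> H t t01.
  by rewrite -H // PE //; move: t01; rewrite in_itv.
by rewrite -H // PE //; move: t01; rewrite in_itv.
Qed.

End OneSide.

Lemma eq_curve_integral (R : realType) (g : R -> C R) (h h' : C R -> C R) :
  (forall t, 0 <= t <= 1 -> h (g t) = h' (g t)) ->
  curve_integral g h = curve_integral g h'.
Proof.
move=> hh'; rewrite /curve_integral; congr Complex;
  by apply: eq_Rintegral => t; rewrite inE /= in_itv /= => t01; rewrite hh'.
Qed.

Theorem theorem5p1 (R : realType) (P Q : ratfun R) (g : R -> C R) (j0 : nat)
    (P_nonconstant : nonconstant P) (Q_nonconstant : nonconstant Q)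
    (g_curve : is_curve g)
    (g_no_pole : forall t : R, 0 <= t <= 1 ->
      ~ poles P (Some (g t)) /\ ~ poles Q (Some (g t)))
    (I_rational : forall j : nat, (j0 <= j <= j0 + rdeg P - 1)%N ->
      rational_series (fun i : nat =>
        curve_integral g (fun z =>
          rval P z ^+ i * rval Q z ^+ j * rval (rderiv Q) z))) :
  exists Pt Qt W : ratfun R,
    (forall z : CP1 R, rmap P z = rmap Pt (rmap W z)) /\
    (forall z : CP1 R, rmap Q z = rmap Qt (rmap W z)) /\
    closed_curve (fun t : R => rmap W (Some (g t))) /\
    on_one_side (poles Pt) (fun t : R => rmap W (Some (g t))).
Proof.
have [m [s [q [[s0 sm] s_incr pieces _]]]] := g_curve.
have gq k : (k < m)%N -> C1 (q k) /\ forall t, s k <= t <= s k.+1 -> g t = q k t.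
  by move=> /pieces[qC1 gE]; split=> // t /gE[].
have P_reg : regular_along g P by move=> t /g_no_pole[Pp _]; apply/regularE.
have Q_reg : regular_along g Q by move=> t /g_no_pole[_ Qp]; apply/regularE.
have [W [i [Pt [Qt [W_nonconst iE [PE QE] Pt_infty dec]]]]] :=
  ratfun_decomposition j0 P_nonconstant Q_nonconstant.
have PW z : rmap P z = rmap Pt (rmap W z) by rewrite PE (rmap_subst Pt z iE).
have QW z : rmap Q z = rmap Qt (rmap W z) by rewrite QE (rmap_subst Qt z iE).
(* Infinity is a pole of [Pt], so a pole of [W] on the curve would be a pole of [P]. *)
have W_reg : regular_along g W.
  move=> t t01; apply/regularE => Wp; have [Pp _] := g_no_pole t t01.
  by apply: Pp; apply: etrans (PW _) _; rewrite Wp.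
have W_rmap t : 0 <= t <= 1 -> rmap W (Some (g t)) = Some (rval W (g t)).
  by move=> t01; have := W_reg t t01; rewrite /regular /= => /negbTE ->.
pose lam f := curve_integral g (rval f).
have reg_tof c : regular_along g (tofr c%:P).
  by move=> t _; exact: (rval_poly c%:P (g t)).1.
have regD f1 f2 : regular_along g f1 -> regular_along g f2 -> regular_along g (f1 + f2).
  by move=> r1 r2 t t01; exact: (rvalD (r1 t t01) (r2 t t01)).1.
have regM f1 f2 : regular_along g f1 -> regular_along g f2 -> regular_along g (f1 * f2).
  by move=> r1 r2 t t01; exact: (rvalM (r1 t t01) (r2 t t01)).1.
have lam_linear c f1 f2 : regular_along g f1 -> regular_along g f2 ->
    lam (tofr c%:P * f1 + f2) = c * lam f1 + lam f2.
  exact: (curve_integral_linear s0 sm s_incr gq).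
have dW_reg := regular_along_rderiv W_reg.
have dQ_reg := regular_along_rderiv Q_reg.
have EN : (size (rden Pt) < size (rnum Pt))%N.
  by move: Pt_infty; rewrite /rmap; case: ifP.
have P_E : P = eval_at tofr W (rnum Pt) / eval_at tofr W (rden Pt).
  by rewrite -!iE -fmorph_div -tofr_rnum_rden.
have dec' := rderiv_decomposition iE QE Q_nonconstant dec.
have reg_eval f p : regular_along g f -> regular_along g (eval_at tofr f p).
  by move=> fr t t01; exact: (regular_eval_at p (fr t t01)).1.
have regXn f k : regular_along g f -> regular_along g (f ^+ k).
  by move=> fr t t01; exact: (rvalX k (fr t t01)).1.
have lam_deriv (F : {poly C R}) : lam (eval_at tofr W F^`() * rderiv W)
    = F.[rval W (g 1)] - F.[rval W (g 0)].
  rewrite -(delta_eval_at (@tofr_inj R) (@tofr_surj R) (@rderiv_fraction R)).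
  rewrite /lam (curve_integral_rderiv s0 sm s_incr gq); last exact: reg_eval.
  by rewrite !(regular_eval_at F (W_reg _ _)).2 // ?lexx ?ler01.
have moments l : (l < rdeg P)%N -> exists A : {poly C R}, A != 0 /\ forall B,
    lam (eval_at tofr P (A * B) * Q ^+ (j0 + l) * rderiv Q) = 0.
  (* For j = j0 + l the functional integrating B(P) Q^j Q' sends X^i to the i-th moment of I_j. *)
  move=> ln; apply: (rational_series_annihilator
    (mu := fun B => lam (eval_at tofr P B * Q ^+ (j0 + l) * rderiv Q))).
    move=> c A B; rewrite -lam_linear; last 2 first.
    - by do 2 ?apply: (regM) => //; [exact: reg_eval|exact: regXn].
    - by do 2 ?apply: (regM) => //; [exact: reg_eval|exact: regXn].
    congr lam; rewrite -mul_polyC rmorphD rmorphM eval_atC.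
    have D (K : comPzRingType) (c0 a b y x : K) :
      (c0 * a + b) * y * x = c0 * (a * y * x) + b * y * x by ring.
    exact: D.
  have jr : (j0 <= j0 + l <= j0 + rdeg P - 1)%N.
    by case: (rdeg P) ln => // d; rewrite ltnS leq_addr addnS subn1 leq_add2l.
  have := I_rational (j0 + l)%N jr; congr rational_series; apply/funext => k.
  apply: eq_curve_integral => t t01.
  have [rP vP] := rvalX k (P_reg t t01); have [rQ vQ] := rvalX (j0 + l) (Q_reg t t01).
  have [rPQ vPQ] := rvalM rP rQ; have [_ v] := rvalM rPQ (dQ_reg t t01).
  by rewrite rmorphXn eval_atX v vPQ vP vQ.
have W10 : rval W (g 1) = rval W (g 0).
  exact/esym/(moments_endpoints (@tofr_inj R) reg_tof regD regM lam_linear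
    W_nonconst P_nonconstant W_reg P_reg Q_reg dW_reg dQ_reg
    (coprime_rnum_rden Pt) EN (rden_neq0 Pt) P_E dec' moments lam_deriv).
have log_integral p : root (rden Pt) p -> regular_along g (W - tofr p%:P)^-1 /\
    curve_integral g (rval ((W - tofr p%:P)^-1 * rderiv W)) = 0.
  (* W does not take the value p on the curve, since P = Pt(W) would have a pole there. *)
  move=> Ep; have Wp_reg : regular_along g (W - tofr p%:P)^-1.
    move=> t t01; have [rp vp] := rval_poly (- p%:P) (g t).
    have [rd vd] := rvalD (W_reg t t01) rp; rewrite rmorphN in rd vd vp.
    apply: (rvalV rd _).1; rewrite vd vp hornerN hornerC subr_eq0.
    apply/eqP => Wp; have [Pp _] := g_no_pole t t01; apply: Pp.
    by apply: etrans (PW _) _; rewrite W_rmap // Wp /= (rootP Ep) eqxx.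
  split=> //.
  exact: (moments_log_integral (@tofr_inj R) reg_tof regD regM lam_linear
    W_nonconst P_nonconstant W_reg P_reg Q_reg dW_reg dQ_reg
    (coprime_rnum_rden Pt) EN (rden_neq0 Pt) P_E dec' moments lam_deriv Ep Wp_reg).
have W_closed : closed_curve (fun t => rmap W (Some (g t))).
  by rewrite /closed_curve !W_rmap ?lexx ?ler01 // W10.
exists Pt, Qt, W; split; first exact: PW.
split; first exact: QW.
split; first exact: W_closed.
split; first exact: W_closed.
exact: (poles_on_one_side s0 sm s_incr gq W_nonconst W_reg W10 log_integral).
Qed.
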